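(* Let $d=2$ and consider first-passage percolation on $\mathbb{Z}^2$ with i.i.d. nonnegative edge weights $(\tau_e)$. Suppose $\mathbb{P}(\tau_e=0)<p_c(2)=1/2$ and $\mathbb{E}e^{\alpha\tau_e}<\infty$ for some $\alpha>0$. Then there exists $C>0$ such that $\mathbb{P}\big(M(t)\le C\,t\log t \text{ for all large } t\big)=1$.
   Context: Paths, passage times $T(\gamma)=\sum_{e\in\gamma}\tau_e$ and $T(x,y)=\inf_{\gamma:x\to y}T(\gamma)$ over nearest-neighbor paths in $\mathbb{Z}^2$ are as usual; $B(t)=\{x\in\mathbb{Z}^2:T(0,x)\le t\}$; $p_c(2)$ is the critical probability for Bernoulli bond percolation on $\mathbb{Z}^2$. $M(t)$ is the maximal number of vertices of a finite connected component of $\mathbb{Z}^2\setminus B(t)$. *)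

(* Defs.v *)
From HB Require Import structures.
From mathcomp Require Import all_boot all_order all_algebra.
From mathcomp Require Import all_classical all_reals.
From mathcomp Require Import ereal topology normedtype sequences exp measure lebesgue_measure lebesgue_integral probability.
Set Implicit Arguments. Unset Strict Implicit. Unset Printing Implicit Defensive.
Import Order.TTheory GRing.Theory Num.Theory.
Local Open Scope classical_set_scope.
Local Open Scope ring_scope.

Definition vtx := (int * int)%type.

(* Nearest-neighbour edges of Z^2: (v,false) = {v, v+e1}, (v,true) = {v, v+e2}.
   Each edge of Z^2 is represented exactly once. *)
Definition edge := (vtx * bool)%type.

Definition adj : rel vtx := fun a b =>
  (`|a.1 - b.1|%N + `|a.2 - b.2|%N == 1)%N.

Definition edge_of (a b : vtx) : edge :=
  if b == (a.1 + 1, a.2) then (a, false)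
  else if a == (b.1 + 1, b.2) then (b, false)
  else if b == (a.1, a.2 + 1) then (a, true)
  else (b, true).

Definition nn_path (x y : vtx) (p : seq vtx) : Prop :=
  path adj x p /\ last x p = y.

Definition path_time {R : realType} (w : edge -> R) (x : vtx) (p : seq vtx) : R :=
  \sum_(ab <- zip (x :: p) p) w (edge_of ab.1 ab.2).

Definition passage_time {R : realType} (w : edge -> R) (x y : vtx) : R :=
  inf [set path_time w x p | p in [set p | nn_path x y p]].

Definition origin : vtx := (0, 0).

Definition ball_B {R : realType} (w : edge -> R) (t : R) : set vtx :=
  [set x | passage_time w origin x <= t].

Definition connected_in (S : set vtx) (x y : vtx) : Prop :=
  exists p : seq vtx, [/\ nn_path x y p, S x & all (fun v => `[< S v >]) p].

Definition component (S C : set vtx) : Prop :=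
  exists2 x, S x & C = [set y | connected_in S x y].

Definition finite_component_size (S : set vtx) (n : nat) : Prop :=
  exists s : seq vtx, [/\ uniq s, component S [set` s] & size s = n].

(* M(t): maximal number of vertices of a finite connected component of
   Z^2 \ B(t)  (0 if there is no finite component). *)
Definition M_max {R : realType} (w : edge -> R) (t : R) : \bar R :=
  ereal_sup ([set (n%:R)%:E | n in finite_component_size (~` ball_B w t)]
             `|` [set 0%E]).

Definition iid_edge_weights {d} {T : measurableType d} {R : realType}
  (P : probability T R) (tau : edge -> T -> R) : Prop :=
  [/\ (forall e, measurable_fun setT (tau e)),
      (forall (s : seq edge) (B : edge -> set R), uniq s ->
         (forall e, measurable (B e)) ->
         P (\bigcap_(e in [set` s]) (tau e @^-1` B e))
           = (\prod_(e <- s) P (tau e @^-1` B e))%E) &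
      (forall e e' (B : set R), measurable B ->
         P (tau e @^-1` B) = P (tau e' @^-1` B))].

(* Main.v *)
Require Import Defs.
From HB Require Import structures.
From mathcomp Require Import all_boot all_order all_algebra.
From mathcomp Require Import all_classical all_reals.
From mathcomp Require Import ereal topology normedtype sequences derive realfun exp measure lebesgue_measure lebesgue_integral probability measurable_realfun.
From mathcomp Require Import zify ring lra.
Set Implicit Arguments. Unset Strict Implicit. Unset Printing Implicit Defensive.
Import Order.TTheory GRing.Theory Num.Theory.
Import numFieldNormedType.Exports.
Local Open Scope classical_set_scope.
Local Open Scope ring_scope.

(** The proof controls the shape of a hole [H] through two properties of the
    weights at scale [t], which hold almost surely for all large [t].

    (1) Linear growth: every self-avoiding path of length at least [C log t]
    near the origin has passage time at least [c] times its length.  By the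
    Duminil-Copin--Tassion differential inequality together with a count of
    boundary clusters and four-arm events, bond percolation at [p < 1/2] has a
    finite set [S] with [phi_p(S) < 1], hence exponential decay; a long
    self-avoiding path with few slow edges would produce many separated
    vertices connected to distance [l] by fast edges.

    (2) Symmetric concentration: up to [W = O(sqrt (t log t))], the passage time
    between two points is a function of the absolute coordinate differences.
    With [V e = exp (lam tau_e)], the minimum [Phi] over paths of the product of
    the [V e] is increasing, concave and subhomogeneous in each coordinate, and
    an induction over coordinates gives [E Phi(V) * E (1 / Phi(kappa V)) <= 1]
    for [kappa = 1 + C lam^2], whence exponential tails on both sides.

    Reflecting the end of a geodesic shows that [T(0, h) <= T(0, z) + 2 W] as
    soon as [h] is coordinatewise no farther from the axes than [z].  If [H]
    crossed a horizontal strip much higher than [W], take a geodesic to a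
    neighbour [y] of [H] lying to the right of [H] in the middle of the strip.
    It avoids [H], and by parity its last entrance [z] into the strip dominates a
    vertex [h] of [H]; but then [T(0, y) >= T(0, z) + c (height) > T(0, h)],
    contradicting [T(0, y) <= t < T(0, h)].  So [H] has diameter
    [O(sqrt (t log t))]. *)

(** * Expectation over finitely many independent coordinates *)

(** A diameter of order [sqrt (t log t)] is the size of a fluctuation bound, far below what is
    controlled about the limit shape or about the centring of passage times. Hence only passage
    times of equal law are ever compared: those of pairs of points exchanged by a reflection, for
    which the unknown centring cancels. The scale comes from taking [lam] of order
    [sqrt (log t / t)]: for paths of [O(t)] edges the exponent [C lam^2 t - lam W] is then a
    negative multiple of [log t], as large as one likes, and beats a union bound over polynomially
    many pairs of points. The delicate point is the one-variable inequality for unbounded weights,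
    where very large values must be paid for by the exponential moment. All probabilities are
    computed as finite sums over finitely many coordinates with finitely supported laws: weights are
    reduced to fast or slow, or rounded to multiples of [1/n] and capped, and only then carried to
    the probability space. The bound on a hole is deterministic on the resulting event, so [M_max]
    enters only pointwise. *)

Section ProductExpectation.
Variable R : realType.

Section Generic.
Variables (I : eqType) (W : Type).
Implicit Types (l : seq (R * W)) (s : seq I) (f g : I -> W) (F G : (I -> W) -> R).

Definition upd f (e : I) (v : W) : I -> W := fun x => if x == e then v else f x.

(* Expectation of [F] when the coordinates listed in [s] are independent with
   law [l] (a list of weighted values) and the others are frozen to [f]. *)
Fixpoint Ex l s F f : R :=
  if s is e :: s' then \sum_(x <- l) x.1 * Ex l s' F (upd f e x.2) else F f.

Definition law l := all (fun x => 0 <= x.1) l /\ \sum_(x <- l) x.1 = 1.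

Definition dep (A : pred I) F :=
  forall f g, (forall e, A e -> f e = g e) -> F f = F g.

Lemma updC f e1 e2 v1 v2 : e1 != e2 ->
  upd (upd f e1 v1) e2 v2 = upd (upd f e2 v2) e1 v1.
Proof.
move=> ne; apply/funext => x; rewrite /upd.
by case: (x =P e1) => [->|//]; case: (x =P e2) => [e12|//]; rewrite (negPf ne).
Qed.

Lemma upd_id f e : upd f e (f e) = f.
Proof. by apply/funext => x; rewrite /upd; case: eqP => [->|]. Qed.

Lemma eq_Ex l s F G f : (forall f, F f = G f) -> Ex l s F f = Ex l s G f.
Proof. by move=> FG; rewrite (_ : F = G) //; apply/funext. Qed.

Lemma wsum_le l (a b : W -> R) : all (fun x => 0 <= x.1) l ->
  (forall v, a v <= b v) -> \sum_(x <- l) x.1 * a x.2 <= \sum_(x <- l) x.1 * b x.2.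
Proof.
move=> l0 ab; elim: l l0 => [|x l IH] /=; first by rewrite !big_nil.
by case/andP => x0 l0; rewrite !big_cons lerD ?IH // ler_wpM2l.
Qed.

Lemma Ex_le l s F G f : law l -> (forall f, F f <= G f) -> Ex l s F f <= Ex l s G f.
Proof.
move=> [l0 _] FG; elim: s f => [|e s IH] f //=.
by apply: (@wsum_le l (fun v => Ex l s F (upd f e v)) (fun v => Ex l s G (upd f e v))).
Qed.

Lemma ExD l s F G f : Ex l s (fun f => F f + G f) f = Ex l s F f + Ex l s G f.
Proof.
elim: s f => [|e s IH] f //=.
by rewrite -big_split /=; apply: eq_bigr => x _; rewrite IH mulrDr.
Qed.

Lemma ExZ l s c F f : Ex l s (fun f => c * F f) f = c * Ex l s F f.
Proof.
elim: s f => [|e s IH] f //=.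
by rewrite big_distrr /=; apply: eq_bigr => x _; rewrite IH mulrCA.
Qed.

Lemma ExZr l s c F f : Ex l s (fun f => F f * c) f = Ex l s F f * c.
Proof. by rewrite mulrC -ExZ; apply: eq_Ex => g; rewrite mulrC. Qed.

Lemma ExN l s F f : Ex l s (fun f => - F f) f = - Ex l s F f.
Proof. by rewrite -mulN1r -ExZ; apply: eq_Ex => g; rewrite mulN1r. Qed.

Lemma ExB l s F G f : Ex l s (fun f => F f - G f) f = Ex l s F f - Ex l s G f.
Proof. by rewrite ExD ExN. Qed.

Lemma Ex_cst l s c f : law l -> Ex l s (fun=> c) f = c.
Proof.
move=> [_ l1]; elim: s f => [|e s IH] f //=.
by under eq_bigr do rewrite IH; rewrite -big_distrl /= l1 mul1r.
Qed.

Lemma Ex_ge0 l s F f : law l -> (forall f, 0 <= F f) -> 0 <= Ex l s F f.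
Proof. by move=> hl F0; rewrite -(Ex_cst s 0 f hl); apply: Ex_le. Qed.

Lemma Ex_sum l s f (J : Type) (r : seq J) (H : J -> (I -> W) -> R) :
  Ex l s (fun f => \sum_(j <- r) H j f) f = \sum_(j <- r) Ex l s (H j) f.
Proof.
elim: r => [|j r IH].
  rewrite big_nil; under eq_Ex do rewrite big_nil.
  by under eq_Ex do rewrite -[0](mul0r 0); rewrite ExZ mul0r.
by rewrite big_cons -IH -ExD; apply: eq_Ex => g; rewrite big_cons.
Qed.

Lemma Ex_agree l s (A : pred I) F f g : dep A F ->
  (forall e, A e -> e \notin s -> f e = g e) -> Ex l s F f = Ex l s F g.
Proof.
move=> dF; elim: s f g => [|e s IH] f g fg /=.
  by apply: dF => e Ae; apply: fg.
apply: eq_bigr => x _; congr (_ * _); apply: IH => e' Ae' es'.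
rewrite /upd; case: (e' =P e) => // /eqP ne.
by apply: fg; rewrite // inE negb_or ne.
Qed.

Lemma Ex_cons_notin l s (A : pred I) F f e : law l -> dep A F -> ~~ A e ->
  Ex l (e :: s) F f = Ex l s F f.
Proof.
move=> [_ l1] dF Ae /=.
under eq_bigr => x _.
  rewrite (@Ex_agree _ s A F _ f) //; last first.
    by move=> e' Ae' _; rewrite /upd; case: eqP Ae => // <-; rewrite Ae'.
  over.
by rewrite -big_distrl /= l1 mul1r.
Qed.

Lemma Ex_filter l s (A : pred I) F f : law l -> dep A F ->
  Ex l s F f = Ex l [seq x <- s | A x] F f.
Proof.
move=> hl dF; elim: s f => [|e s IH] f //.
rewrite [X in _ = Ex _ X _ _]/=; case: ifPn => Ae; last by rewrite (Ex_cons_notin _ _ hl dF).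
by rewrite /=; apply: eq_bigr => x _; rewrite IH.
Qed.

Lemma Ex_upd l s F f e v : e \notin s ->
  Ex l s (fun f => F (upd f e v)) f = Ex l s F (upd f e v).
Proof.
elim: s f => [|e' s IH] f //=; rewrite inE negb_or => /andP[ne es].
by apply: eq_bigr => x _; rewrite IH // updC // eq_sym.
Qed.

Lemma Ex_swap l s F f e1 e2 : e1 != e2 ->
  Ex l (e1 :: e2 :: s) F f = Ex l (e2 :: e1 :: s) F f.
Proof.
move=> ne /=; under eq_bigr do rewrite big_distrr /=.
rewrite exchange_big /=; apply: eq_bigr => x _; rewrite big_distrr /=.
by apply: eq_bigr => y _; rewrite mulrCA updC.
Qed.

Lemma Ex_middle l a b F f e : e \notin a ->
  Ex l (a ++ e :: b) F f = Ex l (e :: a ++ b) F f.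
Proof.
elim: a f => [|e' a IH] f //; rewrite inE negb_or => /andP[ne ea].
rewrite !cat_cons Ex_swap //=.
by apply: eq_bigr => x _; rewrite IH.
Qed.

Lemma Ex_perm l s1 s2 F f : uniq s1 -> perm_eq s1 s2 ->
  Ex l s1 F f = Ex l s2 F f.
Proof.
elim: s1 s2 f => [|e s1 IH] s2 f.
  by rewrite perm_sym => _ /perm_nilP ->.
move=> /= /andP[es1 us1] pe.
have es2 : e \in s2 by rewrite -(perm_mem pe) mem_head.
case/splitPr: es2 pe => a b pe.
have u2 : uniq (a ++ e :: b) by rewrite -(perm_uniq pe) /= es1.
have ea : e \notin a.
  by move: u2; rewrite cat_uniq /= negb_or => /and3P[_ /andP[]].
rewrite Ex_middle //=; apply: eq_bigr => x _; rewrite (IH (a ++ b)) //.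
by rewrite -(perm_cons e) (perm_trans pe) // (perm_catCA a [:: e] b).
Qed.

(** Coordinates outside [A] integrate to one, so only the trace of the list on [A] matters. This is
    what allows the same event to be measured in boxes of different sizes. *)
Lemma Ex_same l s1 s2 (A : pred I) F f : law l -> dep A F -> uniq s1 -> uniq s2 ->
  (forall e, A e -> (e \in s1) = (e \in s2)) -> Ex l s1 F f = Ex l s2 F f.
Proof.
move=> hl dF u1 u2 As; rewrite (Ex_filter s1 f hl dF) (Ex_filter s2 f hl dF).
apply: Ex_perm; first exact: filter_uniq.
apply: uniq_perm; rewrite ?filter_uniq // => e.
by rewrite !mem_filter; case Ae : (A e) => //=; exact: As.
Qed.

Lemma dep_mul (A B : pred I) F G : dep A F -> dep B G ->
  dep (fun e => A e || B e) (fun f => F f * G f).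
Proof.
move=> dF dG f g fg; rewrite (dF f g) ?(dG f g) // => e h; apply: fg; rewrite h //.
by rewrite orbT.
Qed.

(** Each coordinate belongs to at most one of the two supports, so the other factor can be taken out
    of its sum. *)
Lemma Ex_indep l s (A B : pred I) F G f : law l -> dep A F -> dep B G ->
  (forall e, A e -> B e -> false) ->
  Ex l s (fun f => F f * G f) f = Ex l s F f * Ex l s G f.
Proof.
move=> hl dF dG AB; elim: s f => [|e s IH] f //.
have dFG := dep_mul dF dG.
case Ae : (A e); last case Be : (B e).
- have Be : ~~ B e by apply/negP => /(AB _ Ae).
  rewrite (Ex_cons_notin s f hl dG Be) /= big_distrl /=; apply: eq_bigr => x _.
  rewrite IH mulrA; congr (_ * _); apply: (Ex_agree _ dG) => e' Be' _.
  by rewrite /upd; case: eqP Be => // <-; rewrite Be'.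
- rewrite (Ex_cons_notin s f hl dF (negbT Ae)) /= big_distrr /=; apply: eq_bigr => x _.
  rewrite IH mulrCA; congr (_ * _); apply: (Ex_agree _ dF) => e' Ae' _.
  by rewrite /upd; case: eqP Ae => // <-; rewrite Ae'.
rewrite (Ex_cons_notin s f hl dFG) ?Ae ?Be //.
by rewrite (Ex_cons_notin s f hl dF) ?Ae // (Ex_cons_notin s f hl dG) ?Be.
Qed.

Lemma Ex_prod_indep l s f (J : eqType) (X : seq J) (A : J -> pred I)
    (H : J -> (I -> W) -> R) :
  law l -> uniq X -> (forall x, dep (A x) (H x)) ->
  (forall x y e, x \in X -> y \in X -> A x e -> A y e -> x = y) ->
  Ex l s (fun f => \prod_(x <- X) H x f) f = \prod_(x <- X) Ex l s (H x) f.
Proof.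
move=> hl; elim: X => [|x X IH] /=.
  by move=> *; rewrite big_nil; under eq_Ex do rewrite big_nil; rewrite Ex_cst.
move=> /andP[xX uX] dH disj; rewrite big_cons -IH //; last first.
  by move=> a b e aX bX; apply: disj; rewrite inE ?aX ?bX orbT.
under eq_Ex do rewrite big_cons.
apply: (@Ex_indep _ _ (A x) (fun e => has (fun y => A y e) X)) => //.
  move=> f1 f2 f12; apply: eq_big_seq => y yX; apply: dH => e Aye.
  by apply: f12; apply/hasP; exists y.
move=> e Axe /hasP[y yX Aye].
have xy : x = y by apply: (disj _ _ e) => //; rewrite inE ?eqxx ?yX ?orbT.
by rewrite xy yX in xX.
Qed.

(** Conditioning on the value of a random set. Once [K f] is frozen to [S], the event [K f == S] and
    the function [G S] can have disjoint supports although [G (K f) f] has no product form. *)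
Lemma Ex_decouple l s f (J : eqType) (K : (I -> W) -> J) (vals : seq J)
    (G : J -> (I -> W) -> R) : uniq vals -> (forall f, K f \in vals) ->
  Ex l s (fun f => G (K f) f) f =
  \sum_(S <- vals) Ex l s (fun f => (K f == S)%:R * G S f) f.
Proof.
move=> uv Kv; rewrite -Ex_sum; apply: eq_Ex => g.
rewrite (bigD1_seq (K g)) //= eqxx mul1r big1 ?addr0 // => S.
by rewrite eq_sym => /negPf ->; rewrite mul0r.
Qed.

End Generic.

Lemma Ex_map_index (I J : eqType) (W : Type) (l : seq (R * W)) (s : seq I)
    (u : I -> J) (u' : J -> I) (F : (J -> W) -> R) (g : J -> W) :
  cancel u u' -> cancel u' u ->
  Ex l (map u s) F g = Ex l s (fun f => F (f \o u')) (g \o u).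
Proof.
move=> uK u'K; elim: s g => [|e s IH] g /=.
  by congr F; apply/funext => x /=; rewrite u'K.
apply: eq_bigr => x _; rewrite IH; congr (_ * Ex _ _ _ _); apply/funext => y /=.
by rewrite /upd (can_eq uK).
Qed.

Lemma Ex_map_law (I : eqType) (W W' : Type) (l : seq (R * W)) (s : seq I)
    (h : W -> W') (F : (I -> W') -> R) (g : I -> W) :
  Ex [seq (x.1, h x.2) | x <- l] s F (h \o g) = Ex l s (fun f => F (h \o f)) g.
Proof.
elim: s g => [|e s IH] g //=; rewrite big_map; apply: eq_bigr => x _ /=.
rewrite -IH; congr (_ * Ex _ _ _ _); apply/funext => y /=.
by rewrite /upd; case: eqP.
Qed.

(** * Bernoulli laws: FKG, Russo's formula, cost of forcing edges *)

Section Bernoulli.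
Variable I : eqType.
Implicit Types (s b : seq I) (f g : I -> bool) (F G : (I -> bool) -> R).

Definition pb (q : R) : seq (R * bool) := [:: (q, true); (1 - q, false)].

Lemma law_pb q : 0 <= q <= 1 -> law (pb q).
Proof.
case/andP=> q0 q1; split; first by rewrite /= q0 subr_ge0 q1.
by rewrite /pb big_cons big_seq1 /=; ring.
Qed.

Lemma Ex_pb_cons q s F f e : Ex (pb q) (e :: s) F f =
  q * Ex (pb q) s F (upd f e true) + (1 - q) * Ex (pb q) s F (upd f e false).
Proof. by rewrite /= /pb big_cons big_seq1. Qed.

Definition incr F := forall f g, (forall e, f e -> g e) -> F f <= F g.
Definition decr F := forall f g, (forall e, f e -> g e) -> F g <= F f.

Lemma Ex_incr q s F : 0 <= q <= 1 -> incr F -> incr (Ex (pb q) s F).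
Proof.
move=> q01 iF; elim: s => [//|e s IH] f g fg; rewrite !Ex_pb_cons.
case/andP: q01 => q0 q1.
by apply: lerD; apply: ler_wpM2l; rewrite ?subr_ge0 //; apply: IH => x;
   rewrite /upd; case: ifP => // _; apply: fg.
Qed.

Lemma upd_le f e : forall x, upd f e false x -> upd f e true x.
Proof. by move=> x; rewrite /upd; case: ifP. Qed.

(** Induction on the coordinates: the two expectations with [e] open or closed are ordered in the
    same way for [F] and [G], and [q * (1 - q) * ((a1 - a0) * (b1 - b0))] is the covariance
    contributed by [e]. *)
Lemma FKG q s F G f : 0 <= q <= 1 -> incr F -> incr G ->
  Ex (pb q) s F f * Ex (pb q) s G f <= Ex (pb q) s (fun f => F f * G f) f.
Proof.
move=> q01 iF iG; elim: s f => [//|e s IH] f; rewrite !Ex_pb_cons.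
have [q0 q1] := andP q01.
have hF := Ex_incr s q01 iF (@upd_le f e).
have hG := Ex_incr s q01 iG (@upd_le f e).
have := IH (upd f e true); have := IH (upd f e false).
set a1 := Ex _ s F (upd f e true) in hF *; set a0 := Ex _ s F (upd f e false) in hF *.
set b1 := Ex _ s G (upd f e true) in hG *; set b0 := Ex _ s G (upd f e false) in hG *.
set c1 := Ex _ s _ (upd f e true); set c0 := Ex _ s _ (upd f e false).
move=> h0 h1.
have : 0 <= q * (1 - q) * ((a1 - a0) * (b1 - b0)).
  by rewrite !mulr_ge0 // ?subr_ge0.
have h2 : q * (a1 * b1) <= q * c1 by apply: ler_wpM2l.
have h3 : (1 - q) * (a0 * b0) <= (1 - q) * c0 by apply: ler_wpM2l; rewrite ?subr_ge0.
by lra.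
Qed.

Lemma FKG_decr q s F G f : 0 <= q <= 1 -> decr F -> decr G ->
  Ex (pb q) s F f * Ex (pb q) s G f <= Ex (pb q) s (fun f => F f * G f) f.
Proof.
move=> q01 dF dG.
have := @FKG q s (fun f => - F f) (fun f => - G f) f q01.
rewrite !ExN mulrNN => h; apply: (le_trans (h _ _)).
- by move=> g g' gg'; rewrite lerN2 dF.
- by move=> g g' gg'; rewrite lerN2 dG.
by rewrite (eq_Ex _ _ _ (fun g => mulrNN (F g) (G g))).
Qed.

Lemma Ex_pb_mono q q' s F f : 0 <= q -> q <= q' -> q' <= 1 -> incr F ->
  Ex (pb q) s F f <= Ex (pb q') s F f.
Proof.
move=> q0 qq' q1 iF; elim: s f => [//|e s IH] f; rewrite !Ex_pb_cons.
have := IH (upd f e true); have := IH (upd f e false).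
have q01' : 0 <= q' <= 1 by rewrite q1 (le_trans q0).
have := Ex_incr s q01' iF (@upd_le f e).
set a1 := Ex (pb q) s F (upd f e true); set a0 := Ex (pb q) s F (upd f e false).
set b1 := Ex (pb q') s F (upd f e true); set b0 := Ex (pb q') s F (upd f e false).
by move=> h1 h2 h3; nra.
Qed.

Lemma Ex_pb_flip q s F f :
  Ex (pb q) s (fun f => F (negb \o f)) f = Ex (pb (1 - q)) s F (negb \o f).
Proof.
elim: s f => [//|e s IH] f; rewrite !Ex_pb_cons !IH addrC.
have h v : negb \o upd f e v = upd (negb \o f) e (~~ v).
  by apply/funext => x /=; rewrite /upd; case: eqP.
by rewrite !h /=; congr (_ * _ + _ * _); ring.
Qed.

(** For the indicator of an increasing event, this is the indicator that [e] is pivotal. *)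
Definition dif (e : I) F : (I -> bool) -> R :=
  fun f => F (upd f e true) - F (upd f e false).

(** Product rule: differentiating the weight of the first coordinate leaves the difference of the
    two frozen expectations, which is the expectation of [dif e F] since that function no longer
    depends on [e]. *)
Lemma Russo (q : R) s F f : uniq s ->
  is_derive q (1 : R) (fun q : R => Ex (pb q) s F f)
    (\sum_(e <- s) Ex (pb q) s (dif e F) f).
Proof.
elim: s f => [|e s IH] f.
  by move=> _; rewrite big_nil; exact: is_derive_cst.
move=> /= /andP[es us]; rewrite big_cons.
have {}IH g := IH g us.
rewrite (_ : (fun q0 : R => _) = fun q : R =>
  q * Ex (pb q) s F (upd f e true) + (1 - q) * Ex (pb q) s F (upd f e false));
  last by apply/funext => r; rewrite /pb big_cons big_seq1.
apply: is_derive_eq.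
rewrite /pb !big_cons !big_nil /= -/(pb q) addr0.
have hd v : Ex (pb q) s (dif e F) (upd f e v) =
    Ex (pb q) s F (upd f e true) - Ex (pb q) s F (upd f e false).
  have uu w w' : upd (upd f e w) e w' = upd f e w'.
    by apply/funext => x; rewrite /upd; case: eqP.
  by rewrite /dif ExB (@Ex_upd _ _ _ _ _ _ _ true) // (@Ex_upd _ _ _ _ _ _ _ false) // !uu.
rewrite !hd.
under [X in _ = _ + X]eq_bigr => e' _ do rewrite big_cons big_seq1 /=.
rewrite big_split /= -!big_distrr /= /GRing.scale /=; ring.
Qed.

Definition setb b (v : bool) f : I -> bool := fun e => if e \in b then v else f e.

(** Finite energy: each state of an edge has probability at least [c], so forcing that state changes
    the expectation of a nonnegative function by at most a factor [1 / c]. *)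
Lemma Ex_fix_coord (q c : R) s H f e v : 0 <= q <= 1 -> 0 <= c -> c <= q -> c <= 1 - q ->
  (forall f, 0 <= H f) -> uniq s -> e \in s ->
  c * Ex (pb q) s (fun f => H (upd f e v)) f <= Ex (pb q) s H f.
Proof.
move=> q01 c0 cq cq' H0; elim: s f => [//|e' s IH] f /= /andP[es us].
have hl := law_pb q01; have [q0 q1] := andP q01.
have P0 g : 0 <= Ex (pb q) s H g by apply: Ex_ge0.
rewrite inE; case: (e =P e') => [e'E|/eqP ne] /=.
  move=> _; have ees : e \notin s by rewrite e'E.
  rewrite -e'E /pb !big_cons !big_nil /= -/(pb q) !addr0.
  have uu w w' : upd (upd f e w) e w' = upd f e w'.
    by apply/funext => x; rewrite /upd; case: eqP.
  rewrite !(@Ex_upd _ _ _ _ _ _ _ v) // !uu.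
  have := P0 (upd f e true); have := P0 (upd f e false).
  by clear IH; case: v => h1 h2; nra.
move=> es'; rewrite /pb !big_cons !big_nil /= -/(pb q) !addr0.
have h1 := IH (upd f e' true) us es'; have h2 := IH (upd f e' false) us es'.
rewrite mulrDr ![c * (_ * _)]mulrCA.
by apply: lerD; apply: ler_wpM2l; rewrite ?subr_ge0.
Qed.

Lemma Ex_fix_block (q c : R) s b H f v : 0 <= q <= 1 -> 0 <= c -> c <= q -> c <= 1 - q ->
  (forall f, 0 <= H f) -> uniq s -> {subset b <= s} ->
  c ^+ size b * Ex (pb q) s (fun f => H (setb b v f)) f <= Ex (pb q) s H f.
Proof.
move=> q01 c0 cq cq' H0 us; elim: b H H0 => [|e b IH] H H0 bs.
  by rewrite expr0 mul1r (_ : (fun f => _) = H).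
have es : e \in s by apply: bs; rewrite mem_head.
apply: le_trans (Ex_fix_coord f v q01 c0 cq cq' H0 us es).
rewrite /= exprS -mulrA; apply: ler_wpM2l => //.
apply: le_trans (IH (fun f => H (upd f e v)) (fun f => H0 _) _); last first.
  by move=> x xb; apply: bs; rewrite inE xb orbT.
apply: ler_wpM2l; first exact: exprn_ge0.
rewrite le_eqVlt; apply/orP; left; apply/eqP; apply: eq_Ex => g.
by congr H; apply/funext => x; rewrite /setb /upd inE; case: eqP.
Qed.

(** Opening a closed block edge by edge turns the total change into a telescoping sum of single-edge
    changes, in which the other edges of the block are forced. Finite energy removes the forcing at
    a cost of [c] per edge. *)
Lemma Ex_block_dif (q c : R) s b F f : 0 <= q <= 1 -> 0 <= c -> c <= q -> c <= 1 - q ->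
  c <= 1 -> decr F -> uniq s -> {subset b <= s} ->
  c ^+ size b * Ex (pb q) s (fun f => F (setb b false f) - F (setb b true f)) f
  <= \sum_(e <- b) Ex (pb q) s (fun f => - dif e F f) f.
Proof.
move=> q01 c0 cq cq' c1 dF us; have hl := law_pb q01.
elim: b F dF => [|e b IH] F dF bs.
  rewrite big_nil expr0 mul1r; under eq_Ex do rewrite /setb /= subrr.
  by rewrite Ex_cst.
have bs' : {subset b <= s} by move=> x xb; apply: bs; rewrite inE xb orbT.
have es : e \in s by apply: bs; rewrite mem_head.
(* The change at [e] is taken with the rest of the block closed; [F'] then treats the rest of the
   block with [e] already open. *)
pose F' := fun f => F (upd f e true).
have dF' : decr F'.
  by move=> g g' gg'; apply: dF => x; rewrite /upd; case: ifP => // _; apply: gg'.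
have difge0 e' F0 g : decr F0 -> 0 <= - dif e' F0 g.
  by move=> dF0; rewrite /dif opprB subr_ge0; apply: dF0; apply: upd_le.
have seteq v g : setb (e :: b) v g = upd (setb b v g) e v.
  by apply/funext => x; rewrite /setb /upd inE; case: eqP.
rewrite big_cons.
have -> : Ex (pb q) s (fun f => F (setb (e :: b) false f) - F (setb (e :: b) true f)) f =
    Ex (pb q) s (fun f => - dif e F (setb b false f)) f +
    Ex (pb q) s (fun f => F' (setb b false f) - F' (setb b true f)) f.
  rewrite -ExD; apply: eq_Ex => g; rewrite !seteq /F' /dif; ring.
rewrite mulrDr; apply: lerD.
  apply: le_trans (@Ex_fix_block q c s b (fun f => - dif e F f) f false q01 c0 cq cq' _ us bs') => //.
    apply: ler_wpM2r; first by apply: Ex_ge0 => // g; apply: difge0.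
    by rewrite /= exprS ler_piMl ?exprn_ge0.
  by move=> g; apply: difge0.
rewrite /= exprS -mulrA; apply: le_trans (ler_wpM2l c0 (IH F' dF' bs')) _.
rewrite big_distrr /= big_seq [leRHS]big_seq; apply: ler_sum => e' e'b.
case: (e' =P e) => [->|/eqP ne].
  have -> : Ex (pb q) s (fun f => - dif e F' f) f = 0.
    rewrite -(Ex_cst s 0 f hl); apply: eq_Ex => g; rewrite /dif /F'.
    have uu w w' : upd (upd g e w) e w' = upd g e w'.
      by apply/funext => x; rewrite /upd; case: eqP.
    by rewrite !uu subrr oppr0.
  by rewrite mulr0; apply: Ex_ge0 => // g; apply: difge0.
apply: le_trans (Ex_fix_coord f true q01 c0 cq cq' _ us es); last first.
  by move=> g; apply: difge0.
apply: ler_wpM2l => //; rewrite le_eqVlt; apply/orP; left; apply/eqP.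
by apply: eq_Ex => g; rewrite /dif /F' !(@updC _ _ g e e') // eq_sym.
Qed.

End Bernoulli.
End ProductExpectation.

(** * Lattice paths and crossing parity *)

Section Reach.
Variable T : eqType.
Implicit Types (e : rel T) (A : pred T) (x y : T).

Definition reach e x y : Prop := exists2 p, path e x p & last x p = y.

Definition on A e : rel T := fun a b => [&& e a b, A a & A b].

Lemma reach_refl e x : reach e x x. Proof. by exists [::]. Qed.

Lemma reach1 e x y : e x y -> reach e x y.
Proof. by move=> exy; exists [:: y] => //=; rewrite exy. Qed.

Lemma reach_trans e x y z : reach e x y -> reach e y z -> reach e x z.
Proof.
move=> [p pp <-] [q pq <-]; exists (p ++ q); last by rewrite last_cat.
by rewrite cat_path pp.
Qed.

Lemma reach_sym e x y : symmetric e -> reach e x y -> reach e y x.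
Proof.
move=> se [p pp <-]; exists (rev (belast x p)).
  by rewrite rev_path; apply: sub_path pp => a b; rewrite se.
by case: p {pp} => [//|z p]; rewrite [belast _ _]/= rev_cons last_rcons.
Qed.

Lemma reach_sub e e' x y : (forall a b, e a b -> e' a b) -> reach e x y -> reach e' x y.
Proof. by move=> ee' [p pp <-]; exists p => //; apply: sub_path pp. Qed.

Lemma reach_inv e (Q : T -> Prop) x y : (forall a b, e a b -> Q a -> Q b) ->
  Q x -> reach e x y -> Q y.
Proof.
move=> step Qx [p pp <-]; elim: p x Qx pp => [//|a p IH] x Qx /= /andP[exa pa].
by apply: IH => //; apply: step Qx.
Qed.

Lemma reach_exit e A x y : A x -> ~~ A y -> reach e x y ->
  exists a b, [/\ reach (on A e) x a, A a, ~~ A b & e a b].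
Proof.
move=> Ax Ay [p pp ly]; elim: p x Ax pp ly => [|b p IH] x Ax /=.
  by move=> _ xy; rewrite -xy Ax in Ay.
case/andP => exb pb lb; case Ab : (A b); last first.
  by exists x, b; split; rewrite ?Ab //; apply: reach_refl.
have [a [b' [ra Aa Ab' eab]]] := IH b Ab pb lb.
exists a, b'; split=> //; apply: reach_trans ra.
by apply: reach1; rewrite /on exb Ax Ab.
Qed.

Lemma reach_last_exit e A x y : A x -> ~~ A y -> reach e x y ->
  exists a b, [/\ A a, ~~ A b, e a b & reach (on (predC A) e) b y].
Proof.
move=> Ax Ay [p pp ly]; elim: p x Ax pp ly => [|b p IH] x Ax /=.
  by move=> _ xy; rewrite -xy Ax in Ay.
case/andP => exb pb lb; case Ab : (A b); first exact: IH Ab pb lb.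
have [[p' pp' lp']|nh] := pselect (reach (on (predC A) e) b y).
  by exists x, b; split; rewrite ?Ab //; exists p'.
suff [c [d [Ac Ad ecd pd]]] : exists c d, [/\ A c, ~~ A d, e c d & reach (on (predC A) e) d y].
  by exists c, d.
have : has A p.
  apply: contra_notT nh => hA; exists p => //.
  move: Ab pb hA; elim: (p) b {lb IH exb} => [//|c q IHq] b /= Ab /andP[ebc pq].
  by rewrite negb_or => /andP[Ac hq]; rewrite /on /= ebc Ab Ac /=; apply: IHq => //; apply/negbTE.
case/hasP => c cp Ac; case/splitPr: cp pb lb => p1 p2.
rewrite cat_path last_cat /= => /and3P[_ _ pc] lc.
(* the path to [c] is discarded: any exit after a later visit will do *)
have [n] := ubnP (size p2); elim: n c p2 Ac pc lc => // n IHn c p2 Ac.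
case: p2 => [|d p2] /=; first by move=> _ cy; rewrite -cy Ac in Ay.
case/andP => ecd pd ld sz.
case Ad : (A d); first exact: (IHn d p2).
have [hr|nr] := pselect (reach (on (predC A) e) d y).
  by exists c, d; rewrite Ad.
have : has A p2.
  apply: contra_notT nr => hA; exists p2 => //.
  move: Ad pd hA; elim: (p2) d {ld sz ecd} => [//|c' q IHq] d /= Ad /andP[ebc pq].
  by rewrite negb_or => /andP[Ac' hq]; rewrite /on /= ebc Ad Ac' /=; apply: IHq => //; apply/negbTE.
case/hasP => c' cp Ac'; case/splitPr: cp pd ld sz => q1 q2.
rewrite cat_path last_cat size_cat /= => /and3P[_ _ pc] lc sz.
apply: (IHn c' q2) => //; lia.
Qed.

End Reach.

Section Indicator.
Variable R : realType.
Definition ind (P : Prop) : R := (`[< P >])%:R.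

Lemma ind_ge0 P : 0 <= ind P. Proof. exact: ler0n. Qed.
Lemma ind_le1 P : ind P <= 1. Proof. by rewrite /ind lern1 leq_b1. Qed.
Lemma ind1 P : P -> ind P = 1. Proof. by move=> p; rewrite /ind asboolT. Qed.
Lemma ind0 P : ~ P -> ind P = 0. Proof. by move=> p; rewrite /ind asboolF. Qed.
Lemma le_ind P Q : (P -> Q) -> ind P <= ind Q.
Proof.
move=> PQ; have [p|p] := pselect P; last by rewrite ind0 // ind_ge0.
by rewrite !ind1 //; apply: PQ.
Qed.
Lemma eq_ind_iff P Q : (P <-> Q) -> ind P = ind Q.
Proof. by move=> [PQ QP]; apply/eqP; rewrite eq_le !le_ind. Qed.
Lemma ind_and P Q : ind (P /\ Q) = ind P * ind Q.
Proof. by rewrite /ind asbool_and; case: asboolP; case: asboolP; rewrite ?(mulr1,mulr0). Qed.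
Lemma ind_not P : ind (~ P) = 1 - ind P.
Proof. by rewrite /ind asbool_neg; case: asboolP => _; rewrite ?(subrr,subr0). Qed.
Lemma ind_bool (b : bool) : ind b = b%:R.
Proof. by rewrite /ind asboolb. Qed.

Lemma dep_ind (I : eqType) W (A : pred I) (P : (I -> W) -> Prop) :
  (forall f g, (forall e, A e -> f e = g e) -> P f -> P g) ->
  dep A (fun f => ind (P f)).
Proof. by move=> h f g fg; apply: eq_ind_iff; split; apply: h => // e Ae; rewrite fg. Qed.

Lemma incr_ind (I : eqType) (P : (I -> bool) -> Prop) :
  (forall f g : I -> bool, (forall e, f e -> g e) -> P f -> P g) ->
  incr (fun f => ind (P f)).
Proof. by move=> h f g fg; apply: le_ind; apply: h. Qed.
End Indicator.
Arguments ind R P : clear implicits.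

Section Lattice.
Implicit Types (a b x y v : vtx) (e : edge) (w : edge -> bool) (D : pred vtx).

Definition src e : vtx := e.1.
Definition tgt e : vtx := if e.2 then (e.1.1, e.1.2 + 1) else (e.1.1 + 1, e.1.2).

Lemma adj_cases a b : adj a b -> [\/ b = (a.1 + 1, a.2) /\ edge_of a b = (a, false),
  b = (a.1 - 1, a.2) /\ edge_of a b = ((a.1 - 1, a.2), false),
  b = (a.1, a.2 + 1) /\ edge_of a b = (a, true) |
  b = (a.1, a.2 - 1) /\ edge_of a b = ((a.1, a.2 - 1), true)].
Proof.
case: a b => [a1 a2] [b1 b2]; rewrite /adj /= => h.
have : [\/ b1 = a1 + 1 /\ b2 = a2, b1 = a1 - 1 /\ b2 = a2,
          b1 = a1 /\ b2 = a2 + 1 | b1 = a1 /\ b2 = a2 - 1].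
  have : (b1 = a1 + 1 /\ b2 = a2) \/ (b1 = a1 - 1 /\ b2 = a2) \/
          (b1 = a1 /\ b2 = a2 + 1) \/ (b1 = a1 /\ b2 = a2 - 1) by lia.
  by case=> [?|[?|[?|?]]]; [apply: Or41|apply: Or42|apply: Or43|apply: Or44].
rewrite /edge_of /= !xpair_eqE.
case=> -[-> ->]; [apply: Or41|apply: Or42|apply: Or43|apply: Or44]; split=> //.
- by rewrite !eqxx.
- rewrite (_ : (a1 - 1 == a1 + 1) = false) /=; last by lia.
  by rewrite subrK !eqxx.
- rewrite (_ : (a1 == a1 + 1) = false) /=; last by lia.
  by rewrite !eqxx.
- rewrite (_ : (a1 == a1 + 1) = false) /=; last by lia.
  by rewrite eqxx (_ : (a2 - 1 == a2 + 1) = false) //; lia.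
Qed.

Lemma adj_sym : symmetric adj.
Proof. by move=> a b; rewrite /adj !(distnC a.1) !(distnC a.2). Qed.

Lemma edge_of_sym a b : adj a b -> edge_of a b = edge_of b a.
Proof.
move: a b => [a1 a2] [b1 b2] ab; have := ab; rewrite adj_sym => /adj_cases ba.
case/adj_cases: ab => -[/= [e1 e2] ->]; case: ba => -[/= [e3 e4] ->];
  try (exfalso; lia); congr ((_, _), _); lia.
Qed.

Lemma adj_edge e : adj (src e) (tgt e).
Proof. by move: e => [[a1 a2] []]; rewrite /adj /src /tgt /=; lia. Qed.

Lemma edge_of_ends e : edge_of (src e) (tgt e) = e.
Proof.
move: e => [[a1 a2] d]; have := adj_edge ((a1, a2), d); case/adj_cases => -[h ->];
  have := congr1 fst h; have := congr1 snd h; case: d {h}; rewrite /src /tgt /= => h1 h2;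
  try done; exfalso; lia.
Qed.

Lemma edge_ends a b : adj a b ->
  (src (edge_of a b) = a /\ tgt (edge_of a b) = b) \/
  (src (edge_of a b) = b /\ tgt (edge_of a b) = a).
Proof.
move: a b => [a1 a2] b; case/adj_cases => -[-> ->]; rewrite /src /tgt /=;
  [left|right|left|right]; split=> //; congr (_, _); lia.
Qed.

Definition opn w D : rel vtx := fun a b => [&& adj a b, w (edge_of a b), D a & D b].

Lemma opn_sym w D : symmetric (opn w D).
Proof.
move=> a b; rewrite /opn adj_sym; case ab : (adj b a) => //=.
by rewrite (edge_of_sym ab) [D b && _]andbC.
Qed.

Lemma sub_opn w w' D D' a b : (forall e, w e -> w' e) -> (forall x, D x -> D' x) ->
  opn w D a b -> opn w' D' a b.
Proof. by rewrite /opn => ww DD /and4P[-> /ww -> /DD -> /DD ->]. Qed.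

Definition nrm x : nat := maxn `|x.1|%N `|x.2|%N.
Definition box (n : nat) : pred vtx := fun x => (nrm x <= n)%N.

Definition VL (n : nat) : seq vtx :=
  [seq (i%:Z - n%:Z, j%:Z - n%:Z) | i <- iota 0 n.*2.+1, j <- iota 0 n.*2.+1].
(** Edges are listed by their source, so some of them leave the box; all edges with both ends in the
    box are included. *)
Definition EL (n : nat) : seq edge := [seq (v, d) | v <- VL n, d <- [:: false; true]].

Lemma mem_VL n x : (x \in VL n) = box n x.
Proof.
rewrite /box /nrm; apply/allpairsP/idP => [[[i j] []]|].
  by rewrite !mem_iota /= => h1 h2 -> /=; lia.
move=> h; exists (absz (x.1 + n%:Z), absz (x.2 + n%:Z)); rewrite !mem_iota.
split; try (move: h; case: x => [x1 x2] /=; lia).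
by move: h; case: x => [x1 x2] /= h; congr (_, _); lia.
Qed.

Lemma uniq_VL n : uniq (VL n).
Proof.
apply: allpairs_uniq; rewrite ?iota_uniq // => -[i j] [i' j'] _ _ /= [h1 h2].
by congr (_, _); lia.
Qed.

Lemma mem_EL n e : (e \in EL n) = box n e.1.
Proof.
rewrite -mem_VL; apply/allpairsP/idP => [[[v d] /= [vV _ ->]]//|].
by move: e => [v d] /= h; exists (v, d); split=> //; case: d.
Qed.

Lemma uniq_EL n : uniq (EL n).
Proof. by apply: allpairs_uniq; rewrite ?uniq_VL // => -[i j] [i' j'] _ _ /= [-> ->]. Qed.

Lemma EL_sub m n : (m <= n)%N -> {subset EL m <= EL n}.
Proof. by move=> mn e; rewrite !mem_EL /box => h; apply: leq_trans mn. Qed.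

Lemma nrm_adj a b : adj a b -> (nrm b <= (nrm a).+1)%N.
Proof. by move: a b => [a1 a2] [b1 b2]; rewrite /adj /nrm /=; lia. Qed.

Lemma opn_edge_src w D a b : opn w D a b -> D (src (edge_of a b)) && D (tgt (edge_of a b)).
Proof. by case/and4P => /edge_ends [] [-> ->] _ -> ->. Qed.

Definition act (g : vtx -> vtx) e : edge := edge_of (g (src e)) (g (tgt e)).

Lemma act_edge g a b : (forall a b, adj (g a) (g b) = adj a b) -> adj a b ->
  edge_of (g a) (g b) = act g (edge_of a b).
Proof.
move=> hg ab; rewrite /act; case: (edge_ends ab) => -[-> ->] //.
by apply: edge_of_sym; rewrite hg.
Qed.

Lemma act_cancel g g' : (forall a b, adj (g a) (g b) = adj a b) ->
  (forall a b, adj (g' a) (g' b) = adj a b) -> cancel g g' -> cancel (act g) (act g').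
Proof.
move=> hg hg' gK e; rewrite {2}/act -act_edge ?hg ?adj_edge //.
by rewrite !gK edge_of_ends.
Qed.

Definition shift v x : vtx := (x.1 + v.1, x.2 + v.2).
Lemma adj_shift v a b : adj (shift v a) (shift v b) = adj a b.
Proof. by move: v a b => [v1 v2] [a1 a2] [b1 b2]; rewrite /adj /shift /=; lia. Qed.
Definition opv v : vtx := (- v.1, - v.2).
Lemma shiftK v : cancel (shift v) (shift (opv v)).
Proof. by move=> [x1 x2]; rewrite /shift /opv /=; congr (_, _); lia. Qed.
Lemma shiftKV v : cancel (shift (opv v)) (shift v).
Proof. by move=> [x1 x2]; rewrite /shift /opv /=; congr (_, _); lia. Qed.

Lemma reach_opn_act g w D x y : (forall a b, adj (g a) (g b) = adj a b) ->
  reach (opn (w \o act g) (D \o g)) x y -> reach (opn w D) (g x) (g y).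
Proof.
move=> hg [p pp <-]; exists (map g p); last by rewrite last_map.
rewrite path_map; apply: sub_path pp => a b /and4P[ab wab Da Db].
by rewrite /= /opn hg ab act_edge //; move: wab Da Db => /= -> -> ->.
Qed.

End Lattice.

Section Crossing.

Definition steps (T : Type) (x : T) p := zip (x :: p) p.

Lemma path_steps (T : eqType) (e : rel T) (x : T) p :
  path e x p = all (fun s => e s.1 s.2) (steps x p).
Proof. by elim: p x => [//|y p IH] x /=; rewrite IH. Qed.

Lemma mem_steps (T : eqType) (x : T) p s : s \in steps x p -> s.1 \in x :: p /\ s.2 \in x :: p.
Proof.
elim: p x => [//|y p IH] x; rewrite /steps [zip _ _]/= in_cons => /orP[/eqP-> /=|].
  by rewrite !in_cons !eqxx orbT.
by case/(IH y) => h1 h2; rewrite !(in_cons x) h1 h2 !orbT.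
Qed.

Lemma odd_count_addb (T : Type) (A B : pred T) s :
  odd (count (fun z => A z (+) B z) s) = odd (count A s) (+) odd (count B s).
Proof.
elim: s => [//|z s IH] /=; rewrite !oddD IH !oddb.
by case: (A z); case: (B z); case: (odd _); case: (odd _).
Qed.

Lemma odd_toggle (T : Type) (A : pred T) (x : T) p :
  odd (count (fun s => A s.1 (+) A s.2) (steps x p)) = A x (+) A (last x p).
Proof.
elim: p x => [|y p IH] x /=; first by rewrite addbb.
by rewrite oddD oddb IH; case: (A x); case: (A y); case: (A _).
Qed.

(* Vertical edges of the path met by the rightward half-line starting just
   above [x]; only the parity matters. *)
Definition rcount (q0 : vtx) (q : seq vtx) (x : vtx) :=
  count (fun s => (x.1 < s.1.1) && ((s.1.2 <= x.2) (+) (s.2.2 <= x.2))) (steps q0 q).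

(** A step counted on one side only is vertical in column [x.1 + 1] and has the vertex
    [(x.1 + 1, x.2)] as an end, which is off the path. *)
Lemma rcount_h q0 q x : path adj q0 q -> (x.1 + 1, x.2) \notin q0 :: q ->
  rcount q0 q x = rcount q0 q (x.1 + 1, x.2).
Proof.
rewrite path_steps => /allP hq xq; apply: eq_in_count => -[a b] ab.
have {hq} := hq _ ab; have [/= aq bq] := mem_steps ab => /= hab.
have {aq} na : a != (x.1 + 1, x.2) by apply: contraNneq xq => <-.
have {bq} nb : b != (x.1 + 1, x.2) by apply: contraNneq xq => <-.
move: x a b hab na nb {xq ab} => [x1 x2] [a1 a2] [b1 b2]; rewrite /adj !xpair_eqE /=; lia.
Qed.

(** The two counts differ by the entrances into and exits from the open half-line to the right of
    [(x.1, x.2 + 1)]. Their number is even because both ends of the path are off that row. *)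
Lemma rcount_v q0 q x : path adj q0 q -> (x.1, x.2 + 1) \notin q0 :: q ->
  q0.2 != x.2 + 1 -> (last q0 q).2 != x.2 + 1 ->
  odd (rcount q0 q x) = odd (rcount q0 q (x.1, x.2 + 1)).
Proof.
rewrite path_steps => /allP hq xq n0 n1.
suff : odd (rcount q0 q x) (+) odd (rcount q0 q (x.1, x.2 + 1)) = false.
  by case: (odd _); case: (odd _).
rewrite -odd_count_addb.
pose A := fun z : vtx => (z.2 == x.2 + 1) && (x.1 < z.1).
rewrite (@eq_in_count _ _ (fun s => A s.1 (+) A s.2)).
  by rewrite odd_toggle /A (negPf n0) (negPf n1).
move=> -[a b] ab; have {hq} := hq _ ab; have [/= aq bq] := mem_steps ab => /= hab.
have {aq} na : a != (x.1, x.2 + 1) by apply: contraNneq xq => <-.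
have {bq} nb : b != (x.1, x.2 + 1) by apply: contraNneq xq => <-.
rewrite /A; move: x a b hab na nb {xq ab n0 n1 A} => [x1 x2] [a1 a2] [b1 b2].
rewrite /adj !xpair_eqE /=; lia.
Qed.

(** The part of the Jordan curve theorem that is used: a path that stays in the rows of the strip
    and avoids a barrier through the strip cannot change sides. The bounds on the ends of the
    barrier keep them off every row in which a vertical step needs them absent. *)
Lemma rcount_path q0 q z p (k1 k3 : int) : path adj q0 q -> path adj z p ->
  q0.2 <= k1 -> k3 <= (last q0 q).2 ->
  all (fun x => (k1 <= x.2 < k3) && (x \notin q0 :: q)) (z :: p) ->
  odd (rcount q0 q z) = odd (rcount q0 q (last z p)).
Proof.
move=> hq hp hk1 hk3; elim: p z hp => [//|y p IH] z /= /andP[zy hp] /andP[hz hyp].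
rewrite -(IH y) //; have /andP[hy _] := hyp.
case/andP: hz => hz zq; case/andP: hy => hy yq {IH hyp hp}.
case/adj_cases: zy => -[yE _]; rewrite yE in hy yq *.
- by rewrite (rcount_h (x := z)).
- rewrite [in RHS](rcount_h (x := (z.1 - 1, z.2))) ?subrK // -?surjective_pairing //.
- by rewrite (rcount_v (x := z)) //; move: hy => /=; lia.
- have E : ((z.1, z.2 - 1).1, (z.1, z.2 - 1).2 + 1) = z.
    by rewrite /= subrK -surjective_pairing.
  rewrite (@rcount_v q0 q (z.1, z.2 - 1)) ?E //; rewrite /= in hy *; lia.
Qed.

(* The dual vertex [(i, j)] sits at [(i + 1/2, j + 1/2)]; [dl] maps a dual
   edge to the primal edge it crosses. *)
Definition dl (e : edge) : edge :=
  if e.2 then ((e.1.1, e.1.2 + 1), false) else ((e.1.1 + 1, e.1.2), true).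
Definition dlV (e : edge) : edge :=
  if e.2 then ((e.1.1 - 1, e.1.2), false) else ((e.1.1, e.1.2 - 1), true).
Lemma dlK : cancel dl dlV.
Proof. by move=> [[i j] []]; rewrite /dl /dlV /= addrK. Qed.
Lemma dlVK : cancel dlV dl.
Proof. by move=> [[i j] []]; rewrite /dl /dlV /= subrK. Qed.

(** Counterpart of [rcount] for dual paths. Dual vertices have half-integer coordinates, so the
    half-line can start at [x] itself. *)
Definition dcount (q0 : vtx) (q : seq vtx) (x : vtx) :=
  count (fun s => (x.1 <= s.1.1) && ((s.1.2 < x.2) (+) (s.2.2 < x.2))) (steps q0 q).

Definition dstep (w : edge -> bool) : rel vtx := fun a b => adj a b && ~~ w (dl (edge_of a b)).
Definition pstep (w : edge -> bool) : rel vtx := fun a b => adj a b && w (edge_of a b).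

(** The only dual step that could be counted on one side only crosses the primal edge from [x] to
    its right neighbour, and that edge is open. *)
Lemma dcount_h w q0 q x : path (dstep w) q0 q -> w (x, false) ->
  dcount q0 q x = dcount q0 q (x.1 + 1, x.2).
Proof.
rewrite path_steps => /allP hq wx; apply: eq_in_count => -[a b] ab.
have {hq ab} /= /andP[hab] := hq _ ab => /negP nw.
have ne : dl (edge_of a b) <> (x, false) by move=> h; apply: nw; rewrite h.
move: hab ne {nw wx} => /adj_cases; move: x a => [x1 x2] [a1 a2].
by case=> -[-> ->]; rewrite /dl /= => ne; try lia;
  have [?|/eqP] := eqVneq a1 x1; try lia; have [?|/eqP] := eqVneq a2 x2; try lia;
  have [?|/eqP] := eqVneq (a2 + 1) x2; try lia; case: ne; subst; congr (_, _, _); lia.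
Qed.

Lemma dcount_v w q0 q x : path (dstep w) q0 q -> w (x, true) ->
  q0.2 != x.2 -> (last q0 q).2 != x.2 ->
  odd (dcount q0 q x) = odd (dcount q0 q (x.1, x.2 + 1)).
Proof.
rewrite path_steps => /allP hq wx n0 n1.
suff : odd (dcount q0 q x) (+) odd (dcount q0 q (x.1, x.2 + 1)) = false.
  by case: (odd _); case: (odd _).
rewrite -odd_count_addb.
pose A := fun z : vtx => (z.2 == x.2) && (x.1 <= z.1).
rewrite (@eq_in_count _ _ (fun s => A s.1 (+) A s.2)).
  by rewrite odd_toggle /A (negPf n0) (negPf n1).
move=> -[a b] ab; have {hq ab} /= /andP[hab] := hq _ ab => /negP nw.
have ne : dl (edge_of a b) <> (x, true) by move=> h; apply: nw; rewrite h.
rewrite /A; move: hab ne {nw wx n0 n1 A} => /adj_cases; move: x a => [x1 x2] [a1 a2].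
by case=> -[-> ->]; rewrite /dl /= => ne; try lia;
  have [?|/eqP] := eqVneq (a1 + 1) x1; try lia; have [?|/eqP] := eqVneq a2 x2; try lia;
  have [?|/eqP] := eqVneq a1 x1; try lia; case: ne; subst; congr (_, _, _); lia.
Qed.

Lemma dcount_path w q0 q z p (k1 k3 : int) : path (dstep w) q0 q -> path (pstep w) z p ->
  q0.2 < k1 -> k3 <= (last q0 q).2 -> all (fun x => k1 <= x.2 <= k3) (z :: p) ->
  odd (dcount q0 q z) = odd (dcount q0 q (last z p)).
Proof.
move=> hq hp hk1 hk3; elim: p z hp => [//|y p IH] z /= /andP[/andP[zy wzy] hp] /andP[hz hyp].
rewrite -(IH y) //; have /andP[hy _] := hyp.
case/adj_cases: zy => -[yE eE]; rewrite eE in wzy; rewrite yE in hy *.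
- by rewrite (dcount_h (x := z) hq).
- by rewrite [in RHS](dcount_h (x := (z.1 - 1, z.2)) hq) //= subrK -surjective_pairing.
- by rewrite (dcount_v (x := z) hq) //; move: hy => /=; lia.
- have E : ((z.1, z.2 - 1).1, (z.1, z.2 - 1).2 + 1) = z.
    by rewrite /= subrK -surjective_pairing.
  rewrite (@dcount_v w q0 q (z.1, z.2 - 1)) ?E //; rewrite /= in hy *; lia.
Qed.

End Crossing.

(** * Sharpness of the phase transition *)

Section Percolation.
Variable R : realType.
Implicit Types (q : R) (a b x y v : vtx) (e : edge) (w f : edge -> bool) (S : seq vtx).

Definition inD (D : pred vtx) : pred edge := fun e => D (src e) && D (tgt e).
Definition allc : edge -> bool := fun=> false.

Lemma opn_agree w w' (D : pred vtx) a b : (forall e, inD D e -> w e = w' e) ->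
  opn w D a b -> opn w' D a b.
Proof.
move=> ww h; have := opn_edge_src h; move: h => /and4P[ab wab Da Db] /ww we.
by rewrite /opn ab -we wab Da Db.
Qed.

Lemma reach_agree w w' (D : pred vtx) x y : (forall e, inD D e -> w e = w' e) ->
  reach (opn w D) x y -> reach (opn w' D) x y.
Proof. by move=> ww; apply: reach_sub => a b; apply: opn_agree. Qed.

Lemma inD_box n e : inD (box n) e -> e \in EL n.
Proof. by rewrite mem_EL => /andP[]. Qed.

Lemma Ex_EL q n n' F f f' (A : pred edge) : 0 <= q <= 1 -> dep (R := R) A F ->
  (forall e, A e -> e \in EL n) -> (forall e, A e -> e \in EL n') ->
  Ex (pb q) (EL n) F f = Ex (pb q) (EL n') F f'.
Proof.
move=> q01 dF An An'.
rewrite (@Ex_agree _ _ _ (pb q) (EL n) A F f f') //; last by move=> e /An ->.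
apply: Ex_same (law_pb q01) dF (uniq_EL _) (uniq_EL _) _ => e Ae.
by rewrite An // An'.
Qed.

(** Supplies the finite range of a random subset of [L] over which [Ex_decouple] sums. *)
Lemma sublists (T : eqType) (L : seq T) :
  exists2 vals : seq (seq T), uniq vals & forall P : pred T, [seq x <- L | P x] \in vals.
Proof.
elim: L => [|x L [vals _ h]].
  by exists [:: [::]] => // P; rewrite mem_seq1.
exists (undup (vals ++ map (cons x) vals)); first exact: undup_uniq.
move=> P /=; rewrite mem_undup mem_cat; case: ifP => _; last by rewrite h.
by rewrite map_f ?orbT.
Qed.

Definition conn0 n w : Prop :=
  exists2 y, nrm y == n & reach (opn w (box n)) origin y.

Definition theta q n : R := Ex (pb q) (EL n) (fun w => ind R (conn0 n w)) allc.

Definition oe e (d : bool) : vtx * vtx := if d then (src e, tgt e) else (tgt e, src e).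
Definition cut S (p : vtx * vtx) := (p.1 \in S) && (p.2 \notin S).

(** The quantity [phi_p(S)] of Duminil-Copin and Tassion, summed over oriented edges leaving [S];
    [n] is only a box large enough to contain [S] and these edges. *)
Definition phi q n S : R := q * \sum_(e <- EL n) \sum_(d <- [:: true; false])
  (cut S (oe e d))%:R *
  Ex (pb q) (EL n) (fun w => ind R (reach (opn w [in S]) origin (oe e d).1)) allc.

Lemma incr_reach (D : pred vtx) x y : incr (fun w => ind R (reach (opn w D) x y)).
Proof.
by apply: incr_ind => f g fg; apply: reach_sub => a b; apply: sub_opn.
Qed.

Lemma incr_conn0 n : incr (fun w => ind R (conn0 n w)).
Proof.
apply: incr_ind => f g fg [y ny ry]; exists y => //.
by apply: reach_sub ry => a b; apply: sub_opn.
Qed.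

Lemma phi_mono q q' n S : 0 <= q -> q <= q' -> q' <= 1 -> phi q n S <= phi q' n S.
Proof.
move=> q0 qq' q1; have q01 : 0 <= q <= 1 by rewrite q0 (le_trans qq').
apply: ler_pM => //.
  apply: sumr_ge0 => e _; apply: sumr_ge0 => d _; rewrite mulr_ge0 ?ler0n //.
  by apply: Ex_ge0 (law_pb q01) _ => w; apply: ind_ge0.
apply: ler_sum => e _; apply: ler_sum => d _; apply: ler_wpM2l; first exact: ler0n.
by apply: Ex_pb_mono => //; apply: incr_reach.
Qed.

Lemma oe_adj e d : adj (oe e d).1 (oe e d).2.
Proof. by case: d => /=; rewrite ?adj_edge // adj_sym adj_edge. Qed.

Lemma oe_edge e d : edge_of (oe e d).1 (oe e d).2 = e.
Proof. by case: d => /=; rewrite ?edge_of_ends // -edge_of_sym ?edge_of_ends ?adj_edge. Qed.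

(** The part of the box not joined to its boundary: what remains unseen after exploring all clusters
    from the boundary inwards. *)
Definition cored n w : seq vtx :=
  [seq x <- VL n | ~~ `[< exists2 y, nrm y == n & reach (opn w (box n)) x y >]].

Lemma mem_cored n w x : (x \in cored n w) =
  box n x && ~~ `[< exists2 y, nrm y == n & reach (opn w (box n)) x y >].
Proof. by rewrite mem_filter mem_VL andbC. Qed.

Lemma cored_step n w a b : opn w (box n) a b -> b \notin cored n w -> a \notin cored n w.
Proof.
move=> ab; have /and4P[_ _ Ba Bb] := ab; rewrite !mem_cored Ba Bb /= !negbK.
move=> /asboolP [y ny ry]; apply/asboolP; exists y => //.
exact: reach_trans (reach1 ab) ry.
Qed.

Lemma cored_nrm n w x : x \in cored n w -> (nrm x < n)%N.
Proof.
rewrite mem_cored => /andP[]; rewrite /box leq_eqVlt => /orP[nx|//] /negP[].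
by apply/asboolP; exists x => //; apply: reach_refl.
Qed.

(** The exploration never inspects an edge with both ends in [S]. Paths from outside [S] to the
    boundary stay outside, and a new connection from [S] would use an edge leaving [S], whose state
    has not changed. *)
Lemma cored_agree n w w' S : (forall e, ~~ inD [in S] e -> w e = w' e) ->
  cored n w = S -> cored n w' = S.
Proof.
move=> ww hS; rewrite -hS; apply: eq_in_filter => x; rewrite mem_VL => bx.
apply/idP/idP.
- apply: contraNN => /asboolP[y ny ry]; apply/asboolP; exists y => //.
  have : x \notin cored n w by rewrite mem_cored bx negbK; apply/asboolP; exists y.
  rewrite hS => xS; case: ry => p pp ly; exists p => //.
  elim: p x xS {bx} pp ly => [//|b p IH] x xS /= /andP[xb pb] lb.
  have bS : b \notin S.
    have /and4P[_ _ _ Bb] := xb.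
    rewrite -hS mem_cored Bb negbK; apply/asboolP; exists y => //; by exists p.
  rewrite IH // andbT; have /and4P[adjab wab Ba Bb] := xb.
  rewrite /opn adjab Ba Bb -ww ?wab //.
  by rewrite /inD; case: (edge_ends adjab) => -[-> ->]; rewrite /= (negPf bS) ?andbF.
apply: contraNN => /asboolP[y ny ry]; apply: contraT => nx.
have xS : x \in S by rewrite -hS mem_cored bx.
have yS : y \notin S.
  by rewrite -hS; apply: contraL ny => /cored_nrm; case: ltngtP.
have [a [b [Sa nSb ab rb]]] := reach_last_exit (A := [in S]) xS yS ry.
suff : a \notin cored n w by move: Sa; rewrite hS => ->.
apply: (@cored_step n w a b); last by rewrite hS.
have /and4P[adjab wab Ba Bb] := ab; rewrite /opn adjab Ba Bb ww ?wab //.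
by rewrite /inD; case: (edge_ends adjab) => -[-> ->]; rewrite /= (negPf nSb) ?andbF.
Qed.

(** Such an edge is closed, or its inner end would reach the boundary. Its inner end is joined to
    the origin and its outer end to the boundary, so opening it connects the two. *)
Lemma cored_pivot n w e d : origin \in cored n w -> e \in EL n ->
  cut (cored n w) (oe e d) -> reach (opn w [in cored n w]) origin (oe e d).1 ->
  dif e (fun w => ind R (conn0 n w)) w = 1.
Proof.
move=> oS eE /andP[aS cS] ra; set a := (oe e d).1 in aS ra; set c := (oe e d).2 in cS.
have ac : adj a c by apply: oe_adj.
have ea : edge_of a c = e by apply: oe_edge.
have na := cored_nrm aS.
have nc : box n c by have := nrm_adj ac; rewrite /box; lia.
have ba : box n a by rewrite /box ltnW.
have [y ny ry] : exists2 y, nrm y == n & reach (opn w (box n)) c y.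
  by apply/asboolP; move: cS; rewrite mem_cored nc negbK.
have n0 : ~ conn0 n w.
  by move=> /asboolP h; move: oS; rewrite mem_cored /conn0 in h *; rewrite h andbF.
have we : w e = false.
  apply/negbTE/negP => wt; suff : a \notin cored n w by rewrite aS.
  by apply: (@cored_step n w a c) cS; rewrite /opn ac ea wt ba nc.
rewrite /dif (_ : upd w e false = w); last by rewrite -we upd_id.
rewrite (ind0 R n0) subr0; apply: ind1; exists y => //.
have wle : forall e', w e' -> upd w e true e' by move=> e'; rewrite /upd; case: ifP.
apply: (@reach_trans _ _ _ a).
  apply: reach_sub ra => u v; apply: sub_opn => // x.
  by rewrite mem_cored => /andP[].
apply: (@reach_trans _ _ _ c); last by apply: reach_sub ry => u v; apply: sub_opn.
by apply: reach1; rewrite /opn ac ea /upd eqxx ba nc.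
Qed.

Lemma dep_reach S x y : dep (R := R) (inD [in S]) (fun w => ind R (reach (opn w [in S]) x y)).
Proof. by apply: dep_ind => f g fg; apply: reach_agree. Qed.

(** Given [cored n w = S], the edges leaving [S] from vertices joined to the origin inside [S] are
    pivotal. The event looks only at edges not inside [S], the joining only at edges inside, so the
    expected number of these edges, multiplied by [q <= 1], is [phi q n S >= 1]. Finally
    [1 - theta q n] is the probability that the origin lies in [cored n w]. *)
Lemma theta_derive_ge q n : 0 <= q <= 1 ->
  (forall S, origin \in S -> (forall x, x \in S -> (nrm x < n)%N) -> 1 <= phi q n S) ->
  1 - theta q n <=
  \sum_(e <- EL n) Ex (pb q) (EL n) (dif e (fun w => ind R (conn0 n w))) allc.
Proof.
move=> q01 hphi; have hl := law_pb q01; have [q0 q1] := andP q01.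
have [vals uv vP] := sublists (VL n).
pose H S w := (origin \in S)%:R * \sum_(e <- EL n) \sum_(d <- [:: true; false])
  (cut S (oe e d))%:R * ind R (reach (opn w [in S]) origin (oe e d).1).
have H0 S w : 0 <= H S w.
  rewrite mulr_ge0 ?ler0n ?sumr_ge0 // => e _; rewrite sumr_ge0 // => d _.
  by rewrite mulr_ge0 ?ler0n ?ind_ge0.
rewrite -Ex_sum; apply: (@le_trans _ _ (Ex (pb q) (EL n) (fun w => H (cored n w) w) allc)); last first.
  apply: Ex_le => // w; rewrite /H.
  have [oS|_] := boolP (origin \in cored n w); last first.
    rewrite mul0r; apply: sumr_ge0 => e _; rewrite subr_ge0.
    by apply: incr_conn0; apply: upd_le.
  rewrite mul1r big_seq [leRHS]big_seq; apply: ler_sum => e eE.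
  rewrite big_cons big_seq1.
  have D0 : 0 <= dif e (fun w => ind R (conn0 n w)) w.
    by rewrite subr_ge0; apply: incr_conn0; apply: upd_le.
  have one d : (cut (cored n w) (oe e d))%:R *
      ind R (reach (opn w [in cored n w]) origin (oe e d).1)
      <= dif e (fun w => ind R (conn0 n w)) w.
    case: (boolP (cut _ _)) => [cd|_]; last by rewrite mul0r.
    have [r|r] := pselect (reach (opn w [in cored n w]) origin (oe e d).1).
      by rewrite (cored_pivot oS eE cd r) ind1 // mulr1.
    by rewrite (ind0 R r) mulr0.
  (* At most one orientation of an edge leaves the set, so the two terms do not count the same
     pivotal edge twice. *)
  have [c1|c1] := boolP (cut (cored n w) (oe e true)).
    have -> : cut (cored n w) (oe e false) = false.
      by move: c1; rewrite /cut /= => /andP[-> /negPf ->].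
    by rewrite mul0r addr0; have := one true; rewrite c1.
  by rewrite mul0r add0r; exact: one.
rewrite (@Ex_decouple _ _ _ (pb q) (EL n) allc _ (cored n) vals H uv); last by move=> w; apply: vP.
have -> : 1 - theta q n = Ex (pb q) (EL n) (fun w => (origin \in cored n w)%:R) allc.
  transitivity (Ex (pb q) (EL n) (fun w => 1 - ind R (conn0 n w)) allc).
    by rewrite ExB Ex_cst.
  apply: eq_Ex => w.
  rewrite -ind_not -ind_bool; apply: eq_ind_iff; rewrite mem_cored /=.
  by split => /= [h|/negP h]; [apply/negP => /asboolP|move=> k; apply: h; apply/asboolP].
rewrite (@Ex_decouple _ _ _ (pb q) (EL n) allc _ (cored n) vals (fun S _ => (origin \in S)%:R) uv);
  last by move=> w; apply: vP.
apply: ler_sum => S _.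
have [/allP nS|nS] := boolP (all (fun x => nrm x < n)%N S); last first.
  have z w : (cored n w == S) = false.
    by apply: contraNF nS => /eqP <-; apply/allP => x /cored_nrm.
  by rewrite le_eqVlt; apply/orP; left; apply/eqP; apply: eq_Ex => w; rewrite z !mul0r.
rewrite [leRHS](@Ex_indep _ _ _ (pb q) (EL n) (predC (inD [in S])) (inD [in S])) //; last first.
- by move=> e /= /negP.
- move=> f g fg; congr (_ * _); apply: eq_bigr => e _; apply: eq_bigr => d _.
  by congr (_ * _); apply: dep_reach.
- move=> f g fg; congr (_%:R); congr nat_of_bool.
  by apply/eqP/eqP; apply: cored_agree => e /fg.
rewrite ExZr; apply: ler_wpM2l; first by apply: Ex_ge0 => // w; apply: ler0n.
rewrite ExZ; have [oS|_] := boolP (origin \in S); last by rewrite mul0r.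
rewrite mul1r; have := hphi S oS nS; rewrite /phi Ex_sum.
under [X in _ -> _ <= X]eq_bigr do rewrite Ex_sum.
under [X in _ -> _ <= X]eq_bigr do under eq_bigr do rewrite ExZ.
set s := \sum_(e <- _) _; have s0 : 0 <= s.
  rewrite sumr_ge0 // => e _; rewrite sumr_ge0 // => d _; rewrite mulr_ge0 ?ler0n //.
  by apply: Ex_ge0 => // w; apply: ind_ge0.
by move/le_trans; apply; rewrite ler_piMl.
Qed.

Lemma theta_incr q q' n : 0 <= q -> q <= q' -> q' <= 1 -> theta q n <= theta q' n.
Proof. by move=> *; apply: Ex_pb_mono => //; apply: incr_conn0. Qed.

Lemma theta_ge0 q n : 0 <= q <= 1 -> 0 <= theta q n.
Proof. by move=> q01; apply: Ex_ge0 (law_pb q01) _ => w; apply: ind_ge0. Qed.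

Lemma theta_le1 q n : 0 <= q <= 1 -> theta q n <= 1.
Proof.
move=> q01; rewrite -(Ex_cst (EL n) 1 allc (law_pb q01)).
by apply: Ex_le (law_pb q01) _ => w; apply: ind_le1.
Qed.

(** The hypothesis at [p] persists above [p] by monotonicity of [phi]. The mean value theorem then
    gives [theta p' n >= (1 - theta p' n) * (p' - p)], and [p' - p <= 1]. *)
Lemma theta_ge_sub (p p' : R) n : 0 <= p -> p < p' -> p' <= 1 ->
  (forall S, origin \in S -> (forall x, x \in S -> (nrm x < n)%N) -> 1 <= phi p n S) ->
  (p' - p) / 2 <= theta p' n.
Proof.
move=> p0 pp' p1 hphi.
pose dth q := \sum_(e <- EL n) Ex (pb q) (EL n) (dif e (fun w => ind R (conn0 n w))) allc.
have der q : is_derive q (1 : R) (fun q => theta q n) (dth q).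
  exact: (Russo q (fun w => ind R (conn0 n w)) allc (uniq_EL n)).
have [|] := @MVT R (fun q => theta q n) dth p p' pp' (fun q _ => der q).
  apply: continuous_in_subspaceT => q _; apply: differentiable_continuous.
  by apply/derivable1_diffP; have [] := der q.
move=> xi /[!in_itv] /= /andP[xi0 xi1] E.
have xi01 : 0 <= xi <= 1 by rewrite (le_trans p0 (ltW xi0)) (le_trans (ltW xi1)).
have h1 : 1 - theta xi n <= dth xi.
  apply: theta_derive_ge => // S oS nS; apply: le_trans (hphi S oS nS) _.
  by apply: phi_mono => //; [exact: ltW|case/andP: xi01].
have h2 : theta xi n <= theta p' n by apply: theta_incr => //; [case/andP: xi01|exact: ltW].
have h3 : 0 <= theta p n by apply: theta_ge0; rewrite p0 (le_trans (ltW pp')).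
have h4 : theta p' n <= 1 by apply: theta_le1; rewrite p1 (le_trans p0 (ltW pp')).
by nra.
Qed.

End Percolation.

(** * Arms from a box to the sides of a square *)

Section Arms.
Variable R : realType.
Implicit Types (q : R) (a b x y v d : vtx) (e : edge) (w f : edge -> bool) (lo hi : int).

(** The centre is arbitrary because dual vertices carry a half-unit offset: the symmetric dual
    squares are [[-n, n-1]] in each coordinate. *)
Definition Isq lo hi : pred vtx := fun x => (lo <= x.1 <= hi) && (lo <= x.2 <= hi).

Lemma Isq_box n : Isq (- n%:Z) n%:Z =1 box n.
Proof. by move=> [x1 x2]; rewrite /Isq /box /nrm /=; lia. Qed.

Definition dirs : seq vtx := [:: (1, 0); (0, 1); (-1, 0); (0, -1)].

Lemma adj_dirs a b : adj a b -> exists2 d, d \in dirs & b = shift d a.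
Proof.
move: a => [a1 a2]; case/adj_cases => -[-> _]; rewrite /shift /dirs /=.
- by exists (1, 0); rewrite ?inE //=; congr (_, _); lia.
- by exists (-1, 0); rewrite ?inE //=; congr (_, _); lia.
- by exists (0, 1); rewrite ?inE //=; congr (_, _); lia.
- by exists (0, -1); rewrite ?inE //=; congr (_, _); lia.
Qed.

Lemma dirs_adj d a : d \in dirs -> adj a (shift d a).
Proof.
rewrite /dirs !in_cons in_nil orbF; move: a => [a1 a2].
by case/or4P => /eqP ->; rewrite /adj /shift /=; lia.
Qed.

Definition exits lo hi lo' hi' d w : Prop := exists x y,
  [/\ Isq lo' hi' x, Isq lo hi y, reach (opn w (Isq lo hi)) x y, ~~ Isq lo hi (shift d y)
    & w (edge_of y (shift d y))].

Lemma Isq_step lo hi a b : adj a b -> Isq lo hi a -> Isq (lo - 1) (hi + 1) b.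
Proof. by move: a b => [a1 a2] [b1 b2]; rewrite /adj /Isq /=; lia. Qed.

Lemma Isq_widen lo hi a : Isq lo hi a -> Isq (lo - 1) (hi + 1) a.
Proof. by move: a => [a1 a2]; rewrite /Isq /=; lia. Qed.

Lemma exits_agree lo hi lo' hi' d f g : d \in dirs ->
  (forall e, inD (Isq (lo - 1) (hi + 1)) e -> f e = g e) ->
  exits lo hi lo' hi' d f -> exits lo hi lo' hi' d g.
Proof.
move=> dd fg [x [y [hx hy ry ny fy]]]; exists x, y; split=> //.
  apply: reach_agree ry => e; rewrite /inD => /andP[h1 h2]; apply: fg.
  by rewrite /inD !Isq_widen.
rewrite -fg // /inD; have ad := dirs_adj y dd.
by case: (edge_ends ad) => -[-> ->]; rewrite (Isq_widen hy) (Isq_step ad hy).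
Qed.

Lemma incr_exits lo hi lo' hi' d : incr (fun w => ind R (exits lo hi lo' hi' d w)).
Proof.
apply: incr_ind => f g fg [x [y [hx hy ry ny fy]]]; exists x, y; split=> //; last exact: fg.
by apply: reach_sub ry => a b; apply: sub_opn.
Qed.

Lemma Ex_bij q n F (A : pred edge) (u u' : edge -> edge) f f' : 0 <= q <= 1 ->
  cancel u u' -> cancel u' u -> dep (R := R) A F ->
  (forall e, A e -> e \in EL n) -> (forall e, A e -> u' e \in EL n) ->
  Ex (pb q) (EL n) (fun w => F (w \o u')) f = Ex (pb q) (EL n) F f'.
Proof.
move=> q01 uK u'K dF An An'.
have -> : f = (f \o u') \o u by apply/funext => x /=; rewrite uK.
rewrite -(Ex_map_index _ _ _ _ uK u'K).
have memu e : (e \in map u (EL n)) = (u' e \in EL n).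
  by rewrite -{1}(u'K e) mem_map //; apply: can_inj uK.
rewrite (@Ex_agree _ _ _ (pb q) _ A F _ f') //; last by move=> e /An' h; rewrite memu h.
apply: (Ex_same f' (law_pb q01) dF _ (uniq_EL n)).
  by rewrite map_inj_uniq ?uniq_EL //; apply: can_inj uK.
by move=> e Ae; rewrite memu (An e Ae) (An' e Ae).
Qed.

(** Quarter turn about [(k/2, k/2)]. With [k = lo + hi] it preserves [Isq lo hi], also when the
    centre is not a lattice point. *)
Definition rot (k : int) x : vtx := (k - x.2, x.1).
Definition rotV (k : int) x : vtx := (x.2, k - x.1).
Lemma rotK k : cancel (rot k) (rotV k).
Proof. by move=> [x y]; rewrite /rot /rotV /=; congr (_, _); lia. Qed.
Lemma rotVK k : cancel (rotV k) (rot k).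
Proof. by move=> [x y]; rewrite /rot /rotV /=; congr (_, _); lia. Qed.
Lemma adj_rot k a b : adj (rot k a) (rot k b) = adj a b.
Proof. by move: a b => [a1 a2] [b1 b2]; rewrite /adj /rot /=; lia. Qed.
Lemma adj_rotV k a b : adj (rotV k a) (rotV k b) = adj a b.
Proof. by move: a b => [a1 a2] [b1 b2]; rewrite /adj /rotV /=; lia. Qed.
Lemma Isq_rot lo hi x : Isq lo hi (rot (lo + hi) x) = Isq lo hi x.
Proof. by move: x => [x1 x2]; rewrite /Isq /rot /=; lia. Qed.

Lemma exits_rot lo hi lo' hi' d w : lo + hi = lo' + hi' -> d \in dirs ->
  exits lo hi lo' hi' d (w \o act (rot (lo + hi))) ->
  exits lo hi lo' hi' (rot 0 d) w.
Proof.
move=> lh dd [x [y [hx hy ry ny wy]]].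
have sh : shift (rot 0 d) (rot (lo + hi) y) = rot (lo + hi) (shift d y).
  by rewrite /shift /rot /=; congr (_, _); lia.
exists (rot (lo + hi) x), (rot (lo + hi) y); split.
- by rewrite lh Isq_rot.
- by rewrite Isq_rot.
- apply: reach_opn_act; first exact: adj_rot.
  by apply: reach_sub ry => a b; apply: sub_opn => // z; rewrite /= Isq_rot.
- by rewrite sh Isq_rot.
by rewrite sh act_edge //; [exact: adj_rot | exact: dirs_adj].
Qed.

Lemma Isq_box_sub lo hi n x : Isq (lo - 1) (hi + 1) x -> - n%:Z < lo -> hi < n%:Z -> box n x.
Proof. by move: x => [x1 x2]; rewrite /Isq /box /nrm /=; lia. Qed.

Lemma inD_Isq_EL lo hi n e : - n%:Z < lo -> hi < n%:Z ->
  inD (Isq (lo - 1) (hi + 1)) e -> e \in EL n.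
Proof. by move=> h1 h2 /andP[h _]; rewrite mem_EL (Isq_box_sub h). Qed.

Definition pexit q n lo hi lo' hi' d : R :=
  Ex (pb q) (EL n) (fun w => ind R (exits lo hi lo' hi' d w)) allc.

Lemma pexit_rot q n lo hi lo' hi' d : 0 <= q <= 1 -> lo + hi = lo' + hi' -> d \in dirs ->
  - n%:Z < lo -> hi < n%:Z ->
  pexit q n lo hi lo' hi' d <= pexit q n lo hi lo' hi' (rot 0 d).
Proof.
move=> q01 lh dd h1 h2; rewrite /pexit.
rewrite -(@Ex_bij q n _ (inD (Isq (lo - 1) (hi + 1))) (act (rotV (lo + hi))) (act (rot (lo + hi))) allc) //.
- by apply: Ex_le (law_pb q01) _ => w; apply: le_ind; apply: exits_rot.
- by apply: act_cancel; [exact: adj_rotV|exact: adj_rot|exact: rotVK].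
- by apply: act_cancel; [exact: adj_rot|exact: adj_rotV|exact: rotK].
- by apply: dep_ind => f g fg; apply: exits_agree.
- by move=> e; apply: inD_Isq_EL.
move=> e /andP[hs ht]; apply: (inD_Isq_EL h1 h2).
have rr z : Isq (lo - 1) (hi + 1) (rot (lo + hi) z) = Isq (lo - 1) (hi + 1) z.
  by rewrite -(Isq_rot (lo - 1) (hi + 1) z) (_ : lo - 1 + (hi + 1) = lo + hi) //; lia.
rewrite /inD /act; case: (edge_ends (a := rot (lo + hi) (src e)) (b := rot (lo + hi) (tgt e))).
- by rewrite adj_rot adj_edge.
- by case=> -> ->; rewrite !rr hs ht.
by case=> -> ->; rewrite !rr hs ht.
Qed.

(** Four successive quarter turns close a cycle of inequalities, so all of them are equalities. *)
Lemma pexit_sides q n lo hi lo' hi' d : 0 <= q <= 1 -> lo + hi = lo' + hi' -> d \in dirs ->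
  - n%:Z < lo -> hi < n%:Z -> pexit q n lo hi lo' hi' d = pexit q n lo hi lo' hi' (1, 0).
Proof.
move=> q01 lh dd h1 h2.
have r1 := @pexit_rot q n lo hi lo' hi' (1, 0) q01 lh isT h1 h2.
have r2 := @pexit_rot q n lo hi lo' hi' (0, 1) q01 lh isT h1 h2.
have r3 := @pexit_rot q n lo hi lo' hi' (-1, 0) q01 lh isT h1 h2.
have r4 := @pexit_rot q n lo hi lo' hi' (0, -1) q01 lh isT h1 h2.
rewrite /rot /= !(sub0r, opprK, oppr0) in r1 r2 r3 r4.
move: dd; rewrite /dirs !in_cons in_nil orbF.
by case/or4P => /eqP -> //; apply/eqP; rewrite eq_le; apply/andP; split; lra.
Qed.

Lemma incr_decr (F : (edge -> bool) -> R) : incr F -> decr (fun w => 1 - F w).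
Proof. by move=> iF f g fg; rewrite lerD2l lerN2; apply: iF. Qed.

Lemma decr_mul (F G : (edge -> bool) -> R) : (forall f, 0 <= F f) -> (forall f, 0 <= G f) ->
  decr F -> decr G -> decr (fun w => F w * G w).
Proof. by move=> F0 G0 dF dG f g fg; apply: ler_pM => //; [apply: dF|apply: dG]. Qed.

(* "Square root trick": by FKG and symmetry, the probability that all four
   sides fail is at least the fourth power of that for one side. *)
Lemma pexit_ge q n lo hi lo' hi' d : 0 <= q <= 1 -> lo + hi = lo' + hi' -> d \in dirs ->
  - n%:Z < lo -> hi < n%:Z ->
  1 - 8^-1 ^+ 4 <= Ex (pb q) (EL n) (fun w => ind R (exists2 d, d \in dirs & exits lo hi lo' hi' d w)) allc ->
  1 - 8^-1 <= pexit q n lo hi lo' hi' d.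
Proof.
move=> q01 lh dd h1 h2 hU; rewrite pexit_sides // {dd d}.
have hl := law_pb q01.
pose N d w := 1 - ind R (exits lo hi lo' hi' d w).
have dN d : decr (N d) by apply: incr_decr; apply: incr_exits.
have N0 d w : 0 <= N d w by rewrite subr_ge0 ind_le1.
have EN d : d \in dirs -> Ex (pb q) (EL n) (N d) allc = 1 - pexit q n lo hi lo' hi' (1, 0).
  by move=> dd; rewrite -(@pexit_sides q n lo hi lo' hi' d) // ExB Ex_cst.
have k1 := FKG_decr (EL n) allc q01 (dN (1, 0)) (dN (0, 1)).
have k2 := FKG_decr (EL n) allc q01 (dN (-1, 0)) (dN (0, -1)).
have k3 := FKG_decr (EL n) allc q01 (decr_mul (N0 (1, 0)) (N0 (0, 1)) (dN _) (dN _))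
   (decr_mul (N0 (-1, 0)) (N0 (0, -1)) (dN _) (dN _)).
rewrite !EN // in k1 k2; set x := 1 - pexit _ _ _ _ _ _ _ in k1 k2 *.
have x0 : 0 <= x by rewrite /x -(EN (1, 0)) //; apply: Ex_ge0.
suff k4 : Ex (pb q) (EL n) (fun w => N (1, 0) w * N (0, 1) w * (N (-1, 0) w * N (0, -1) w)) allc
    <= 8^-1 ^+ 4.
  have x4 : x ^+ 4 <= 8^-1 ^+ 4.
    apply: le_trans k4; apply: le_trans k3.
    rewrite (_ : x ^+ 4 = x * x * (x * x)); last by rewrite !exprS expr0 mulr1 !mulrA.
    by apply: ler_pM => //; apply: mulr_ge0.
  have : x <= 8^-1 by rewrite -(@ler_pXn2r _ 4%N) ?nnegrE // invr_ge0.
  by rewrite /x; lra.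
apply: (@le_trans _ _ (1 - Ex (pb q) (EL n) (fun w => ind R (exists2 d, d \in dirs & exits lo hi lo' hi' d w)) allc)); last by lra.
rewrite -[X in X - _](Ex_cst (EL n) 1 allc hl) -ExB; apply: Ex_le => // w.
have [[d dd ed]|nd] := pselect (exists2 d, d \in dirs & exits lo hi lo' hi' d w).
  rewrite (ind1 R) ?subrr; last by exists d.
  rewrite le_eqVlt; apply/orP; left; apply/eqP.
  move: dd ed; rewrite /dirs !in_cons in_nil orbF.
  by case/or4P => /eqP -> ed; rewrite /N (ind1 R ed) subrr !(mul0r, mulr0).
rewrite (ind0 R nd) subr0.
have N1 d : N d w <= 1 by rewrite /N gerBl ind_ge0.
by rewrite !mulr_ile1 ?mulr_ge0.
Qed.

Definition hits m n w : Prop := exists x y, [/\ box m x, nrm y == n & reach (opn w (box n)) x y].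

Lemma incr_hits m n : incr (fun w => ind R (hits m n w)).
Proof.
apply: incr_ind => f g fg [x [y [hx hy ry]]]; exists x, y; split=> //.
by apply: reach_sub ry => a b; apply: sub_opn.
Qed.

Lemma hits_exits m n lo hi lo' hi' w : (forall x, box m x -> Isq lo' hi' x && Isq lo hi x) ->
  (forall x, Isq lo hi x -> (nrm x < n)%N) -> hits m n w ->
  exists2 d, d \in dirs & exits lo hi lo' hi' d w.
Proof.
move=> h1 h2 [x [y [hx hy ry]]]; have /andP[x1 x2] := h1 _ hx.
have ny : ~~ Isq lo hi y by apply: contraL hy => /h2; case: ltngtP.
have [a [b [ra Ia Ib ab]]] := reach_exit x2 ny ry.
have /and4P[adjab wab _ _] := ab.
have [d dd bE] := adj_dirs adjab; exists d => //; exists x, a; rewrite -bE; split=> //.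
by apply: reach_sub ra => u v; rewrite /on /opn => /and3P[/and4P[-> -> _ _] -> ->].
Qed.

(* Outside [box m] the crossing from [box m] to distance [n] is independent of
   what happens inside. *)
Lemma hits_theta q m n : 0 <= q <= 1 -> (m < n)%N ->
  theta q n <= theta q m * Ex (pb q) (EL n) (fun w => ind R (hits m n w)) allc.
Proof.
move=> q01 mn; have hl := law_pb q01.
pose r w : rel vtx := fun a b => opn w (box n) a b && ~~ inD (box m) (edge_of a b).
pose outer w := exists x y, [/\ box m x, nrm y == n & reach (r w) x y].
apply: (@le_trans _ _ (Ex (pb q) (EL n) (fun w => ind R (conn0 m w) * ind R (outer w)) allc)).
  apply: Ex_le => // w; rewrite -ind_and; apply: le_ind => -[y ny ry].
  have b0 : box m origin by [].
  have nby : ~~ box m y by rewrite /box -ltnNge (eqP ny).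
  split.
    have [a [b [ra ba nb ab]]] := reach_exit b0 nby ry.
    have /and4P[adjab _ _ _] := ab.
    exists a.
      by have := nrm_adj adjab; move: ba nb; rewrite /box; lia.
    by apply: reach_sub ra => u v; rewrite /on /opn => /and3P[/and4P[-> -> _ _] -> ->].
  have [a [b [ba nb ab rb]]] := reach_last_exit b0 nby ry.
  exists a, y; split=> //; apply: (@reach_trans _ _ _ b).
    apply: reach1; rewrite /r ab /inD; have /and4P[adjab _ _ _] := ab.
    by case: (edge_ends adjab) => -[-> ->]; rewrite (negPf nb) ?andbF.
  apply: reach_sub rb => u v; rewrite /on /r => /and3P[uv nu nv].
  rewrite uv /inD; have /and4P[adjuv _ _ _] := uv.
  by move: nu nv => /= /negPf nu /negPf nv; case: (edge_ends adjuv) => -[-> ->]; rewrite ?nu ?nv.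
rewrite (@Ex_indep _ _ _ (pb q) (EL n) (inD (box m)) (predC (inD (box m)))) //; last first.
- by move=> e /= h /negP.
- apply: dep_ind => f g fg [x [y [hx hy rxy]]]; exists x, y; split=> //.
  apply: reach_sub rxy => a b /andP[/and4P[ab fab Ba Bb] nab].
  by rewrite /r /opn ab Ba Bb nab -fg // fab.
- by apply: dep_ind => f g fg [y ny ry]; exists y => //; apply: reach_agree ry.
have -> : Ex (pb q) (EL n) (fun w => ind R (conn0 m w)) allc = theta q m.
  apply: (@Ex_EL _ _ _ _ _ _ _ (inD (box m))) => //.
  - by apply: dep_ind => f g fg [y ny ry]; exists y => //; apply: reach_agree ry.
  - by move=> e /inD_box; apply: EL_sub; apply: ltnW.
  - by move=> e /inD_box.
apply: ler_wpM2l; first exact: theta_ge0.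
apply: Ex_le => // w; apply: le_ind => -[x [y [hx hy rxy]]]; exists x, y; split=> //.
by apply: reach_sub rxy => a b /andP[].
Qed.

Definition dualc w : edge -> bool := fun e => ~~ w (dl e).

(* Open arms to the left and right, closed dual arms to the bottom and top. *)
Definition four_arms M n w : Prop :=
  [/\ exits (- (n%:Z - 1)) (n%:Z - 1) (- M%:Z) M%:Z (-1, 0) w,
      exits (- (n%:Z - 1)) (n%:Z - 1) (- M%:Z) M%:Z (1, 0) w,
      exits (- n%:Z) (n%:Z - 1) (- M%:Z) (M%:Z - 1) (0, 1) (dualc w) &
      exits (- n%:Z) (n%:Z - 1) (- M%:Z) (M%:Z - 1) (0, -1) (dualc w)].

(** Exchanging open and closed turns the parameter into [1 - q], and [dl] is a bijection between
    dual and primal edges. *)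
Lemma Ex_dualc q n lo hi lo' hi' d : 0 <= q <= 1 -> - n%:Z < lo - 1 -> hi + 1 < n%:Z -> d \in dirs ->
  Ex (pb q) (EL n) (fun w => ind R (exits lo hi lo' hi' d (dualc w))) allc =
  pexit (1 - q) n lo hi lo' hi' d.
Proof.
move=> q01 h1 h2 dd.
have q01' : 0 <= 1 - q <= 1 by move: q01; lra.
pose F w := ind R (exits lo hi lo' hi' d w).
have dF : dep (R := R) (inD (Isq (lo - 1) (hi + 1))) F.
  by apply: dep_ind => f g fg; apply: exits_agree.
rewrite (_ : (fun w => _) = fun w => (fun w' => F (w' \o dl)) (negb \o w)) //.
rewrite (Ex_pb_flip q (EL n) (fun w' => F (w' \o dl)) allc) (@Ex_bij (1 - q) n F (inD (Isq (lo - 1) (hi + 1))) dlV dl _ allc) //.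
- exact: dlVK.
- exact: dlK.
- by move=> e; apply: inD_Isq_EL; lia.
move=> [[e1 e2] b] /andP[hs ht]; rewrite mem_EL; move: hs ht.
by rewrite /dl /Isq /src /tgt /box /nrm; case: b => /=; lia.
Qed.

Lemma four_arms_prob q m n N : 0 <= q <= 1 -> (m.+2 < n)%N -> (n.+2 < N)%N ->
  (forall q', q' = q \/ q' = 1 - q -> 1 - 8^-1 ^+ 4 <= Ex (pb q') (EL n.+2) (fun w => ind R (hits m n.+2 w)) allc) ->
  2^-1 <= Ex (pb q) (EL N) (fun w => ind R (four_arms m.+1 n w)) allc.
Proof.
move=> q01 mn nN hH; have hl := law_pb q01.
have q01' : 0 <= 1 - q <= 1 by move: q01; lra.
have step q' lo hi lo' hi' d : q' = q \/ q' = 1 - q -> lo + hi = lo' + hi' -> d \in dirs ->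
   - n%:Z - 1 < lo -> hi < n%:Z + 1 ->
   (forall x, box m x -> Isq lo' hi' x && Isq lo hi x) ->
   (forall x, Isq lo hi x -> (nrm x < n.+2)%N) -> 1 - 8^-1 <= pexit q' N lo hi lo' hi' d.
  move=> hq lh dd l1 l2 s1 s2.
  have q01q : 0 <= q' <= 1 by case: hq => ->.
  apply: pexit_ge => //; try lia.
  apply: le_trans (hH _ hq) _.
  rewrite (@Ex_EL _ q' n.+2 N _ allc allc (inD (box n.+2))) //.
  - apply: Ex_le (law_pb q01q) _ => w; apply: le_ind; apply: hits_exits => //.
  - apply: dep_ind => f g fg [x [y [hx hy rxy]]]; exists x, y; split=> //.
    by apply: reach_agree rxy.
  - by move=> e /inD_box.
  - by move=> e /inD_box; apply: EL_sub; lia.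
have side : forall x : vtx, box m x ->
   Isq (- m.+1%:Z) m.+1%:Z x && Isq (- (n%:Z - 1)) (n%:Z - 1) x.
  by move=> [x1 x2]; rewrite /box /nrm /Isq /=; lia.
have side' : forall x : vtx, box m x ->
   Isq (- m.+1%:Z) (m.+1%:Z - 1) x && Isq (- n%:Z) (n%:Z - 1) x.
  by move=> [x1 x2]; rewrite /box /nrm /Isq /=; lia.
have sd1 : forall x : vtx, Isq (- (n%:Z - 1)) (n%:Z - 1) x -> (nrm x < n.+2)%N.
  by move=> [x1 x2]; rewrite /nrm /Isq /=; lia.
have sd2 : forall x : vtx, Isq (- n%:Z) (n%:Z - 1) x -> (nrm x < n.+2)%N.
  by move=> [x1 x2]; rewrite /nrm /Isq /=; lia.
have h1 : 1 - 8^-1 <= pexit q N (- (n%:Z - 1)) (n%:Z - 1) (- m.+1%:Z) m.+1%:Z (-1, 0).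
  by apply: step => //; [left|lia|lia|lia].
have h2 : 1 - 8^-1 <= pexit q N (- (n%:Z - 1)) (n%:Z - 1) (- m.+1%:Z) m.+1%:Z (1, 0).
  by apply: step => //; [left|lia|lia|lia].
have h3 : 1 - 8^-1 <= pexit (1 - q) N (- n%:Z) (n%:Z - 1) (- m.+1%:Z) (m.+1%:Z - 1) (0, 1).
  by apply: step => //; [right|lia|lia|lia].
have h4 : 1 - 8^-1 <= pexit (1 - q) N (- n%:Z) (n%:Z - 1) (- m.+1%:Z) (m.+1%:Z - 1) (0, -1).
  by apply: step => //; [right|lia|lia|lia].
rewrite -!Ex_dualc // in h3 h4; try lia.
(* Union bound in the form: sum of four indicators minus 3 is at most the indicator of the
   intersection. Here [4 * (7/8) - 3 = 1/2]. *)
apply: (@le_trans _ _ (Ex (pb q) (EL N) (fun w =>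
  ind R (exits (- (n%:Z - 1)) (n%:Z - 1) (- m.+1%:Z) m.+1%:Z (-1, 0) w) +
  (ind R (exits (- (n%:Z - 1)) (n%:Z - 1) (- m.+1%:Z) m.+1%:Z (1, 0) w) +
  (ind R (exits (- n%:Z) (n%:Z - 1) (- m.+1%:Z) (m.+1%:Z - 1) (0, 1) (dualc w)) +
  (ind R (exits (- n%:Z) (n%:Z - 1) (- m.+1%:Z) (m.+1%:Z - 1) (0, -1) (dualc w)) - 3)))) allc)).
  rewrite ExD ExD ExD ExD Ex_cst //; move: h1 h2 h3 h4; rewrite /pexit.
  set A := Ex _ _ _ _; set B := Ex _ _ _ _; set C := Ex _ _ _ _; set D := Ex _ _ _ _.
  by lra.
apply: Ex_le => // w; rewrite /four_arms.
set A := exits _ _ _ _ _ _; set B := exits _ _ _ _ _ _; set C := exits _ _ _ _ _ _; set D := exits _ _ _ _ _ _.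
have [[hA hB hC hD]|nn] := pselect [/\ A, B, C & D].
  by rewrite (ind1 R hA) (ind1 R hB) (ind1 R hC) (ind1 R hD) ind1 //; lra.
rewrite (ind0 R nn); have := ind_le1 R A; have := ind_le1 R B; have := ind_le1 R C; have := ind_le1 R D.
have : ~ A \/ ~ B \/ ~ C \/ ~ D by apply: contrapT => h; apply: nn; split; apply: contrapT => k; apply: h; tauto.
by case=> [/(ind0 R) ->|[/(ind0 R) ->|[/(ind0 R) ->|/(ind0 R) ->]]]; lra.
Qed.

End Arms.

(** * Four arms separate two clusters once the central block is closed *)

Section FourArms.
Implicit Types (a b x y v d : vtx) (e : edge) (w f : edge -> bool) (lo hi : int).

Lemma Isq_connected lo hi x y : Isq lo hi x -> Isq lo hi y ->
  reach (fun a b => [&& adj a b, Isq lo hi a & Isq lo hi b]) x y.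
Proof.
have [n] := ubnP (`|x.1 - y.1| + `|x.2 - y.2|)%N; elim: n x y => // n IH x y.
move: x y => [x1 x2] [y1 y2] hn hx hy.
have st a : adj (x1, x2) a -> Isq lo hi a ->
    (`|a.1 - y1| + `|a.2 - y2| < `|x1 - y1| + `|x2 - y2|)%N ->
    reach (fun a b => [&& adj a b, Isq lo hi a & Isq lo hi b]) (x1, x2) (y1, y2).
  move=> ad ha lt; apply: (@reach_trans _ _ _ a); first by apply: reach1; rewrite ad hx ha.
  by apply: IH => //; move: hn lt => /=; lia.
have [|n1] := boolP (x1 < y1).
  by move=> h; apply: (st (x1 + 1, x2)); move: hx hy; rewrite /adj /Isq /=; lia.
have [|n2] := boolP (y1 < x1).
  by move=> h; apply: (st (x1 - 1, x2)); move: hx hy; rewrite /adj /Isq /=; lia.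
have [|n3] := boolP (x2 < y2).
  by move=> h; apply: (st (x1, x2 + 1)); move: hx hy; rewrite /adj /Isq /=; lia.
have [|n4] := boolP (y2 < x2).
  by move=> h; apply: (st (x1, x2 - 1)); move: hx hy; rewrite /adj /Isq /=; lia.
by rewrite (_ : (x1, x2) = (y1, y2)); [exact: reach_refl|congr (_, _); lia].
Qed.

Definition blk M : seq edge := [seq e <- EL M | inD (box M) e].

Lemma mem_blk M e : (e \in blk M) = inD (box M) e.
Proof. by rewrite mem_filter; case h : (inD _ _) => //=; apply: inD_box. Qed.

Lemma setb_incr (I : eqType) (b : seq I) g :
  forall i, setb b false g i -> setb b true g i.
Proof. by move=> i; rewrite /setb; case: ifP. Qed.

Lemma setb_false_le (I : eqType) (b : seq I) g : forall i, setb b false g i -> g i.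
Proof. by move=> i; rewrite /setb; case: ifP. Qed.

(** After its last visit to [box M] the arm uses no edge of the block, so this part of it survives
    closing the block. *)
Lemma arm_last_exit M n w d : d \in dirs -> (M < n)%N ->
  exits (- (n%:Z - 1)) (n%:Z - 1) (- M%:Z) M%:Z d w ->
  exists a y, [/\ box M a, ~~ Isq (- (n%:Z - 1)) (n%:Z - 1) (shift d y),
    Isq (- (n%:Z - 1)) (n%:Z - 1) y &
    reach (opn (setb (blk M) false w) (box n)) a (shift d y)].
Proof.
move=> dd Mn [x [y [hx hy ry ny wy]]]; rewrite Isq_box in hx.
have ad := dirs_adj y dd.
have by1 : box n (shift d y).
  by have := Isq_step ad hy; move: (shift d y) => [s1 s2]; rewrite /Isq /box /nrm /=; lia.
have sub z : Isq (- (n%:Z - 1)) (n%:Z - 1) z -> box n z.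
  by move: z => [z1 z2]; rewrite /Isq /box /nrm /=; lia.
have r1 : reach (opn w (box n)) x (shift d y).
  apply: (@reach_trans _ _ _ y); first by apply: reach_sub ry => a b; apply: sub_opn.
  by apply: reach1; rewrite /opn ad wy by1 sub.
have nM : ~~ box M (shift d y).
  by move: ny; move: (shift d y) => [s1 s2]; rewrite /Isq /box /nrm /=; lia.
have [a [b [Ma Mb ab rb]]] := reach_last_exit hx nM r1.
exists a, y; split=> //.
have keep u v : opn w (box n) u v -> ~~ box M v -> opn (setb (blk M) false w) (box n) u v.
  move=> /and4P[adj1 w1 Bu Bv] nv; rewrite /opn adj1 Bu Bv /setb mem_blk /inD.
  by case: (edge_ends adj1) => -[-> ->]; rewrite (negPf nv) ?andbF w1.
apply: (@reach_trans _ _ _ b); first by apply: reach1; apply: keep.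
by apply: reach_sub rb => u v /and3P[uv _ nv]; apply: keep.
Qed.

(** Parity of the steps of the dual path to the right of a primal vertex. The dual path is wholly to
    the right of [x] and climbs from below to above it, giving an odd count; none of it is to the
    right of [y]; and the parity is constant along open edges. *)
Lemma no_crossing w n x y q0 q1 :
  x.1 = - n%:Z -> box n x -> y.1 = n%:Z -> reach (opn w (box n)) x y ->
  q0.2 = - n%:Z - 1 -> q1.2 = n%:Z -> (- n%:Z <= q0.1 < n%:Z) ->
  reach (fun a b => dstep w a b && (- n%:Z <= b.1 < n%:Z)) q0 q1 -> False.
Proof.
move=> x1 bx y1 [p pp lp] q02 q12 hq0 [q pq lq].
have hp : path (pstep w) x p.
  by apply: sub_path pp => a b /and4P[ab wab _ _]; rewrite /pstep ab.
have hpb : all (box n) (x :: p).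
  rewrite /= bx; elim: p x {x1 bx lp hp} pp => [//|z p IH] x /= /andP[/and4P[_ _ _ ->] pz].
  exact: IH pz.
have hq : path (dstep w) q0 q by apply: sub_path pq => a b /andP[].
have hqb : all (fun a : vtx => - n%:Z <= a.1 < n%:Z) (q0 :: q).
  rewrite /= hq0; elim: q q0 {q02 hq0 lq hq} pq => [//|z q IH] q0 /= /andP[/andP[_ ->] pz].
  exact: IH pz.
have := @dcount_path w q0 q x p (- n%:Z) n%:Z hq hp.
rewrite q02 lq q12 lexx => /(_ _ isT).
have -> : (- n%:Z - 1 < - n%:Z) = true by lia.
move/(_ isT); have -> : all (fun z : vtx => - n%:Z <= z.2 <= n%:Z) (x :: p).
  by apply: sub_all hpb => -[z1 z2]; rewrite /box /nrm /=; lia.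
move/(_ isT); rewrite lp.
have -> : dcount q0 q y = 0%N.
  apply/eqP; rewrite -leqn0 leqNgt -has_count; apply/hasPn => -[a b] ab /=.
  have [aq _] := mem_steps ab; have := allP hqb _ aq; rewrite y1 /=; clear; lia.
pose A := fun z : vtx => z.2 < x.2.
have -> : dcount q0 q x = count (fun s => A s.1 (+) A s.2) (steps q0 q).
  apply: eq_in_count => -[a b] ab /=; have [aq _] := mem_steps ab.
  by have := allP hqb _ aq; rewrite x1 /= => /andP[-> _].
rewrite odd_toggle lq /A q02 q12; move: x bx {x1 A pp hp hpb lp} => [x1 x2].
by rewrite /box /nrm /=; case: ltP; case: ltP => /=; lia.
Qed.

Lemma Isq_dualcol n z : Isq (- n%:Z) (n%:Z - 1) z -> - n%:Z <= z.1 < n%:Z.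
Proof. by rewrite /Isq; lia. Qed.

(** [u] and [u'] are where the west and east arms first leave [D]. An open block joins the two arms
    inside [D]; a closed block joins the two dual arms into a vertical barrier between them. The
    region [D] is left free because it will be a box seen from an off-centre point. *)
Lemma four_arms_split M n (D : pred vtx) w : (0 < M)%N -> (M < n)%N -> four_arms M n w ->
  (forall x, box M x -> D x) -> (forall x, D x -> box n.-1 x) ->
  exists u u', [/\ D u /\ (exists2 b, adj u b & ~~ D b), D u' /\ (exists2 b, adj u' b & ~~ D b),
    reach (opn (setb (blk M) true w) D) u u' & ~ reach (opn (setb (blk M) false w) D) u u'].
Proof.
move=> M0 Mn [hW hE hN hS] MD Dn.
set w1 := setb (blk M) false w; set w2 := setb (blk M) true w.
have arm d : d \in dirs -> exits (- (n%:Z - 1)) (n%:Z - 1) (- M%:Z) M%:Z d w ->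
  exists a u y, [/\ box M a, [/\ D u, exists2 b, adj u b & ~~ D b & reach (opn w1 D) a u],
    ~~ Isq (- (n%:Z - 1)) (n%:Z - 1) (shift d y), Isq (- (n%:Z - 1)) (n%:Z - 1) y &
    reach (opn w1 (box n)) u (shift d y)].
  move=> dd /(arm_last_exit dd Mn) [a [y [ha ny hy ra]]].
  have nD : ~~ D (shift d y).
    by apply: contraNN ny => /Dn; rewrite -Isq_box /Isq; move: Mn; clear; lia.
  have [u [b [ru Du nb ub]]] := reach_exit (MD a ha) nD ra.
  have ru' : reach (opn w1 D) a u.
    by apply: reach_sub ru => z t; rewrite /on /opn -/w1 => /and3P[/and4P[-> -> _ _] -> ->].
  exists a, u, y; split=> //; first by split=> //; exists b => //; case/and4P: ub.
  apply: reach_trans ra; apply: reach_sym; first exact: opn_sym.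
  apply: reach_sub ru' => z t; apply: sub_opn => // s /Dn; clear; rewrite /box; lia.
have [aW [uW [yW [haW [DW bW rW] nyW hyW rW']]]] := arm (-1, 0) isT hW.
have [aE [uE [yE [haE [DE bE rE] nyE hyE rE']]]] := arm (1, 0) isT hE.
exists uW, uE; split; [by []|by []| |].
  have up z t : opn w1 D z t -> opn w2 D z t by apply: sub_opn => //; apply: setb_incr.
  apply: (@reach_trans _ _ _ aW); first by apply: reach_sym; [exact: opn_sym|apply: reach_sub rW].
  apply: (@reach_trans _ _ _ aE); last by apply: reach_sub rE.
  rewrite -!(Isq_box M) in haW haE.
  apply: reach_sub (Isq_connected haW haE) => z t; rewrite !Isq_box => /and3P[zt hz ht].
  rewrite /opn zt !MD // /w2 /setb mem_blk /inD.
  by case: (edge_ends zt) => -[-> ->]; rewrite hz ht.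
(* If the arms were joined with the block closed, they would form a horizontal open crossing of
   [box n], against the vertical dual crossing built below. *)
move=> rWE.
pose rd : rel vtx := fun a b => dstep w1 a b && (- n%:Z <= b.1 < n%:Z).
have dual_arm d : d \in [:: (0, 1); (0, -1)] ->
   exits (- n%:Z) (n%:Z - 1) (- M%:Z) (M%:Z - 1) d (dualc w) ->
   exists x y, [/\ Isq (- M%:Z) (M%:Z - 1) x, Isq (- n%:Z) (n%:Z - 1) y, ~~ Isq (- n%:Z) (n%:Z - 1) (shift d y)
     & reach (fun a b => dstep w1 a b && ((- n%:Z <= a.1 < n%:Z) && (- n%:Z <= b.1 < n%:Z))) x (shift d y)].
  move=> dd [x [y [hx hy ry ny wy]]]; exists x, y; split=> //.
  have cl e : ~~ w e -> ~~ w1 e by apply: contraNN; apply: setb_false_le.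
  apply: (@reach_trans _ _ _ y).
    by apply: reach_sub ry => z t /and4P[zt wzt hz ht]; rewrite /dstep zt cl // (Isq_dualcol hz) (Isq_dualcol ht).
  apply: reach1; rewrite /dstep cl // dirs_adj /=; last first.
    by move: dd; rewrite !in_cons in_nil orbF => /orP[] /eqP ->.
  by move: dd hy; clear; rewrite !in_cons in_nil orbF /Isq /shift => /orP[] /eqP -> /=; lia.
have [xN [yN [hxN hyN nyN rN]]] := dual_arm (0, 1) isT hN.
have [xS [yS [hxS hyS nyS rS]]] := dual_arm (0, -1) isT hS.
apply: (@no_crossing w1 n (shift (-1, 0) yW) (shift (1, 0) yE) (shift (0, -1) yS) (shift (0, 1) yN)).
- by move: hyW nyW; clear; rewrite /Isq /shift /=; lia.
- by move: hyW nyW; clear; rewrite /Isq /box /nrm /shift /=; lia.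
- by move: hyE nyE; clear; rewrite /Isq /shift /=; lia.
- apply: (@reach_trans _ _ _ uW); first by apply: reach_sym; [exact: opn_sym|].
  apply: reach_trans rE'; apply: reach_sub rWE => z t; apply: sub_opn => // s /Dn; clear; rewrite /box; lia.
- by move: hyS nyS; clear; rewrite /Isq /shift /=; lia.
- by move: hyN nyN; clear; rewrite /Isq /shift /=; lia.
- by move: hyS nyS; clear; rewrite /Isq /shift /=; lia.
apply: (@reach_sub _ (fun a b => dstep w1 a b && ((- n%:Z <= a.1 < n%:Z) && (- n%:Z <= b.1 < n%:Z)))).
  by move=> a b /andP[-> /andP[_ ->]].
apply: (@reach_trans _ _ _ xS).
  apply: reach_sym => // a b; rewrite /dstep adj_sym andbC [in RHS]andbC.
  by case ab : (adj b a); rewrite ?andbF //= (edge_of_sym ab) [(_ <= a.1 < _) && _]andbC.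
apply: (@reach_trans _ _ _ xN) => //.
apply: reach_sub (Isq_connected hxS hxN) => z t /and3P[zt hz ht].
rewrite /dstep zt /w1 /setb mem_blk.
have -> : inD (box M) (dl (edge_of z t)).
  rewrite /inD -!(Isq_box M); move: hz ht; case/adj_cases: zt => -[-> ->]; rewrite /Isq /dl /src /tgt /=;
    move: z => [z1 z2] /=; clear; lia.
by rewrite (Isq_dualcol (n := n)) // /Isq; move: hz ht Mn; clear; rewrite /Isq; lia.
Qed.

End FourArms.

(** * Counting the clusters that touch the boundary of a box *)

Section ClusterCount.
Variable R : realType.
Implicit Types (q : R) (a b x y v d : vtx) (e : edge) (w f : edge -> bool) (L : nat).

Definition rim L : seq vtx := [seq x <- VL L | nrm x == L].

Definition leader L w x : Prop :=
  forall y, y \in rim L -> (index y (rim L) < index x (rim L))%N -> ~ reach (opn w (box L)) x y.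

(* Clusters of [box L] touching its inner boundary, one leader each. *)
Definition nclust L w : R := \sum_(x <- rim L) ind R (leader L w x).

Lemma leader_decr L (f g : edge -> bool) x : (forall e, f e -> g e) -> leader L g x -> leader L f x.
Proof.
move=> fg lx y hy lt rxy; apply: (lx y hy lt).
by apply: reach_sub rxy => a b; apply: sub_opn.
Qed.

Lemma nclust_decr L : decr (nclust L).
Proof. by move=> f g fg; apply: ler_sum => x _; apply: le_ind; apply: leader_decr. Qed.

Lemma nclust_ge0 L w : 0 <= nclust L w.
Proof. by apply: sumr_ge0 => x _; apply: ind_ge0. Qed.

Lemma uniq_rim L : uniq (rim L). Proof. by rewrite filter_uniq ?uniq_VL. Qed.

Lemma size_rim L : (size (rim L) <= 4 * L.*2.+1)%N.
Proof.
pose s1 (c : int) : seq vtx := [seq (c, i%:Z - L%:Z) | i <- iota 0 L.*2.+1].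
pose s2 (c : int) : seq vtx := [seq (i%:Z - L%:Z, c) | i <- iota 0 L.*2.+1].
have -> : (4 * L.*2.+1 = size (s1 L%:Z ++ s1 (- L%:Z) ++ s2 L%:Z ++ s2 (- L%:Z)))%N.
  by rewrite !size_cat !size_map size_iota; lia.
apply: uniq_leq_size (uniq_rim L) _ => -[x1 x2]; rewrite mem_filter mem_VL => /andP[/eqP nx bx].
rewrite !mem_cat; apply/or4P.
have m1 (c : int) : x1 = c -> (x1, x2) \in s1 c.
  move=> ->; apply/mapP; exists (absz (x2 + L%:Z)); rewrite ?mem_iota.
    by move: nx; rewrite /nrm /=; lia.
  by congr (_, _); move: nx; rewrite /nrm /=; lia.
have m2 (c : int) : x2 = c -> (x1, x2) \in s2 c.
  move=> ->; apply/mapP; exists (absz (x1 + L%:Z)); rewrite ?mem_iota.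
    by move: nx; rewrite /nrm /=; lia.
  by congr (_, _); move: nx; rewrite /nrm /=; lia.
have : x1 = L%:Z \/ x1 = - L%:Z \/ x2 = L%:Z \/ x2 = - L%:Z by move: nx; rewrite /nrm /=; lia.
by case=> [/m1|[/m1|[/m2|/m2]]] h; [apply: Or41|apply: Or42|apply: Or43|apply: Or44].
Qed.

Lemma nclust_le L w : nclust L w <= (4 * L.*2.+1)%:R.
Proof.
apply: (@le_trans _ _ (size (rim L))%:R); last by rewrite ler_nat size_rim.
rewrite -sum1_size natr_sum; apply: ler_sum => x _; exact: ind_le1.
Qed.

Lemma leader_exists L w u : u \in rim L ->
  exists z, [/\ z \in rim L, reach (opn w (box L)) u z & leader L w z].
Proof.
move=> uR.
pose P i := (i < size (rim L))%N && `[< reach (opn w (box L)) u (nth u (rim L) i) >].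
have exP : exists i, P i.
  exists (index u (rim L)); rewrite /P index_mem uR nth_index //.
  by apply/asboolP; apply: reach_refl.
case: (ex_minnP exP) => i /andP[isz /asboolP ri] imin.
exists (nth u (rim L) i); split=> //; first exact: mem_nth.
move=> y yR lt rzy; have : P (index y (rim L)).
  rewrite /P index_mem yR nth_index //; apply/asboolP; exact: reach_trans rzy.
move/imin; rewrite index_uniq ?uniq_rim // in lt; lia.
Qed.

(** Of the leaders of the two merged clusters, the one with the larger index stops being a leader,
    while no vertex becomes one when edges are opened. *)
Lemma nclust_merge L w w' u v : (forall e, w e -> w' e) -> u \in rim L -> v \in rim L ->
  ~ reach (opn w (box L)) u v -> reach (opn w' (box L)) u v ->
  1 <= nclust L w - nclust L w'.
Proof.
move=> ww uR vR nuv ruv.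
have [zu [zuR ru lu]] := leader_exists w uR.
have [zv [zvR rv lv]] := leader_exists w vR.
have up a b : reach (opn w (box L)) a b -> reach (opn w' (box L)) a b.
  by apply: reach_sub => s t; apply: sub_opn.
have ruv' : reach (opn w' (box L)) zu zv.
  apply: (@reach_trans _ _ _ u); first by apply: reach_sym; [exact: opn_sym|apply: up].
  by apply: reach_trans ruv _; apply: up.
have nz : zu <> zv.
  move=> E; apply: nuv; apply: reach_trans ru _; rewrite E.
  by apply: reach_sym => //; exact: opn_sym.
have [z [zR lz nz']] : exists z, [/\ z \in rim L, leader L w z & ~ leader L w' z].
  case: (ltngtP (index zu (rim L)) (index zv (rim L))) => h.
  - exists zv; split=> // l; apply: (l zu zuR h); apply: reach_sym => //; exact: opn_sym.
  - by exists zu; split=> // l; apply: (l zv zvR h).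
  - by case: nz; rewrite -(nth_index zu zuR) h nth_index.
rewrite /nclust -sumrB (bigD1_seq z) ?uniq_rim //= (ind1 R lz) (ind0 R nz') subr0 lerDl.
by apply: sumr_ge0 => x _; rewrite subr_ge0; apply: le_ind; apply: leader_decr.
Qed.

End ClusterCount.

(** * A set with [phi < 1] at every parameter below one half *)

Section Subcritical.
Variable R : realType.
Implicit Types (q : R) (a b x y v d : vtx) (e : edge) (w f : edge -> bool) (L : nat).

Lemma act_shift v e : act (shift v) e = (shift v e.1, e.2).
Proof.
rewrite /act; have : adj (shift v (src e)) (shift v (tgt e)) by rewrite adj_shift adj_edge.
move: e v => [[e1 e2] d] [v1 v2]; rewrite /src /tgt /shift /=.
case/adj_cases => -[h ->]; have h1 := congr1 fst h; have h2 := congr1 snd h;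
  move: h1 h2; case: d {h} => /=; clear => h1 h2; congr ((_, _), _); lia.
Qed.

Definition blkv M v : seq edge := map (act (shift v)) (blk M).

Lemma act_shiftK v : cancel (act (shift v)) (act (shift (opv v))).
Proof. by apply: act_cancel; [exact: adj_shift|exact: adj_shift|exact: shiftK]. Qed.
Lemma act_shiftKV v : cancel (act (shift (opv v))) (act (shift v)).
Proof. by apply: act_cancel; [exact: adj_shift|exact: adj_shift|exact: shiftKV]. Qed.

Lemma setb_blkv M v c w : setb (blkv M v) c w \o act (shift v) = setb (blk M) c (w \o act (shift v)).
Proof.
apply/funext => e; rewrite /setb /= /blkv mem_map //.
exact: can_inj (act_shiftK v).
Qed.

(** The size [n] is so large that arms drawn around any [v] of the grid leave [box L]; opening the
    block at [v] then merges two clusters seen on the rim. *)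
Lemma nclust_four_arms M L n v w : (0 < M)%N -> (M + nrm v <= L)%N -> (L + nrm v < n)%N ->
  four_arms M n (w \o act (shift v)) ->
  1 <= nclust R L (setb (blkv M v) false w) - nclust R L (setb (blkv M v) true w).
Proof.
move=> M0 hv hn; set D : pred vtx := box L \o shift v.
have MD x : box M x -> D x.
  by rewrite /D; move: x v hv {D hn} => [x1 x2] [v1 v2]; rewrite /box /nrm /shift /=; lia.
have Dn x : D x -> box n.-1 x.
  by rewrite /D; move: x v hn {D MD hv} => [x1 x2] [v1 v2]; rewrite /box /nrm /shift /=; lia.
have Mn : (M < n)%N by lia.
move/(four_arms_split M0 Mn)/(_ MD Dn) => [u [u' [[Du [b ub nDb]] [Du' [b' ub' nDb']] r2 r1]]].
have rimP z c : D z -> adj z c -> ~~ D c -> shift v z \in rim L.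
  rewrite /D /= mem_filter mem_VL => Dz zc nDc; rewrite Dz andbT.
  rewrite -(adj_shift v) in zc; have := nrm_adj zc; move: Dz nDc; rewrite /box; clear; lia.
apply: (@nclust_merge _ _ _ _ (shift v u) (shift v u')).
- exact: setb_incr.
- exact: (rimP u b).
- exact: (rimP u' b').
- move=> r; apply: r1; rewrite -setb_blkv -(shiftK v u) -(shiftK v u').
  apply: reach_opn_act; first exact: adj_shift.
  apply: reach_sub r => x y; apply: sub_opn => [e|z].
    by rewrite /= act_shiftKV.
  by rewrite /D /= shiftKV.
apply: reach_opn_act; first exact: adj_shift.
by rewrite setb_blkv.
Qed.

Lemma four_arms_agree M n f g : (M < n)%N -> (forall e, inD (box n.+2) e -> f e = g e) ->
  four_arms M n f -> four_arms M n g.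
Proof.
move=> Mn fg.
have p1 : forall e, inD (Isq (- (n%:Z - 1) - 1) (n%:Z - 1 + 1)) e -> f e = g e.
  move=> e /andP[h1 h2]; apply: fg; rewrite /inD -!(Isq_box n.+2).
  by move: h1 h2; rewrite /Isq; clear; lia.
have p2 : forall e, inD (Isq (- n%:Z - 1) (n%:Z - 1 + 1)) e -> dualc f e = dualc g e.
  move=> [[e1 e2] d] /andP[h1 h2]; rewrite /dualc fg // /inD -!(Isq_box n.+2).
  by move: h1 h2; rewrite /Isq /dl /src /tgt; clear; case: d => /=; lia.
move=> [h1 h2 h3 h4]; split.
- exact: (exits_agree _ p1 h1).
- exact: (exits_agree _ p1 h2).
- exact: (exits_agree _ p2 h3).
- exact: (exits_agree _ p2 h4).
Qed.

Lemma ler_sum_subset (T : eqType) (s1 s2 : seq T) (F : T -> R) : uniq s1 -> uniq s2 ->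
  {subset s1 <= s2} -> (forall i, 0 <= F i) -> \sum_(i <- s1) F i <= \sum_(i <- s2) F i.
Proof.
move=> u1 u2 s12 F0.
have E : \sum_(i <- s1) F i = \sum_(i <- s2 | i \in s1) F i.
  rewrite -[RHS]big_filter; apply: perm_big; apply: uniq_perm => //; first exact: filter_uniq.
  by move=> i; rewrite mem_filter; case h : (i \in s1) => //=; rewrite s12.
rewrite E [leRHS](bigID [in s1]) /= lerDl.
by apply: sumr_ge0.
Qed.

(** The spacing [2 * M + 1] makes the translated blocks disjoint, so that no edge is counted twice
    in the derivative. *)
Definition grid M K : seq vtx :=
  [seq (((2 * M).+1 * i)%:Z, ((2 * M).+1 * j)%:Z) | i <- iota 0 K, j <- iota 0 K].

Lemma grid_blocks_uniq M K : uniq (flatten [seq blkv M v | v <- grid M K]).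
Proof.
have -> : flatten [seq blkv M v | v <- grid M K] = [seq act (shift v) e | v <- grid M K, e <- blk M].
  by [].
apply: allpairs_uniq.
- apply: allpairs_uniq; rewrite ?iota_uniq // => -[i j] [i' j'] _ _ /= [h1 h2].
  by congr (_, _); move: h1 h2; clear; nia.
- by rewrite filter_uniq ?uniq_EL.
move=> [v e] [v' e'] /allpairsP [[v1 e1] /= [hv1 he1 [-> ->]]].
move=> /allpairsP [[v2 e2] /= [hv2 he2 [-> ->]]] /=.
move: he1 he2; rewrite !mem_blk !act_shift => /andP[h1 _] /andP[h2 _].
case/allpairsP: hv1 => -[i j] /= [_ _ ->]; case/allpairsP: hv2 => -[i' j'] /= [_ _ ->].
move: e1 e2 h1 h2 => [[x1 x2] d1] [[y1 y2] d2]; rewrite /src /= -!(Isq_box M) /Isq /shift /=.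
clear => h1 h2 [E1 E2 ->].
have Ei : i = i' by move: E1 h1 h2; clear; nia.
have Ej : j = j' by move: E2 h1 h2; clear; nia.
by subst; congr (_, ((_, _), _)); lia.
Qed.

Lemma size_grid M K : size (grid M K) = (K * K)%N.
Proof. by rewrite size_allpairs !size_iota. Qed.

Lemma grid_nrm M K v : v \in grid M K -> (nrm v + (2 * M).+1 <= (2 * M).+1 * K)%N.
Proof.
case/allpairsP => -[i j] /= [+ + ->]; rewrite !mem_iota /nrm /= => h1 h2.
have : ((2 * M).+1 * i.+1 <= (2 * M).+1 * K)%N by rewrite leq_mul2l; lia.
have : ((2 * M).+1 * j.+1 <= (2 * M).+1 * K)%N by rewrite leq_mul2l; lia.
by rewrite !mulnS; clear; set A := (_ * i)%N; set B := (_ * j)%N; set C := (_ * K)%N; lia.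
Qed.

(** Each of the [K * K] blocks carries four arms with probability at least 1/2, and then opening it
    lowers the cluster count by at least one. [Ex_block_dif] turns this into a contribution to the
    derivative; the box of size [N] holds all supports at once. *)
Lemma blocks_derivative q c M K L n N : 0 < c -> c <= q -> c <= 1 - q -> (0 < M)%N -> (0 < K)%N ->
  L = ((2 * M).+1 * K)%N -> n = (2 * L).+1 -> N = (n + L + 4)%N ->
  2^-1 <= Ex (pb q) (EL N) (fun w => ind R (four_arms M n w)) allc ->
  (K * K)%:R * (c ^+ size (blk M) * 2^-1) <=
    - \sum_(e <- EL N) Ex (pb q) (EL N) (dif e (nclust R L)) allc.
Proof.
move=> c0 cq cq' M0 K0 eL en eN h4.
have q01 : 0 <= q <= 1 by apply/andP; split; lra.
have hl := law_pb q01.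
have d0 e w : 0 <= - dif e (nclust R L) w.
  by rewrite /dif opprB subr_ge0; apply: nclust_decr; apply: upd_le.
rewrite -sumrN; under eq_bigr do rewrite -ExN.
pose G e := Ex (pb q) (EL N) (fun w => - dif e (nclust R L) w) allc.
have KL : (M < L)%N by rewrite eL; move: K0; clear; nia.
have sub : {subset flatten [seq blkv M v | v <- grid M K] <= EL N}.
  move=> e /flatten_mapP [v /grid_nrm hv /mapP [e' he' ->]].
  rewrite act_shift mem_EL /=; move: he'; rewrite mem_blk => /andP[+ _].
  rewrite /src; move: hv; rewrite -eL eN en; move: v (e'.1) => [v1 v2] [x1 x2].
  by rewrite /box /nrm /shift /=; move: KL; clear; lia.
apply: (@le_trans _ _ (\sum_(e <- flatten [seq blkv M v | v <- grid M K]) G e)); last first.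
  apply: ler_sum_subset => //; [exact: grid_blocks_uniq|exact: uniq_EL|].
  by move=> e; apply: Ex_ge0.
rewrite big_flatten big_map /= -(size_grid M K) -sum1_size natr_sum mulr_suml.
rewrite big_seq [leRHS]big_seq; apply: ler_sum => v hv; rewrite mul1r.
have sz : size (blkv M v) = size (blk M) by rewrite size_map.
have bsub : {subset blkv M v <= EL N}.
  by move=> e he; apply: sub; apply/flatten_mapP; exists v.
apply: le_trans (Ex_block_dif allc q01 (ltW c0) cq cq' _ (@nclust_decr R L) (uniq_EL N) bsub); last by lra.
rewrite sz; apply: ler_wpM2l; first by rewrite exprn_ge0 ?ltW.
have nv := grid_nrm hv.
apply: (@le_trans _ _ (Ex (pb q) (EL N) (fun w => ind R (four_arms M n (w \o act (shift v)))) allc)).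
  rewrite (@Ex_bij R q N (fun w => ind R (four_arms M n w)) (inD (box n.+2)) (act (shift (opv v))) (act (shift v)) allc allc) //.
  - exact: act_shiftKV.
  - exact: act_shiftK.
  - by apply: dep_ind => f g fg; apply: four_arms_agree => //; rewrite en; move: KL; clear; lia.
  - by move=> e /inD_box; apply: EL_sub; rewrite eN; clear; lia.
  - move=> e /andP[+ _]; rewrite act_shift mem_EL /= /src; move: nv; rewrite -eL eN en.
    by move: v (e.1) {hv sz bsub} => [v1 v2] [x1 x2]; rewrite /box /nrm /shift /=; clear; lia.
apply: Ex_le => // w.
have [h|h] := pselect (four_arms M n (w \o act (shift v))).
  rewrite ind1 //; apply: (@nclust_four_arms _ _ n) => //.
  - by move: nv; rewrite -eL; clear; lia.
  - by move: nv KL; rewrite -eL en; clear; lia.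
by rewrite ind0 // subr_ge0; apply: nclust_decr; apply: setb_incr.
Qed.

(** Choose [m] so that [theta p' m] exceeds the infimum of [theta p'] by a factor less than
    [1 + 8^-4]. By [hits_theta] the probability of reaching distance [n] from [box m] is at least
    the ratio [theta p' n / theta p' m], hence at least [1 / (1 + 8^-4)]. *)
Lemma hits_uniform (p' c : R) : 0 <= p' <= 1 -> 0 < c -> (forall n, c <= theta p' n) ->
  exists m, forall n, (m < n)%N ->
    1 - 8^-1 ^+ 4 <= Ex (pb p') (EL n) (fun w => ind R (hits m n w)) allc.
Proof.
move=> p01 c0 hc; pose A : set R := [set theta p' n | n in setT].
have hA : has_inf A.
  by split; [exists (theta p' 0), 0%N|exists c => _ [n _ <-]].
have lA : c <= inf A by apply: lb_le_inf; [case: hA|move=> _ [n _ <-]].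
have e0 : 0 < inf A * 8^-1 ^+ 4 :> R.
  by rewrite mulr_gt0 ?exprn_gt0 ?invr_gt0 // (lt_le_trans c0).
have [_ [m _ <-] hm] := inf_adherent e0 hA.
exists m => n mn; have h1 := hits_theta p01 mn.
have h2 : inf A <= theta p' n by apply: ge_inf; [case: hA|exists n].
set h := Ex _ _ _ _ in h1 *.
have h0 : 0 <= h by apply: Ex_ge0 (law_pb p01) _ => w; apply: ind_ge0.
have i0 : 0 < inf A by apply: lt_le_trans lA.
set e := 8^-1 ^+ 4 in hm *.
have e0' : 0 < e by rewrite exprn_gt0 ?invr_gt0.
have h3 : inf A <= inf A * ((1 + e) * h).
  apply: le_trans h2 _; apply: le_trans h1 _; rewrite mulrA; apply: ler_wpM2r => //.
  by rewrite mulrDr mulr1 ltW.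
have h4 : 1 <= (1 + e) * h by rewrite -(ler_pM2l i0) mulr1.
by nra.
Qed.

(* Otherwise theta stays bounded below on [p', 1/2], four alternating arms
   start from every large block, and the number of clusters touching the
   boundary of a box of side L would decrease by order L^2 between p' and 1/2. *)
Lemma subcritical_phi (p : R) : 0 <= p -> p < 2^-1 ->
  exists n S, [/\ origin \in S, (forall x, x \in S -> (nrm x < n)%N) & phi p n S < 1].
Proof.
move=> p0 p2; apply: contrapT => hn.
have hphi n S : origin \in S -> (forall x, x \in S -> (nrm x < n)%N) -> 1 <= phi p n S.
  by move=> oS h; rewrite leNgt; apply/negP => lt; apply: hn; exists n, S.
(* The midpoint separates two uses: from [p] to [p'] the differential inequality makes [theta p' n]
   at least [c], and from [p'] to 1/2 both [q] and [1 - q] are at least [p'], so primal and dual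
   arms are likely together. *)
pose p' := (p + 2^-1) / 2; have pp' : p < p' by rewrite /p'; lra.
have p'2 : p' < 2^-1 by rewrite /p'; lra.
have p01 : 0 <= p' <= 1 by apply/andP; split; lra.
pose c := (p' - p) / 2; have c0 : 0 < c by rewrite /c; lra.
have hc n : c <= theta p' n by apply: theta_ge_sub => //; [lra|move=> S; apply: hphi].
have [m hm] := hits_uniform p01 c0 hc.
have hq q k : p' <= q -> q <= 1 -> (m < k)%N ->
    1 - 8^-1 ^+ 4 <= Ex (pb q) (EL k) (fun w => ind R (hits m k w)) allc.
  move=> hq1 hq2 mk; apply: le_trans (hm _ mk) _.
  by apply: Ex_pb_mono => //; [case/andP: p01|exact: incr_hits].
set M := m.+1.
pose kap := (2^-1 - p') * (p' ^+ size (blk M) * 2^-1).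
have p'0 : 0 < p' by lra.
have kap0 : 0 < kap by rewrite /kap !mulr_gt0 ?exprn_gt0 ?invr_gt0 ?subr_gt0.
(* The cluster count is at most [4 * (2 * L + 1) <= 4 * (4 * M + 3) * K], while its expectation
   drops by at least [K * K * kap]; any [K] above [B] gives the contradiction. *)
pose B : R := (4 * (4 * M + 3))%:R / kap.
have B0 : 0 <= B by rewrite /B divr_ge0 ?ler0n // ltW.
have [K hK] : exists K : nat, B < K%:R by exists (Num.bound B); exact: archi_boundP.
have K0 : (0 < K)%N by rewrite -(ltr_nat R) (le_lt_trans B0).
have [L eL] : exists L, L = ((2 * M).+1 * K)%N by eexists.
have [n en] : exists n, n = (2 * L).+1 by eexists.
have [N eN] : exists N, N = (n + L + 4)%N by eexists.
pose g q := Ex (pb q) (EL N) (nclust R L) allc.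
pose dg q := \sum_(e <- EL N) Ex (pb q) (EL N) (dif e (nclust R L)) allc.
have der q : is_derive q (1 : R) g (dg q) by exact: Russo (uniq_EL N).
have [|] := @MVT R g dg p' 2^-1 p'2 (fun q _ => der q).
  apply: continuous_in_subspaceT => q _; apply: differentiable_continuous.
  by apply/derivable1_diffP; have [] := der q.
move=> xi /[!in_itv] /= /andP[xi0 xi1] E.
have ML : (M < L)%N by rewrite eL; move: K0; clear; nia.
have h4 : 2^-1 <= Ex (pb xi) (EL N) (fun w => ind R (four_arms M n w)) allc.
  apply: four_arms_prob.
  - by apply/andP; split; lra.
  - by rewrite en; move: ML; rewrite /M; clear; lia.
  - by rewrite eN; clear; lia.
  move=> q' [->|->]; apply: hq; try lra; rewrite en; move: ML; rewrite /M; clear; lia.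
have hd : (K * K)%:R * (p' ^+ size (blk M) * 2^-1) <= - dg xi.
  by apply: (@blocks_derivative xi p' M K L n N) => //; lra.
have g0 : 0 <= g 2^-1.
  by apply: Ex_ge0; [apply: law_pb; apply/andP; split; lra|move=> w; apply: nclust_ge0].
have g1 : g p' <= (4 * L.*2.+1)%:R.
  apply: (@le_trans _ _ (Ex (pb p') (EL N) (fun=> (4 * L.*2.+1)%:R) allc)).
    by apply: Ex_le (law_pb p01) _ => w; apply: nclust_le.
  by rewrite Ex_cst //; apply: law_pb.
have h5 : (K * K)%:R * kap <= (4 * (4 * M + 3))%:R * K%:R.
  apply: (@le_trans _ _ (4 * L.*2.+1)%:R).
    have : (2^-1 - p') * ((K * K)%:R * (p' ^+ size (blk M) * 2^-1)) <= (2^-1 - p') * (- dg xi).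
      by rewrite ler_pM2l ?subr_gt0.
    rewrite /kap mulrCA => h; apply: le_trans h _.
    by move: E g0 g1; rewrite mulrN mulrC; lra.
  by rewrite -natrM ler_nat eL; move: K0; clear; nia.
have Kr : 0 < K%:R :> R by rewrite ltr0n.
move: h5; rewrite natrM mulrAC ler_pM2r // => h5.
by move: hK; rewrite /B ltr_pdivrMr // ltNge h5.
Qed.

End Subcritical.

(** * Exponential decay from a set with [phi < 1] *)

Section Decay.
Variable R : realType.
Implicit Types (q : R) (a b x y z v : vtx) (d : bool) (e : edge) (w f : edge -> bool) (S C : seq vtx).

Definition dst x y : nat := nrm (shift (opv x) y).

Lemma reach_conn_at n w (D : pred vtx) z y : reach (opn w D) z y -> (n <= dst z y)%N ->
  conn0 n (w \o act (shift z)).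
Proof.
move=> r hy; case: (posnP n) => [->|n0]; first by exists origin => //; apply: reach_refl.
pose A : pred vtx := fun x => (dst z x < n)%N.
have Az : A z.
  by rewrite /A /dst; move: n0; clear; case: z => [z1 z2]; rewrite /shift /opv /nrm /=; lia.
have Ay : ~~ A y by rewrite /A -leqNgt.
have [a [b [ra Aa Ab ab]]] := reach_exit Az Ay r.
have /and4P[adjab wab _ _] := ab.
have adjs : adj (shift (opv z) a) (shift (opv z) b) by rewrite adj_shift.
have hb : dst z b = n.
  by have := nrm_adj adjs; move: Aa Ab; rewrite /A /dst; clear; lia.
exists (shift (opv z) b); first by rewrite -/(dst z b) hb.
have <- : shift (opv z) z = origin.
  by clear; case: z => [z1 z2]; rewrite /shift /opv /origin /=; congr (_, _); lia.
apply: reach_opn_act; first exact: adj_shift.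
have Ew : (w \o act (shift z)) \o act (shift (opv z)) = w.
  by apply/funext => e /=; rewrite act_shiftKV.
rewrite Ew; apply: (@reach_trans _ _ _ a).
  apply: reach_sub ra => u v /and3P[/and4P[uv wuv _ _] Au Av].
  by rewrite /opn uv wuv; move: Au Av; rewrite /A /dst /box /=; clear; lia.
apply: reach1; rewrite /opn adjab wab /box /= -/(dst z a) -/(dst z b) hb leqnn andbT.
exact: ltnW.
Qed.

Lemma act_shift_EL k n v e : (k + nrm v <= n)%N -> e \in EL k -> act (shift v) e \in EL n.
Proof.
move=> h; rewrite act_shift !mem_EL /=; move: v (e.1) h => [v1 v2] [x1 x2].
by rewrite /box /nrm /shift /=; clear; lia.
Qed.

Lemma conn0_agree n f g : (forall e, inD (box n) e -> f e = g e) -> conn0 n f -> conn0 n g.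
Proof. by move=> fg [y ny ry]; exists y => //; apply: reach_agree ry. Qed.

Lemma theta_shift q n N z f : 0 <= q <= 1 -> (n + nrm z <= N)%N ->
  Ex (pb q) (EL N) (fun w => ind R (conn0 n (w \o act (shift z)))) f = theta q n.
Proof.
move=> q01 hN.
have dc : dep (R := R) (inD (box n)) (fun w => ind R (conn0 n w)).
  by apply: dep_ind; apply: conn0_agree.
rewrite (@Ex_bij R q N (fun w => ind R (conn0 n w)) (inD (box n)) (act (shift (opv z))) (act (shift z)) f allc) //.
- apply: (@Ex_EL _ _ _ _ _ _ _ (inD (box n))) => //.
    by move=> e /inD_box; apply: EL_sub; move: hN; clear; lia.
  by move=> e /inD_box.
- exact: act_shiftKV.
- exact: act_shiftK.
- by move=> e /inD_box; apply: EL_sub; move: hN; clear; lia.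
by move=> e /inD_box; apply: act_shift_EL.
Qed.

Lemma Ex_edge q n e f : 0 <= q <= 1 -> e \in EL n ->
  Ex (pb q) (EL n) (fun w => (w e)%:R) f = q :> R.
Proof.
move=> q01 he.
rewrite (@Ex_same _ _ _ (pb q) (EL n) [:: e] (pred1 e)) ?uniq_EL //; first last.
- by move=> e' /eqP ->; rewrite he mem_head.
- by move=> g g' gg; rewrite gg //= eqxx.
- exact: law_pb.
by rewrite Ex_pb_cons /= /upd eqxx /= mulr1 mulr0 addr0.
Qed.

Definition core S w : seq vtx := [seq x <- S | `[< reach (opn w [in S]) origin x >]].

Lemma mem_core S w x : x \in core S w = (x \in S) && `[< reach (opn w [in S]) origin x >].
Proof. by rewrite mem_filter andbC. Qed.

Definition touches S C : pred edge := fun e => inD [in S] e && ((src e \in C) || (tgt e \in C)).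

Lemma core_agree S C w w' : origin \in S -> (forall e, touches S C e -> w e = w' e) ->
  core S w = C -> core S w' = C.
Proof.
move=> oS ww hC.
have oC : origin \in C by rewrite -hC mem_core oS; apply/asboolP; apply: reach_refl.
rewrite -hC; apply: eq_in_filter => x xS; apply/asboolP/asboolP.
- (* a path from the origin in the new configuration never leaves [C] *)
  suff h : forall y, reach (opn w' [in S]) origin y -> y \in C.
    by move/h; rewrite -hC mem_core => /andP[_ /asboolP].
  move=> y; apply: (reach_inv (Q := fun y => y \in C)) => // a b /and4P[ab wab aS bS] aC.
  have : a \in core S w by rewrite hC.
  rewrite -hC !mem_core => /andP[_ /asboolP ra]; rewrite bS; apply/asboolP.
  apply: reach_trans ra _; apply: reach1; rewrite /opn ab aS bS ww ?wab //.
  by rewrite /touches /inD; case: (edge_ends ab) => -[-> ->]; rewrite aS bS aC ?orbT.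
move=> [p pp lp]; suff [h _] : reach (opn w' [in S]) origin x /\ x \in C by [].
elim/last_ind: p x {xS} pp lp => [|p y IH] x; first by move=> _ <-; split=> //; apply: reach_refl.
rewrite rcons_path last_rcons => /andP[pp st] <-.
have [r1 c1] := IH _ pp erefl.
have rw : reach (opn w [in S]) origin y by exists (rcons p y); rewrite ?rcons_path ?last_rcons ?pp.
have /and4P[ab wab aS bS] := st.
have yC : y \in C by rewrite -hC mem_core bS; apply/asboolP.
split=> //; apply: reach_trans r1 _; apply: reach1; rewrite /opn ab aS bS -ww ?wab //.
by rewrite /touches /inD; case: (edge_ends ab) => -[-> ->]; rewrite aS bS yC ?orbT.
Qed.

Definition avoid C n : pred vtx := fun x => box n x && (x \notin C).

(** At its last visit to the cluster [C] of the origin in [S] the path must leave [S] itself, since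
    any step within [S] would stay in [C]; afterwards it avoids [C]. *)
Lemma conn0_core S n k w : origin \in S -> (forall x, x \in S -> (nrm x < n)%N) -> (n <= k)%N ->
  conn0 k w -> exists e d, [/\ e \in EL n, (oe e d).1 \in core S w, (oe e d).2 \notin S, w e &
    exists2 y, nrm y == k & reach (opn w (avoid (core S w) k)) (oe e d).2 y].
Proof.
move=> oS hS nk [y ny ry]; set C := core S w.
have oC : origin \in C by rewrite mem_core oS; apply/asboolP; apply: reach_refl.
have yC : y \notin C.
  rewrite mem_core negb_and; apply/orP; left; apply: contraL ny => /hS; move: nk; clear; lia.
have [a [b [aC bC ab rb]]] := reach_last_exit (A := [in C]) oC yC ry.
have /and4P[adjab wab Ba Bb] := ab.
have aS : a \in S by move: aC; rewrite /= mem_core => /andP[].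
have bS : b \notin S.
  apply: contraNN bC => bS /=; rewrite mem_core bS; apply/asboolP.
  move: aC; rewrite /= mem_core => /andP[_ /asboolP ra].
  by apply: reach_trans ra _; apply: reach1; rewrite /opn adjab wab aS bS.
have rb' : exists2 y, nrm y == k & reach (opn w (avoid C k)) b y.
  exists y => //; apply: reach_sub rb => u v /and3P[/and4P[uv wuv Bu Bv] Cu Cv].
  by rewrite /opn uv wuv /avoid Bu Bv; move: Cu Cv => /= -> ->.
have na := hS _ aS; have nb := nrm_adj adjab.
have eE : edge_of a b \in EL n.
  rewrite mem_EL -/(src _) /box; case: (edge_ends adjab) => -[-> _]; move: na nb; clear; lia.
case: (edge_ends adjab) => -[hs ht].
  by exists (edge_of a b), true; rewrite /= hs ht.
by exists (edge_of a b), false; rewrite /= hs ht.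
Qed.

(** Simon's inequality, by conditioning on the cluster [C] of the origin in [S]: the event
    [core S w = C], the state of the edge leaving [S], and the continuation avoiding [C] live on
    three disjoint sets of edges. *)
Lemma theta_decay q R0 S n : 0 <= q <= 1 -> origin \in S -> (forall x, x \in S -> (nrm x < R0)%N) ->
  theta q (n + R0) <= phi q R0 S * theta q n.
Proof.
move=> q01 oS hS; set N := (n + R0)%N; have hl := law_pb q01; have [q0 q1] := andP q01.
have RN : (R0 <= N)%N by rewrite leq_addl.
have [vals uv vP] := sublists S.
pose far C z w := exists2 y, nrm y == N & reach (opn w (avoid C N)) z y.
pose G C w := \sum_(e <- EL R0) \sum_(d <- [:: true; false])
  (((oe e d).1 \in C) && ((oe e d).2 \notin S))%:R * ((w e)%:R * ind R (far C (oe e d).2 w)).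
apply: (@le_trans _ _ (Ex (pb q) (EL N) (fun w => G (core S w) w) allc)).
  apply: Ex_le => // w; rewrite /G.
  have t0 e d : 0 <= (((oe e d).1 \in core S w) && ((oe e d).2 \notin S))%:R *
      ((w e)%:R * ind R (far (core S w) (oe e d).2 w)).
    by rewrite !mulr_ge0 ?ler0n ?ind_ge0.
  have [c|c] := pselect (conn0 N w); last first.
    by rewrite ind0 //; apply: sumr_ge0 => e _; apply: sumr_ge0.
  have [e [d [he h1 h2 we hf]]] := conn0_core oS hS RN c.
  rewrite ind1 // (bigD1_seq e) ?uniq_EL //=.
  apply: ler_wpDr; first by apply: sumr_ge0 => e' _; apply: sumr_ge0.
  rewrite big_cons big_seq1.
  have one : (((oe e d).1 \in core S w) && ((oe e d).2 \notin S))%:R *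
      ((w e)%:R * ind R (far (core S w) (oe e d).2 w)) = 1.
    by rewrite h1 h2 we ind1 ?mulr1.
  by case: d one {h1 h2 hf} => ->; [rewrite lerDl|rewrite lerDr].
rewrite (@Ex_decouple _ _ _ (pb q) (EL N) allc _ (core S) vals G uv); last by move=> w; apply: vP.
have phiE : phi q R0 S * theta q n = \sum_(C <- vals) Ex (pb q) (EL N) (fun w => (core S w == C)%:R) allc *
   (\sum_(e <- EL R0) \sum_(d <- [:: true; false])
     (((oe e d).1 \in C) && ((oe e d).2 \notin S))%:R * (q * theta q n)).
  under eq_bigr do rewrite -ExZr.
  rewrite -(@Ex_decouple _ _ _ (pb q) (EL N) allc _ (core S) vals (fun C _ => \sum_(e <- EL R0) \sum_(d <- [:: true; false])
     (((oe e d).1 \in C) && ((oe e d).2 \notin S))%:R * (q * theta q n)) uv); last by move=> w; apply: vP.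
  rewrite Ex_sum /phi mulrAC big_distrr; apply: eq_bigr => e _.
  rewrite Ex_sum big_distrr; apply: eq_bigr => d _.
  rewrite ExZr [LHS]mulrC; congr (_ * _).
  rewrite (@Ex_EL _ q R0 N _ allc allc (inD [in S])) //; last 3 first.
  - exact: dep_reach.
  - by move=> e' /andP[/hS h _]; rewrite mem_EL /box ltnW.
  - by move=> e' /andP[/hS h _]; rewrite mem_EL /box ltnW // (leq_trans h).
  rewrite -ExZ; apply: eq_Ex => w; rewrite /cut mem_core.
  case: (_ \in S); rewrite ?mul0r //=; case: (_ \notin S); rewrite ?mul0r ?andbF ?mul1r //=.
  by rewrite andbT.
rewrite phiE; apply: ler_sum => C _.
rewrite -ExZr.
under eq_Ex do rewrite /G big_distrr.
under [leRHS]eq_Ex do rewrite big_distrr.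
rewrite !Ex_sum big_seq [leRHS]big_seq; apply: ler_sum => e he.
under eq_Ex do rewrite big_distrr.
under [leRHS]eq_Ex do rewrite big_distrr.
rewrite !Ex_sum; apply: ler_sum => d _.
pose c : R := (((oe e d).1 \in C) && ((oe e d).2 \notin S))%:R.
apply: (@le_trans _ _ (c * Ex (pb q) (EL N)
    (fun w => (core S w == C)%:R * ((w e)%:R * ind R (far C (oe e d).2 w))) allc)).
  by rewrite -ExZ le_eqVlt; apply/orP; left; apply/eqP; apply: eq_Ex => w /=; rewrite -/c; ring.
apply: (@le_trans _ _ (c * Ex (pb q) (EL N) (fun w => (core S w == C)%:R * (q * theta q n)) allc));
  last by rewrite -ExZ le_eqVlt; apply/orP; left; apply/eqP; apply: eq_Ex => w /=; rewrite -/c; ring.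
rewrite /c {c}; case: (boolP ((_ \in C) && _)) => [/andP[h1 h2]|_]; last by rewrite !mul0r.
rewrite !mul1r.
have fstsnd : ~~ touches S C e.
  by rewrite /touches /inD; move: h2; case: (d) => /= /negPf ->; rewrite ?andbF.
have nav : ~~ inD (avoid C N) e.
  by rewrite /inD /avoid; move: h1; case: (d) => /= ->; rewrite !andbF.
have dfar : dep (R := R) (inD (avoid C N)) (fun w => ind R (far C (oe e d).2 w)).
  by apply: dep_ind => f g fg [y ny ry]; exists y => //; apply: reach_agree ry.
have de : dep (R := R) (pred1 e) (fun w : edge -> bool => (w e)%:R).
  by move=> g g' gg; rewrite gg //= eqxx.
rewrite (@Ex_indep _ _ _ (pb q) (EL N) (touches S C) (fun e' => pred1 e e' || inD (avoid C N) e')) //; last first.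
- move=> e' h /orP[/eqP E|]; first by rewrite E (negPf fstsnd) in h.
  by move: h; rewrite /inD /avoid /touches => /andP[_ /orP[] ->]; rewrite ?andbF.
- exact: dep_mul de dfar.
- move=> f g fg; congr (_%:R); congr nat_of_bool; apply/eqP/eqP; apply: core_agree => // e'' /fg //.
rewrite ExZr.
have [fS|fS] := boolP ((oe e d).1 \in S); last first.
  rewrite (_ : (fun w => (core S w == C)%:R) = fun=> 0) ?Ex_cst ?mul0r //.
  apply/funext => w; rewrite (_ : (core S w == C) = false) //.
  by apply: contraNF fS => /eqP EC; move: h1; rewrite -EC mem_core => /andP[].
have nz : (nrm (oe e d).2 <= R0)%N.
  by apply: leq_trans (hS _ fS); apply: nrm_adj; apply: oe_adj.
apply: ler_wpM2l; first by apply: Ex_ge0 => // w; apply: ler0n.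
rewrite (Ex_indep (EL N) allc hl de dfar); last by move=> e' /= /eqP ->; rewrite (negPf nav).
rewrite Ex_edge //; last exact: (EL_sub RN).
apply: ler_wpM2l => //.
(* The outer end of the edge has norm at most [R0], so from there the boundary of [box (n + R0)] is
   still at distance at least [n]. *)
rewrite -(@theta_shift q n N (oe e d).2 allc q01); last by rewrite leq_add2l.
apply: Ex_le => // w; apply: le_ind => -[y ny ry]; apply: reach_conn_at ry _.
move: ny nz; rewrite /dst /N; clear; move: y (oe e d).2 => [y1 y2] [z1 z2].
by rewrite /nrm /shift /opv /=; lia.
Qed.

End Decay.

(** * Self-avoiding paths with few slow edges *)

Section SelfAvoiding.
Variable R : realType.
Implicit Types (q : R) (a b c x y z v : vtx) (e : edge) (w f : edge -> bool) (X W p : seq vtx).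

Lemma dst_self x : dst x x = 0%N.
Proof. by case: x => a b; rewrite /dst /shift /opv /nrm /=; lia. Qed.
Lemma dst_sym x y : dst x y = dst y x.
Proof. by case: x y => [a b] [c d]; rewrite /dst /shift /opv /nrm /=; lia. Qed.
Lemma dst_tri x y z : (dst x z <= dst x y + dst y z)%N.
Proof. by case: x y z => [a b] [c d] [e f]; rewrite /dst /shift /opv /nrm /=; lia. Qed.
Lemma dst_adj x y : adj x y -> dst x y = 1%N.
Proof. by case: x y => [a b] [c d]; rewrite /adj /dst /shift /opv /nrm /=; lia. Qed.
Lemma dst_shift x y : dst x (shift x y) = nrm y.
Proof. by case: x y => [a b] [c d]; rewrite /dst /shift /opv /nrm /=; lia. Qed.
Lemma nrm_dst x y : (nrm y <= nrm x + dst x y)%N.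
Proof. by case: x y => [a b] [c d]; rewrite /dst /shift /opv /nrm /=; lia. Qed.

Definition ball x (k : nat) : seq vtx := map (shift x) (VL k).
Lemma mem_ball x k y : (y \in ball x k) = (dst x y <= k)%N.
Proof.
apply/mapP/idP => [[z + ->]|h]; first by rewrite mem_VL dst_shift.
exists (shift (opv x) y); first by rewrite mem_VL.
by rewrite shiftKV.
Qed.
Lemma size_ball x k : size (ball x k) = (k.*2.+1 * k.*2.+1)%N.
Proof. by rewrite size_map size_allpairs !size_iota. Qed.

Lemma has_split (T : Type) (A : pred T) (s : seq T) : has A s ->
  exists s1 (t : T) s2, [/\ s = s1 ++ t :: s2, A t & ~~ has A s1].
Proof.
elim: s => [|t s IH] //=; case At : (A t) => /= h; first by exists [::], t, s.
have [s1 [b [s2 [-> Ab ns]]]] := IH h.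
by exists (t :: s1), b, s2; rewrite /= At.
Qed.

Lemma reach_mem (T : eqType) (r : rel T) (s : T) (t : seq T) (u : T) :
  path r s t -> u \in s :: t -> reach r s u.
Proof.
by move=> pt ut; case/splitPl: ut pt => t1 t2 <-; rewrite cat_path => /andP[pt1 _]; exists t1.
Qed.

Variable l : nat.

(** Balls of radius [l] about the points of [X] are disjoint, which makes the events of being joined
    to distance [l] independent. *)
Definition sep X := forall x y, x \in X -> y \in X -> x != y -> (l.*2 < dst x y)%N.
Definition jump : rel vtx := fun a b => (dst a b <= l.*2.+1)%N.
Definition vol := (l.*2.*2.+1 * l.*2.*2.+1)%N.

(* Greedy exploration of a long self-avoiding path: each new centre is within
   [l.*2.+1] of an older one, so a depth-first tour of the centres is a walk
   with two jumps per centre. *)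
Lemma skeleton x p j : path adj x p -> uniq (x :: p) -> (j * vol <= size p)%N ->
  exists W X, [/\ path jump x W, size W = (2 * j)%N, uniq X /\ size X = j.+1,
    X =i x :: W & sep X /\ {subset X <= x :: p}].
Proof.
move=> pp up; elim: j => [|j IH] hj.
  exists [::], [:: x]; split=> //; split=> //.
    by move=> a b; rewrite !mem_seq1 => /eqP -> /eqP ->; rewrite eqxx.
  by move=> a; rewrite mem_seq1 in_cons => ->.
have [|W [X [pW sW [uX sX] XW [spX Xp]]]] := IH; first by move: hj; clear; nia.
pose A b := all (fun c => l.*2 < dst c b)%N X.
have xX : x \in X by rewrite XW mem_head.
(* Otherwise the balls of radius [2 * l] about the centres, of [vol] vertices each, cover the path.
   Self-avoidance makes its vertices distinct, and there are too many of them. *)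
have hA : has A p.
  apply: contraT => nA; exfalso.
  have cov : {subset x :: p <= flatten [seq ball c l.*2 | c <- X]}.
    have near b : ~~ A b -> b \in flatten [seq ball c l.*2 | c <- X].
      rewrite /A -has_predC => /hasP [c cX /=]; rewrite -leqNgt => h.
      by apply/flatten_mapP; exists c; rewrite ?mem_ball.
    move=> b; rewrite in_cons => /orP[/eqP ->|bp].
      by apply/flatten_mapP; exists x; rewrite ?mem_ball ?dst_self.
    by apply: near; apply: contraNN nA => Ab; apply/hasP; exists b.
  have := uniq_leq_size up cov.
  have -> : size (flatten [seq ball c l.*2 | c <- X]) = (size X * vol)%N.
    elim: (X) => [//|c X' IHX].
    rewrite (_ : flatten [seq ball c l.*2 | c <- c :: X'] = ball c l.*2 ++ flatten [seq ball c l.*2 | c <- X']) //.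
    by rewrite size_cat size_ball IHX.
  by rewrite sX [size (_ :: _)]/= => h; have := leq_trans h hj; rewrite ltnn.
(* The new centre is the first vertex far from all old ones; its predecessor is within [2 * l] of
   some centre [c], whence the jump length [2 * l + 1]. *)
have [p1 [b [p2 [pE Ab np1]]]] := has_split hA.
have [c cX hc] : exists2 c, c \in X & (dst c (last x p1) <= l.*2)%N.
  case: p1 np1 {pE} => [|d p1] np1; first by exists x; rewrite ?dst_self.
  have : ~~ A (last x (d :: p1)).
    by apply: contraNN np1 => h; apply/hasP; exists (last x (d :: p1)); rewrite //= mem_last.
  by rewrite /A -has_predC => /hasP [c cX /=]; rewrite -leqNgt => h; exists c.
have ab : adj (last x p1) b by move: pp; rewrite pE cat_path /= => /and3P[].
have jcb : jump c b.
  by rewrite /jump; have := dst_tri c (last x p1) b; rewrite (dst_adj ab); move: hc; clear; lia.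
have jbc : jump b c by rewrite /jump dst_sym.
have bX : b \notin X.
  by apply/negP => bX; have /allP/(_ _ bX) := Ab; rewrite dst_self.
have [W' [pW' sW' mW']] : exists W', [/\ path jump x W', size W' = (2 * j.+1)%N &
    forall y, (y \in x :: W') = (y == b) || (y \in x :: W)].
  have := cX; rewrite XW in_cons => /orP[/eqP cx|cW].
    exists (b :: x :: W); split.
    - by rewrite /= -{1}cx jcb /= -cx jbc cx.
    - by rewrite /= sW; clear; lia.
    - by move=> y; rewrite !in_cons; case: (y == x); case: (y == b).
  case/splitPr: cW pW sW XW {IH} => W1 W2 pW sW XW.
  exists (W1 ++ c :: b :: c :: W2); split.
  - by move: pW; rewrite !cat_path /= jcb jbc.
  - by move: sW; rewrite !size_cat /=; clear; lia.
  - move=> y; rewrite !(in_cons, mem_cat).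
    by case: (y == x); case: (y == b); case: (y == c); case: (y \in W1).
exists W', (b :: X); split=> //.
- by rewrite /= bX uX sX.
- by move=> y; rewrite mW' in_cons XW.
have bfar d : d \in X -> (l.*2 < dst d b)%N by move=> dX; have /allP/(_ _ dX) := Ab.
split.
  move=> y z; rewrite !in_cons => /orP[/eqP->|yX] /orP[/eqP->|zX]; rewrite ?eqxx //.
  - by move=> _; rewrite dst_sym bfar.
  - by move=> _; rewrite bfar.
  - exact: spX.
move=> y; rewrite in_cons => /orP[/eqP ->|]; last exact: Xp.
by rewrite in_cons pE mem_cat mem_head !orbT.
Qed.

Definition nhigh w x p := count (fun s => ~~ w (edge_of s.1 s.2)) (steps x p).

Definition open_at w y := conn0 l (w \o act (shift y)).

(** If all edges of the path near [y] were fast, following it from [y] towards [y'] would join [y]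
    to distance [l]. The path is used in both directions, as [y'] may come before [y]. *)
Lemma high_near w x p y y' : (0 < l)%N -> path adj x p -> y \in x :: p -> y' \in x :: p ->
  (l.*2 < dst y y')%N -> ~ open_at w y ->
  exists s, [/\ s \in steps x p, ~~ w (edge_of s.1 s.2), (dst y s.1 <= l)%N & (dst y s.2 <= l)%N].
Proof.
move=> l0 pp yp yp' far nop; apply: contrapT => nh; apply: nop.
pose r : rel vtx := fun a b => ((a, b) \in steps x p) || ((b, a) \in steps x p).
have rs : symmetric r by move=> a b; rewrite /r orbC.
have pr : path r x p.
  by rewrite path_steps; apply/allP => -[a b] ab; rewrite /r /= ab.
have rx z : z \in x :: p -> reach r x z by exact: reach_mem.
have ryy : reach r y y' by apply: reach_trans (rx _ yp'); apply: reach_sym => //; apply: rx.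
pose A : pred vtx := fun b => (dst y b < l)%N.
have Ay : A y by rewrite /A dst_self.
have nAy : ~~ A y' by rewrite /A -leqNgt; move: far; clear; lia.
have [a [b [ra Aa nAb rab]]] := reach_exit Ay nAy ryy.
have adjr c d : r c d -> adj c d.
  move: pp; rewrite path_steps => /allP hp; rewrite /r => /orP[/hp //|/hp]; by rewrite /= adj_sym.
have hb : (dst y b <= l)%N.
  by have := dst_tri y a b; rewrite (dst_adj (adjr _ _ rab)); move: Aa; rewrite /A; clear; lia.
have op c d : r c d -> (dst y c <= l)%N -> (dst y d <= l)%N -> opn w predT c d.
  move=> rcd hc hd; have ad := adjr _ _ rcd; rewrite /opn ad !andbT /=.
  apply: contraT => nw; exfalso; apply: nh; move: rcd => /orP[h|h].
    by exists (c, d).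
  by exists (d, c); split=> //; rewrite /= -edge_of_sym.
apply: (@reach_conn_at l w predT y b); last by move: nAb; rewrite /A -leqNgt.
apply: (@reach_trans _ _ _ a).
  by apply: reach_sub ra => c d /and3P[rcd Ac Ad]; apply: op => //; apply: ltnW.
by apply: reach1; apply: op => //; apply: ltnW.
Qed.

(** A centre not joined to distance [l] has a slow edge of the path within distance [l]; separation
    makes the choice of this edge injective. *)
Lemma count_good w x p X : (0 < l)%N -> path adj x p -> uniq X -> sep X ->
  {subset X <= x :: p} -> (1 < size X)%N ->
  (count (fun y => ~~ `[< open_at w y >]) X <= nhigh w x p)%N.
Proof.
move=> l0 pp uX spX Xp sX.
pose st := [seq s <- steps x p | ~~ w (edge_of s.1 s.2)].
have hX y : y \in X -> ~ open_at w y -> exists s,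
    [/\ s \in st, (dst y s.1 <= l)%N & (dst y s.2 <= l)%N].
  move=> yX ny.
  have [y' y'X yy'] : exists2 y', y' \in X & y != y'.
    case: X uX sX yX {spX Xp} => [//|a [//|b X]] /= /andP[+ _] _.
    rewrite !in_cons negb_or => /andP[ab _] yX.
    case: (y =P a) => [->|/eqP ya]; first by exists b; rewrite ?in_cons ?eqxx ?orbT.
    by exists a; rewrite ?in_cons ?eqxx.
  have [s [h1 h2 h3 h4]] := high_near l0 pp (Xp _ yX) (Xp _ y'X) (spX _ _ yX y'X yy') ny.
  by exists s; rewrite mem_filter h1 h2.
have /choice [h hh] : forall y, exists s, y \in X -> ~ open_at w y ->
    [/\ s \in st, (dst y s.1 <= l)%N & (dst y s.2 <= l)%N].
  move=> y; have [yX|yX] := boolP (y \in X); last by exists (origin, origin).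
  have [oy|oy] := pselect (open_at w y); first by exists (origin, origin).
  by have [s hs] := hX y yX oy; exists s.
rewrite -size_filter.
rewrite /nhigh -size_filter -/st -(size_map h); apply: uniq_leq_size.
  rewrite map_inj_in_uniq ?filter_uniq // => y z.
  rewrite !mem_filter => /andP[/asboolPn ny yX] /andP[/asboolPn nz zX] hyz.
  have [_ h1 _] := hh y yX ny; have [_ h2 _] := hh z zX nz.
  apply/eqP; apply: contraT => /(spX _ _ yX zX).
  rewrite -hyz in h2; have := dst_tri y (h y).1 z; rewrite (dst_sym (h y).1 z).
  by move: h1 h2; clear; lia.
move=> s /mapP [y]; rewrite mem_filter => /andP[/asboolPn ny yX] ->.
by have [] := hh y yX ny.
Qed.

Fixpoint walks k x : seq (seq vtx) :=
  if k is k'.+1 then flatten [seq map (cons y) (walks k' y) | y <- ball x l.*2.+1] else [:: [::]].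

Lemma walksS k x : walks k.+1 x = flatten [seq map (cons y) (walks k y) | y <- ball x l.*2.+1].
Proof. by []. Qed.

Lemma mem_walks x W : path jump x W -> W \in walks (size W) x.
Proof.
elim: W x => [//|y W IH] x; rewrite [path _ _ _]/= => /andP[xy pW].
rewrite (walksS (size W) x); apply/flatten_mapP; exists y; first by rewrite mem_ball.
by rewrite map_f ?IH.
Qed.

Lemma walks_path k x W : W \in walks k x -> path jump x W /\ size W = k.
Proof.
elim: k x W => [|k IH] x W; first by rewrite mem_seq1 => /eqP ->.
rewrite walksS => /flatten_mapP [y yb /mapP [W' /IH [pW <-] ->]] /=; split=> //.
by rewrite pW andbT /jump -mem_ball.
Qed.

Definition deg := (l.*2.+1.*2.+1 * l.*2.+1.*2.+1)%N.

Lemma size_walks k x : size (walks k x) = (deg ^ k)%N.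
Proof.
elim: k x => [//|k IH] x; rewrite walksS size_flatten /shape -map_comp.
rewrite (eq_map (g := fun=> (deg ^ k)%N)); last by move=> y; rewrite /= size_map IH.
have sumc (t : seq vtx) (c : nat) : sumn [seq c | _ <- t] = (size t * c)%N by elim: t => //= _ t ->.
by rewrite sumc size_ball expnS.
Qed.

Definition slow_path j x w := exists p,
  [/\ path adj x p, uniq (x :: p), (j * vol <= size p)%N & (2 * nhigh w x p <= j)%N].

Lemma walk_bound x W y : path jump x W -> y \in x :: W -> (nrm y <= nrm x + size W * l.*2.+1)%N.
Proof.
elim: W x => [|z W IH] x /=; first by move=> _; rewrite mem_seq1 => /eqP ->; rewrite leq_addr.
case/andP => xz pW; rewrite in_cons => /orP[/eqP ->|/(IH _ pW)]; first exact: leq_addr.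
by have := nrm_dst x z; move: xz; rewrite /jump mulSn; clear; lia.
Qed.

(** Exponential Markov inequality over skeletons, with [M = 4 * deg ^ 2]. On a slow path at least
    [j / 2] of the [j + 1] centres are joined to distance [l], so the product of the
    [1 + M ^ 2 * ind] is at least [M ^ j]. For a fixed skeleton independence bounds its mean by
    [2 ^ (j + 1)]. With [deg ^ (2 * j)] tours the total is [2 * (2 * deg ^ 2 / M) ^ j]. *)
Lemma slow_path_prob q j x N : 0 <= q <= 1 -> (0 < l)%N -> (0 < j)%N ->
  (nrm x + 2 * j * l.*2.+1 + l <= N)%N ->
  theta q l * (4 * deg * deg)%:R ^+ 2 <= 1 ->
  Ex (pb q) (EL N) (fun w => ind R (slow_path j x w)) allc <= 2 * 2^-1 ^+ j.
Proof.
move=> q01 l0 j0 hN hth; have hl := law_pb q01.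
set M : R := (4 * deg * deg)%:R in hth *.
have d0 : (0 < deg)%N by rewrite /deg.
have M1 : 1 <= M by rewrite /M ler1n; move: d0; clear; nia.
have M0 : 0 < M by apply: lt_le_trans M1.
pose H X w := \prod_(y <- X) (1 + M ^+ 2 * ind R (open_at w y)).
pose good W := uniq (undup (x :: W)) && (size (undup (x :: W)) == j.+1) && `[< sep (undup (x :: W)) >].
have H0 X w : 0 <= H X w.
  by apply: prodr_ge0 => y _; rewrite addr_ge0 // mulr_ge0 ?exprn_ge0 ?ind_ge0 // ltW.
have pw w : ind R (slow_path j x w) <=
    M^-1 ^+ j * \sum_(W <- walks (2 * j) x) (good W)%:R * H (undup (x :: W)) w.
  have S0 : 0 <= \sum_(W <- walks (2 * j) x) (good W)%:R * H (undup (x :: W)) w.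
    by apply: sumr_ge0 => W _; rewrite mulr_ge0 ?ler0n.
  have [[p [pp up hp hh]]|n] := pselect (slow_path j x w); last first.
    by rewrite ind0 // mulr_ge0 // exprn_ge0 // invr_ge0 ltW.
  have [W [X [pW sW [uX sX] XW [spX Xp]]]] := skeleton pp up hp.
  have WW : W \in walks (2 * j) x by rewrite -sW mem_walks.
  have XuW : perm_eq X (undup (x :: W)).
    by apply: uniq_perm => //; [exact: undup_uniq|move=> y; rewrite mem_undup XW].
  have gW : good W.
    rewrite /good undup_uniq -(perm_size XuW) sX eqxx /=; apply/asboolP => y z.
    by rewrite -!(perm_mem XuW); apply: spX.
  rewrite ind1; last by exists p.
  have bnd : M ^+ j <= H (undup (x :: W)) w.
    rewrite /H -(perm_big _ XuW) /=.
    have -> : \prod_(y <- X) (1 + M ^+ 2 * ind R (open_at w y)) =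
       (1 + M ^+ 2) ^+ count (fun y => `[< open_at w y >]) X.
      elim: (X) => [|y X' IH]; first by rewrite big_nil expr0.
      rewrite big_cons IH /ind /=; case: (`[< _ >]); rewrite ?mulr1 ?exprS ?mulr0 ?addr0 ?mul1r //.
    have cg := count_good w l0 pp uX spX Xp.
    have cnt := count_predC (fun y => `[< open_at w y >]) X; rewrite sX in cnt.
    have {cg} : (count (fun y => ~~ `[< open_at w y >]) X <= nhigh w x p)%N by apply: cg; rewrite sX.
    move=> cg; set k := count _ X in cnt *.
    have k2 : (j <= 2 * k)%N.
      by move: cg cnt hh; rewrite /predC /=; set u := count _ _; clear; lia.
    apply: (@le_trans _ _ (M ^+ (2 * k))); first by rewrite ler_weXn2l.
    rewrite exprM; apply: lerXn2r; rewrite ?nnegrE ?exprn_ge0 ?addr_ge0 ?exprn_ge0 ?ltW //.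
    by rewrite ltrDr.
  have := bigD1_seq W WW.
  move=> _; apply: (@le_trans _ _ (M^-1 ^+ j * M ^+ j)).
    by rewrite -exprMn mulVf ?expr1n ?gt_eqF.
  apply: ler_wpM2l; first by rewrite exprn_ge0 // invr_ge0 ltW.
  apply: le_trans bnd _; rewrite (big_rem W) //= gW mul1r lerDl.
  by apply: sumr_ge0 => W' _; rewrite mulr_ge0 ?ler0n.
apply: le_trans (Ex_le _ _ hl pw) _; rewrite ExZ Ex_sum.
have each W : W \in walks (2 * j) x ->
    Ex (pb q) (EL N) (fun w => (good W)%:R * H (undup (x :: W)) w) allc <= 2 ^+ j.+1.
  move=> /walks_path [pW sW]; rewrite ExZ.
  have [/andP[/andP[_ /eqP sX] /asboolP spX]|_] := boolP (good W); last first.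
    by rewrite mul0r exprn_ge0.
  rewrite mul1r; set X := undup (x :: W) in sX spX *.
  pose A y : pred edge := fun e => (dst y (src e) <= l)%N && (dst y (tgt e) <= l)%N.
  rewrite (@Ex_prod_indep _ _ _ (pb q) (EL N) allc _ X A (fun y w => 1 + M ^+ 2 * ind R (open_at w y))) //.
  - rewrite -sX; have : forall y, y \in X -> Ex (pb q) (EL N) (fun w => 1 + M ^+ 2 * ind R (open_at w y)) allc <= 2.
      move=> y; rewrite mem_undup => /(walk_bound pW) hy.
      rewrite ExD Ex_cst // ExZ theta_shift //; last first.
        by move: hy hN; rewrite sW; clear; lia.
      by rewrite mulrC; lra.
    move=> h2; rewrite big_seq -big_seq.
    apply: (@le_trans _ _ (\prod_(y <- X) (2 : R))).
      rewrite big_seq [leRHS]big_seq; apply: ler_prod => y yX; rewrite h2 // andbT.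
      by apply: Ex_ge0 => // w; rewrite addr_ge0 // mulr_ge0 ?exprn_ge0 ?ind_ge0 // ltW.
    have -> : \prod_(y <- X) (2 : R) = 2 ^+ size X; last by [].
    by elim: (X) => [|a X' IH]; rewrite ?big_nil // big_cons IH exprS.
  - exact: undup_uniq.
  - move=> y f g fg; congr (1 + _ * _); apply: eq_ind_iff.
    have hA e : inD (box l) e -> A y (act (shift y) e).
      move=> /andP[h1 h2]; rewrite /A /act.
      have ad : adj (shift y (src e)) (shift y (tgt e)) by rewrite adj_shift adj_edge.
      by case: (edge_ends ad) => -[-> ->]; rewrite !dst_shift; move: h1 h2; rewrite /box => -> ->.
    split; apply: conn0_agree => e /hA he /=; [exact: fg|by rewrite fg].
  move=> y z e yX zX /andP[h1 _] /andP[h2 _].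
  apply/eqP; apply: contraT => /(spX _ _ yX zX).
  have := dst_tri y (src e) z; rewrite (dst_sym (src e) z).
  by move: h1 h2; clear; lia.
apply: (@le_trans _ _ (M^-1 ^+ j * ((deg ^ (2 * j))%:R * 2 ^+ j.+1))).
  apply: ler_wpM2l; first by rewrite exprn_ge0 // invr_ge0 ltW.
  rewrite -(size_walks (2 * j) x) -sum1_size natr_sum mulr_suml big_seq [leRHS]big_seq.
  by apply: ler_sum => W hW; rewrite mul1r each.
have -> : M^-1 ^+ j * ((deg ^ (2 * j))%:R * 2 ^+ j.+1) = 2 * (M^-1 * ((deg ^ 2)%:R * 2)) ^+ j.
  by rewrite expnM natrX exprS !exprMn; ring.
rewrite ler_pM2l //; apply: lerXn2r; rewrite ?nnegrE.
- by rewrite !mulr_ge0 ?invr_ge0 ?ler0n // ltW.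
- by rewrite invr_ge0.
rewrite /M !natrM.
have dr : 0 < deg%:R :> R by rewrite ltr0n.
rewrite le_eqVlt; apply/orP; left; apply/eqP; field.
by rewrite gt_eqF.
Qed.

End SelfAvoiding.

(** * Concentration of passage times *)

Section ThetaSmall.
Variable R : realType.

Lemma bernoulli_ineq (d : R) m : 0 <= d -> m%:R * d <= (1 + d) ^+ m.
Proof.
move=> d0; suff : 1 + m%:R * d <= (1 + d) ^+ m by lra.
elim: m => [|m IH]; first by rewrite mul0r addr0 expr0.
rewrite exprS; apply: (@le_trans _ _ ((1 + d) * (1 + m%:R * d))); last by rewrite ler_pM2l //; lra.
have : 0 <= d * (m%:R * d) by rewrite !mulr_ge0 ?ler0n.
by rewrite -natr1; lra.
Qed.

(** The squared factor is a polynomial of degree 8 in [l]. With [l = 9 * m * r] the decay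
    [f ^ (9 * m)] is at most [(m * d) ^ -9] by Bernoulli's inequality, one power more than the
    polynomial. *)
Lemma theta_small (p : R) : 0 <= p -> p < 2^-1 ->
  exists2 l, (0 < l)%N & theta p l * (4 * deg l * deg l)%:R ^+ 2 <= 1.
Proof.
move=> p0 p2; have p01 : 0 <= p <= 1 by apply/andP; split; lra.
have [r [S [oS hS ph]]] := subcritical_phi p0 p2.
have r0 : (0 < r)%N by have := hS _ oS; case: (r).
pose f := Num.max (phi p r S) 2^-1.
have f0 : 0 < f by rewrite lt_max invr_gt0 ltr0n orbT.
have f1 : f < 1 by rewrite gt_max ph; lra.
have th k : theta p (k * r) <= f ^+ k.
  elim: k => [|k IH]; first by rewrite expr0 theta_le1.
  rewrite mulSn addnC exprS; apply: le_trans (theta_decay _ p01 oS hS) _.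
  apply: ler_pM => //.
  - rewrite /phi mulr_ge0 // sumr_ge0 // => e _; rewrite sumr_ge0 // => d _.
    by rewrite mulr_ge0 ?ler0n //; apply: Ex_ge0 (law_pb p01) _ => w; apply: ind_ge0.
  - exact: theta_ge0.
  - by rewrite le_max lexx.
pose d := f^-1 - 1; have d0 : 0 < d by rewrite subr_gt0 invf_gt1.
have fd k : f ^+ k * (1 + d) ^+ k = 1.
  by rewrite -exprMn /d addrC subrK mulfV ?expr1n // gt_eqF.
(* [deg l] is [(4 * l + 3) ^ 2], and [4 * l + 3 <= 39 * m * r]; cancelling [m ^ 8] leaves the
   condition [B <= m]. *)
pose B : R := 16 * (39 * r%:R) ^+ 8 / d ^+ 9.
have B0 : 0 <= B by rewrite /B !mulr_ge0 ?exprn_ge0 ?mulr_ge0 ?ler0n // invr_ge0 exprn_ge0 // ltW.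
have [m hm] : exists m : nat, B < m%:R by exists (Num.bound B); exact: archi_boundP.
have m0 : (0 < m)%N by rewrite -(ltr_nat R) (le_lt_trans B0).
have mr0 : 0 < m%:R :> R by rewrite ltr0n.
exists (9 * m * r)%N; first by rewrite !muln_gt0 m0 r0.
set D := (4 * _ * _)%:R.
have D2 : D ^+ 2 <= 16 * (39 * (m%:R * r%:R)) ^+ 8.
  have -> : 16 * (39 * (m%:R * r%:R)) ^+ 8 = (4 * ((39 * (m%:R * r%:R)) ^+ 2) * ((39 * (m%:R * r%:R)) ^+ 2)) ^+ 2 :> R by ring.
  apply: lerXn2r; rewrite ?nnegrE ?ler0n ?mulr_ge0 ?exprn_ge0 ?mulr_ge0 ?ler0n //.
  rewrite /D (natrM _ (4 * _)%N) (natrM _ 4%N).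
  have hd : (deg (9 * m * r))%:R <= (39 * (m%:R * r%:R)) ^+ 2 :> R.
    rewrite expr2 /deg natrM; apply: ler_pM; rewrite ?ler0n //;
    by rewrite -!natrM ler_nat; move: m0 r0; clear; nia.
  by apply: ler_pM; rewrite ?mulr_ge0 ?ler0n //; apply: ler_pM; rewrite ?ler0n.
apply: (@le_trans _ _ (f ^+ (9 * m) * (16 * (39 * (m%:R * r%:R)) ^+ 8))).
  by apply: ler_pM; rewrite ?theta_ge0 ?exprn_ge0 ?ler0n.
rewrite -[leRHS](fd (9 * m)%N); apply: ler_wpM2l; first by rewrite exprn_ge0 // ltW.
apply: (@le_trans _ _ ((m%:R * d) ^+ 9)); last first.
  rewrite mulnC exprM; apply: lerXn2r; rewrite ?nnegrE.
  - by apply: mulr_ge0; [exact: ler0n|exact: ltW].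
  - by apply: exprn_ge0; apply: addr_ge0; [exact: ler01|exact: ltW].
  - exact: bernoulli_ineq (ltW d0).
have hB : 16 * (39 * r%:R) ^+ 8 <= m%:R * d ^+ 9.
  by rewrite -ler_pdivrMr ?exprn_gt0 // ltW.
have m8 : 0 <= m%:R ^+ 8 :> R by rewrite exprn_ge0 // ltW.
have e1 : 16 * (39 * (m%:R * r%:R)) ^+ 8 = m%:R ^+ 8 * (16 * (39 * r%:R) ^+ 8) :> R.
  by rewrite !exprMn; move: (39 ^+ 8 : R) (m%:R ^+ 8 : R) (r%:R ^+ 8 : R) => x y z; ring.
have e2 : (m%:R * d) ^+ 9 = m%:R ^+ 8 * (m%:R * d ^+ 9) by rewrite exprMn mulrA -exprSr.
by rewrite e1 e2; exact: ler_wpM2l.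
Qed.

End ThetaSmall.

(** * The one-variable moment inequality *)

Section OneDim.
Variable R : realType.
Implicit Types (psi : R -> R) (l : seq (R * R)).

(* What remains of the minimum of products of edge weights when all weights
   but one are fixed. *)
Definition cls psi :=
  [/\ forall t, 1 <= t -> 1 <= psi t,
      forall t u, 1 <= t -> t <= u -> psi t <= psi u,
      forall c t, 1 <= c -> 1 <= t -> psi (c * t) <= c * psi t &
      forall u v w, 1 <= u -> u <= v -> v <= w ->
        (w - v) * psi u + (v - u) * psi w <= (w - u) * psi v].

Lemma expR_sub1_le (t : R) : 0 <= t -> expR t - 1 <= t * expR t.
Proof.
move=> t0; have h := expR_ge1Dx (- t); have e0 := expR_gt0 t.
have : (1 - t) * expR t <= 1.
  have e1 : expR (- t) * expR t = 1 by rewrite expRN mulVf // gt_eqF.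
  by rewrite -[leRHS]e1 ler_pM2r.
by lra.
Qed.

Lemma sqr_le_expR (z : R) : 0 <= z -> z ^+ 2 <= 4 * expR z.
Proof.
move=> z0; have h := expR_ge1Dx (z / 2).
have -> : expR z = expR (z / 2) ^+ 2 by rewrite -expRM_natl; congr expR; lra.
have : 0 <= z / 2 by lra.
by nra.
Qed.

Section Pointwise.
Variables (psi : R -> R) (vs vm u s : R).
Hypothesis cpsi : cls psi.
Hypotheses (vm1 : 1 <= vm) (vmvs : vm < vs).
Let P := psi vs.
Hypothesis us : 2 * (vs - 1) ^+ 2 <= u.
Hypothesis uvm : (1 + u) * vm <= vs.
Hypothesis sE : s * (vs - vm) = 1 - psi vm / P.

Let vs1 : 1 <= vs. Proof. exact: ltW (le_lt_trans vm1 vmvs). Qed.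
Let P1 : 1 <= P.
Proof. by case: cpsi => h _ _ _; apply: h; apply: ltW; apply: le_lt_trans vm1 vmvs. Qed.
Let P0 : 0 < P. Proof. exact: lt_le_trans ltr01 P1. Qed.
(** Normalised to take the value 1 at [vs]. The number [s] is the slope of the chord of [Psi] over
    [[vm, vs]]: by concavity it bounds the growth of [Psi] beyond [vs] from above and its deficit
    below [vm] from below. *)
Let Psi t := psi t / P.
Let Psi_mono t t' : 1 <= t -> t <= t' -> Psi t <= Psi t'.
Proof. by move=> h1 h2; rewrite /Psi ler_pM2r ?invr_gt0 //; case: cpsi => _ h _ _; apply: h. Qed.
Let Psi_vs : Psi vs = 1. Proof. by rewrite /Psi mulfV // gt_eqF. Qed.
Let Psi_pos t : 1 <= t -> 0 < Psi t.
Proof.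
move=> h; rewrite /Psi divr_gt0 //; case: cpsi => k _ _ _.
exact: lt_le_trans ltr01 (k _ h).
Qed.
Let Psi_conc x y z : 1 <= x -> x <= y -> y <= z ->
  (z - y) * Psi x + (y - x) * Psi z <= (z - x) * Psi y.
Proof.
move=> h1 h2 h3; rewrite /Psi !mulrA -mulrDl ler_pM2r ?invr_gt0 //.
by case: cpsi => _ _ _; apply.
Qed.
Let Psi_sub t : 1 <= t -> t <= vs -> t / vs <= Psi t.
Proof.
move: (vm1) (vmvs) => g1 g2.
move=> h1 h2; have t0 : 0 < t by lra.
have v0 : 0 < vs by lra.
have := (let: And4 _ _ h _ := cpsi in h) (vs / t) t.
rewrite ler_pdivlMr // mul1r divfK ?gt_eqF // => /(_ h2 h1) h.
rewrite /Psi ler_pdivrMr // mulrAC ler_pdivlMr //.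
by move: h; rewrite mulrAC ler_pdivlMr // mulrC (mulrC (psi t)).
Qed.

Lemma s_ge0 : 0 <= s.
Proof.
have h := Psi_mono vm1 (ltW vmvs); rewrite Psi_vs in h.
by rewrite -(pmulr_lge0 _ (_ : 0 < vs - vm)) ?subr_gt0 // sE subr_ge0.
Qed.

Lemma s_le1 : s <= 1.
Proof.
move: (vm1) (vmvs) => g1 g2.
have h := Psi_sub vm1 (ltW vmvs); rewrite /Psi in h.
have v0 : 0 < vs by lra.
have : s * (vs - vm) <= 1 * (vs - vm).
  rewrite sE mul1r.
  have : vs * (vm / vs) = vm by rewrite mulrC divfK // gt_eqF.
  move: h; set q := vm / vs; set r := psi vm / P => h1 h2.
  have : 0 <= (vs - 1) * (1 - q).
    by rewrite mulr_ge0 //; [lra|rewrite subr_ge0 ler_pdivrMr // mul1r ltW].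
  by nra.
by rewrite ler_pM2r // subr_gt0.
Qed.

(** [r] is the fraction of [[t, vs]] gained by multiplying [t] by [1 + u], and concavity returns at
    least this fraction of the deficit [y]. Subhomogeneity gives [y <= (vs - t) / vs], and the lower
    bound on [u] then gives [2 * y <= r]. *)
Lemma low_bound t : 1 <= t -> t < vs -> (1 + u) * t <= vs ->
  let y := 1 - Psi t in exists2 r : R, [/\ 2 * y <= r, r <= 1 & y * u * t = y * r * (vs - t)] &
    1 - y + y * r <= Psi ((1 + u) * t).
Proof.
move: (vm1) (vmvs) (us) => g1 g2 g3.
move=> t1 tvs kt y; have v0 : 0 < vs by lra.
have vt : 0 < vs - t by lra.
have u0 : 0 <= u by apply: le_trans us; rewrite mulr_ge0 ?sqr_ge0.
exists (u * t / (vs - t)).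
  split.
  - rewrite ler_pdivlMr //.
    have hy : y <= (vs - t) / vs.
      by have := Psi_sub t1 (ltW tvs); rewrite /y mulrBl mulfV ?gt_eqF //; lra.
    have h1 : 2 * y * (vs - t) <= 2 * ((vs - t) / vs) * (vs - t).
      by rewrite ler_pM2r // ler_pM2l.
    apply: le_trans h1 _.
    have -> : 2 * ((vs - t) / vs) * (vs - t) = 2 * (vs - t) ^+ 2 / vs by rewrite expr2; ring.
    rewrite ler_pdivrMr //.
    have h2 : (vs - t) ^+ 2 <= (vs - 1) ^+ 2 by rewrite !expr2; apply: ler_pM; lra.
    have h3 : 1 <= t * vs by rewrite -[1]mulr1; apply: ler_pM; lra.
    by nra.
  - by rewrite ler_pdivrMr // mul1r; lra.
  - by rewrite -!mulrA mulVf ?gt_eqF // mulr1.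
have := @Psi_conc t ((1 + u) * t) vs t1 _ kt.
rewrite Psi_vs mulr1 => h.
have {h} : (vs - (1 + u) * t) * Psi t + ((1 + u) * t - t) <= (vs - t) * Psi ((1 + u) * t).
  by apply: h; nra.
move=> h; rewrite -(ler_pM2l vt); apply: le_trans h.
set k := u * t / (vs - t); have hk : k * (vs - t) = u * t by rewrite divfK // gt_eqF.
have -> : (vs - t) * (1 - y + y * k) = (vs - t) * (1 - y) + y * (k * (vs - t)) by ring.
by rewrite hk le_eqVlt; apply/orP; left; apply/eqP; rewrite /y; ring.
Qed.

(** With [Psi t = 1 - y], inversion has a quadratic error [y ^ 2], which the gain
    [y * r >= 2 * y ^ 2] from the rescaling pays for. *)
Lemma inv_bound_mid t : 1 <= t -> t <= vs -> (Psi ((1 + u) * t))^-1 <= 2 - Psi t.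
Proof.
move: (vm1) (vmvs) (us) => g1 g2 g3.
move=> t1 tv.
have u0 : 0 <= u by apply: le_trans us; rewrite mulr_ge0 ?sqr_ge0.
have kt1 : 1 <= (1 + u) * t by nra.
have le1 : Psi t <= 1 by rewrite -Psi_vs; apply: Psi_mono.
have [kv|kv] := leP vs ((1 + u) * t).
  have : 1 <= Psi ((1 + u) * t) by rewrite -[leLHS]Psi_vs; apply: Psi_mono.
  move=> h; apply: (@le_trans _ _ 1); last by lra.
  by rewrite invf_le1 // (lt_le_trans ltr01).
have tvs : t < vs by nra.
have [r [h1 h2 _]] := low_bound t1 tvs (ltW kv).
set y := 1 - Psi t in h1 *; set Q := Psi _ => h3.
have Q0 : 0 < Q by apply: Psi_pos.
rewrite -[leLHS]mul1r ler_pdivrMr //.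
have y0 : 0 <= y by rewrite subr_ge0.
have -> : 2 - Psi t = 1 + y by rewrite /y; lra.
apply: (@le_trans _ _ ((1 + y) * (1 - y + y * r))); last by rewrite ler_pM2l //; lra.
by nra.
Qed.

(** Below [vm] the gain is at least [s * u], and the quadratic error consumes at most about half of
    it; the surplus [s * u / 4] is kept to pay for large weights. *)
Lemma inv_bound_low t : 1 <= t -> t <= vm -> s * u <= 1 ->
  (Psi ((1 + u) * t))^-1 <= 2 - Psi t - s * u / 4.
Proof.
move: (vm1) (vmvs) (us) => g1 g2 g3.
move=> t1 tv su1.
have u0 : 0 <= u by apply: le_trans us; rewrite mulr_ge0 ?sqr_ge0.
have kt1 : 1 <= (1 + u) * t by nra.
have tvs : t < vs by lra.
have kv : (1 + u) * t <= vs by apply: le_trans uvm; rewrite ler_wpM2l //; lra.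
have le1 : Psi t <= 1 by rewrite -Psi_vs; apply: Psi_mono => //; lra.
have [r [h1 h2 h4]] := low_bound t1 tvs kv.
set y := 1 - Psi t in h1 h4 *; set Q := Psi _ => h3.
have Q0 : 0 < Q by apply: Psi_pos.
have y0 : 0 <= y by rewrite subr_ge0.
have hs : s * (vs - t) <= y.
  have := Psi_conc t1 tv (ltW vmvs); rewrite Psi_vs mulr1 => h.
  have e : Psi vm = 1 - s * (vs - vm) by rewrite sE /Psi; lra.
  rewrite e in h.
  have vv : 0 < vs - vm by lra.
  rewrite -(ler_pM2r vv); rewrite /y; nra.
have s0 := s_ge0.
have g4 : s * u <= y * r.
  have vt : 0 < vs - t by lra.
  rewrite -(ler_pM2r vt) -h4.
  have : s * (vs - t) * u <= y * u by rewrite ler_wpM2r.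
  have : y * u <= y * u * t by rewrite ler_peMr // mulr_ge0.
  by nra.
rewrite -[leLHS]mul1r ler_pdivrMr //.
have -> : 2 - Psi t - s * u / 4 = 1 + y - s * u / 4 by rewrite /y; lra.
set g := s * u in su1 g4 *.
have g0 : 0 <= g by rewrite /g mulr_ge0.
apply: (@le_trans _ _ ((1 + y - g / 4) * (1 - y + y * r))); last first.
  by apply: ler_wpM2l => //; lra.
have h5 : y * r <= y by rewrite ler_piMr.
have h6 : y * (2 * y) <= y * r by rewrite ler_wpM2l.
have h7 : 0 <= y * (y * r) by rewrite !mulr_ge0 //; lra.
have h8 : 0 <= g * (y - y * r) by rewrite mulr_ge0 //; lra.
by nra.
Qed.

(** Above [vs] the rescaling is discarded and [1 / (1 + y) <= 1 - y + y ^ 2] is used; the error is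
    controlled by the slope [s], the same factor as in the surplus below [vm]. *)
Lemma inv_bound_high t : vs <= t -> (Psi ((1 + u) * t))^-1 <= 2 - Psi t + s * (t - 1) ^+ 2.
Proof.
move: (vm1) (vmvs) (us) => g1 g2 g3.
move=> tv; have u0 : 0 <= u by apply: le_trans us; rewrite mulr_ge0 ?sqr_ge0.
have t1 : 1 <= t by lra.
have kt : t <= (1 + u) * t by nra.
have h1 := Psi_mono t1 kt.
have h0 : 1 <= Psi t by rewrite -Psi_vs; apply: Psi_mono => //; lra.
have Q0 : 0 < Psi t by lra.
apply: (@le_trans _ _ (Psi t)^-1).
  by rewrite lef_pV2 // posrE (lt_le_trans Q0).
set y := Psi t - 1.
have y0 : 0 <= y by rewrite subr_ge0.
have hy : y <= s * (t - vs).
  have := Psi_conc vm1 (ltW vmvs) tv; rewrite Psi_vs mulr1 => h.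
  have e : Psi vm = 1 - s * (vs - vm) by rewrite sE /Psi; lra.
  rewrite e in h.
  have vv : 0 < vs - vm by lra.
  by rewrite -(ler_pM2r vv) /y; nra.
have s0 := s_ge0; have s1 := s_le1.
have hy2 : y ^+ 2 <= s * (t - 1) ^+ 2.
  apply: (@le_trans _ _ ((s * (t - 1)) ^+ 2)).
    rewrite !expr2; have : y <= s * (t - 1) by apply: le_trans hy _; rewrite ler_wpM2l //; lra.
    by move=> h; apply: ler_pM.
  by rewrite exprMn ler_wpM2r ?sqr_ge0 // expr2 ler_piMl.
rewrite -[leLHS]mul1r ler_pdivrMr //.
have -> : Psi t = 1 + y by rewrite /y; lra.
have : 0 <= y * y ^+ 2 by rewrite mulr_ge0 ?sqr_ge0.
have h9 : y ^+ 2 = y * y by rewrite expr2.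
have : (2 - (1 + y) + y ^+ 2) * (1 + y) <= (2 - (1 + y) + s * (t - 1) ^+ 2) * (1 + y).
  by apply: ler_wpM2r; lra.
by nra.
Qed.

End Pointwise.

Definition wmean l (g : R -> R) : R := \sum_(x <- l) x.1 * g x.2.

Lemma wmean_le l g h : all (fun x => 0 <= x.1) l ->
  (forall x, x \in l -> g x.2 <= h x.2) -> wmean l g <= wmean l h.
Proof.
move=> l0 gh; rewrite /wmean big_seq [leRHS]big_seq; apply: ler_sum => x xl.
by apply: ler_wpM2l; [exact: (allP l0)|exact: gh].
Qed.

Lemma wmeanD l g h : wmean l (fun x => g x + h x) = wmean l g + wmean l h.
Proof. by rewrite /wmean -big_split; apply: eq_bigr => x _; rewrite mulrDr. Qed.
Lemma wmeanZ l c g : wmean l (fun x => c * g x) = c * wmean l g.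
Proof. by rewrite /wmean big_distrr; apply: eq_bigr => x _; rewrite mulrCA. Qed.

(* Averaging the pointwise bounds gives E[1/Psi(kappa V)] <= 2 - E[Psi(V)],
   and m (2 - m) <= 1. *)
Lemma one_dim (al A : R) : 0 < al -> 0 < A -> exists C lam0 : R, [/\ 0 < C, 0 < lam0 &
  forall (lam : R) l psi, 0 < lam -> lam <= lam0 -> all (fun x => 0 <= x.1) l ->
    \sum_(x <- l) x.1 = 1 -> all (fun x => 0 <= x.2) l ->
    wmean l (fun x => expR (al * x)) <= A -> cls psi ->
    wmean l (fun x => psi (expR (lam * x))) *
    wmean l (fun x => (psi ((1 + C * lam ^+ 2) * expR (lam * x)))^-1) <= 1].
Proof.
move=> al0 A0.
(* Beyond [b] one has [expR (al * x) >= 2 * A], so by Markov at least half of the surplus earned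
   below [vm] survives averaging. *)
pose b := 2 * A / al; have b0 : 0 < b by rewrite /b divr_gt0 // mulr_gt0.
(* Makes [x ^ 2 * expR (2 * lam * x) <= c2 * expR (al * x)] when [lam <= al / 4]. *)
pose c2 := 16 / al ^+ 2; have c20 : 0 < c2 by rewrite /c2 divr_gt0 // exprn_gt0.
(* The first term yields [2 * (vs - 1) ^ 2 <= u]; the second makes the averaged error above [vs] at
   most [s * u / 8], the part of the surplus that remains. *)
pose C := 8 * (b + 1) ^+ 2 + 8 * c2 * A + 1.
have C0 : 0 < C.
  rewrite /C; have : 0 <= 8 * (b + 1) ^+ 2 by rewrite mulr_ge0 ?sqr_ge0.
  have : 0 <= 8 * c2 * A by apply: mulr_ge0; [apply: mulr_ge0 => //|]; apply: ltW.
  by lra.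
pose lam0 := Num.min (2 * (b + 1))^-1 (Num.min C^-1 (al / 4)).
have lam00 : 0 < lam0.
  by rewrite !lt_min !invr_gt0 C0 !mulr_gt0 ?invr_gt0 //; lra.
exists C, lam0; split=> // lam l psi lam1 lamle l0 lsum lx lmean cpsi.
move: lamle; rewrite !le_min => /and3P[la lb lc].
have {}la : lam * (b + 1) <= 2^-1.
  have : lam * (2 * (b + 1)) <= 1 by rewrite -ler_pdivlMr ?mul1r //; lra.
  by lra.
have {}lb : C * lam <= 1 by rewrite mulrC -ler_pdivlMr // mul1r.
set u := C * lam ^+ 2.
have u0 : 0 <= u by rewrite mulr_ge0 ?sqr_ge0 // ltW.
have ulam : u <= lam by rewrite /u expr2 mulrA ler_piMl // ltW.
pose vm := expR (lam * b); pose vs := expR (lam * (b + 1)).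
have lb0 : 0 < lam * b by apply: mulr_gt0.
have vm1 : 1 <= vm by have := expR_ge1Dx (lam * b); rewrite /vm; lra.
have vmvs : vm < vs by rewrite ltr_expR mulrDr mulr1; lra.
have vs1 : 1 < vs by lra.
have us : 2 * (vs - 1) ^+ 2 <= u.
  set t := lam * (b + 1) in la vs vmvs vs1 *.
  have t0 : 0 <= t by rewrite /t mulr_ge0 //; lra.
  have h1 : vs - 1 <= 2 * t by have := expR_sub1_le t0; rewrite -/vs; nra.
  have h2 : (vs - 1) ^+ 2 <= (2 * t) ^+ 2 by rewrite !expr2; apply: ler_pM; lra.
  apply: (@le_trans _ _ (2 * (2 * t) ^+ 2)); first by rewrite ler_pM2l.
  rewrite /u /t /C; have e : 2 * (2 * (lam * (b + 1))) ^+ 2 = 8 * (b + 1) ^+ 2 * lam ^+ 2 by ring.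
  rewrite e; apply: ler_wpM2r; first exact: sqr_ge0.
  have : 0 <= 8 * c2 * A by apply: mulr_ge0; [apply: mulr_ge0 => //|]; apply: ltW.
  by lra.
have uvm : (1 + u) * vm <= vs.
  rewrite /vs mulrDr mulr1 expRD -/vm mulrC; apply: ler_wpM2l; first by lra.
  by have := expR_ge1Dx lam; lra.
pose s := (1 - psi vm / psi vs) / (vs - vm).
have sE : s * (vs - vm) = 1 - psi vm / psi vs by rewrite /s divfK // subr_eq0 gt_eqF.
have s0 := s_ge0 cpsi vm1 vmvs sE; have s1 := s_le1 cpsi vm1 vmvs sE.
have P0 : 0 < psi vs by case: cpsi => h _ _ _; apply: lt_le_trans ltr01 (h _ (ltW vs1)).
have su1 : s * u <= 1.
  rewrite -[1]mulr1; apply: ler_pM => //; apply: le_trans ulam _.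
  have : lam * 1 <= lam * (b + 1) by rewrite ler_pM2l //; lra.
  by lra.
(* One bound for the three ranges of [x], whose mean is computable: the second correction cancels
   the surplus beyond [b], and the third covers the error above [vs]. *)
have pt x : 0 <= x -> (psi ((1 + u) * expR (lam * x)) / psi vs)^-1 <=
    2 - psi (expR (lam * x)) / psi vs + (- (s * u / 4) + s * u / 4 * (expR (al * x) / (2 * A)) + s * (c2 * lam ^+ 2 * expR (al * x))).
  move=> x0; have t1 : 1 <= expR (lam * x) by rewrite -expR0 ler_expR mulr_ge0 // ltW.
  have e0 := expR_gt0 (al * x).
  have su0 : 0 <= s * u / 4 by rewrite divr_ge0 // mulr_ge0.
  have k1 : 0 <= s * u / 4 * (expR (al * x) / (2 * A)).
    by rewrite mulr_ge0 // divr_ge0 ?ltW // mulr_gt0.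
  have k2 : 0 <= s * (c2 * lam ^+ 2 * expR (al * x)).
    apply: mulr_ge0 => //; apply: mulr_ge0; last exact: expR_ge0.
    by apply: mulr_ge0; [exact: ltW|exact: sqr_ge0].
  have [xb|xb] := leP x b.
    have h := inv_bound_low cpsi vm1 vmvs us uvm sE t1 _ su1.
    apply: le_trans (h _) _; first by rewrite ler_expR ler_pM2l.
    by lra.
  have k3 : s * u / 4 <= s * u / 4 * (expR (al * x) / (2 * A)).
    rewrite ler_peMr // ler_pdivlMr ?mulr_gt0 // mul1r.
    have := expR_ge1Dx (al * x).
    have : al * b <= al * x by rewrite ler_pM2l // ltW.
    by rewrite /b mulrCA divff ?gt_eqF // mulr1; lra.
  have [xv|xv] := leP (expR (lam * x)) vs.
    by have := inv_bound_mid cpsi vm1 vmvs us t1 xv; lra.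
  have := inv_bound_high cpsi vm1 vmvs us sE (ltW xv).
  have k4 : s * (expR (lam * x) - 1) ^+ 2 <= s * (c2 * lam ^+ 2 * expR (al * x)).
    rewrite ler_wpM2l //.
    have lx0 : 0 <= lam * x by rewrite mulr_ge0 // ltW.
    have h1 := expR_sub1_le lx0.
    have h2 : (expR (lam * x) - 1) ^+ 2 <= (lam * x * expR (lam * x)) ^+ 2.
      by rewrite !expr2; apply: ler_pM; lra.
    apply: le_trans h2 _.
    have h3 : x ^+ 2 <= c2 * expR (al / 2 * x).
      have z0 : 0 <= al / 2 * x by rewrite mulr_ge0 // divr_ge0 // ltW.
      have := sqr_le_expR z0; rewrite exprMn => h.
      have aa : 0 < (al / 2) ^+ 2 by rewrite exprn_gt0 // divr_gt0.
      rewrite -(ler_pM2l aa); apply: le_trans h _.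
      rewrite mulrA le_eqVlt; apply/orP; left; apply/eqP; congr (_ * _).
      by rewrite /c2; field; rewrite gt_eqF.
    have h4 : expR (lam * x) ^+ 2 <= expR (al / 2 * x).
      rewrite -expRM_natl ler_expR mulrA ler_wpM2r //; lra.
    have -> : (lam * x * expR (lam * x)) ^+ 2 = lam ^+ 2 * (x ^+ 2 * expR (lam * x) ^+ 2) by ring.
    have -> : c2 * lam ^+ 2 * expR (al * x) = lam ^+ 2 * (c2 * expR (al / 2 * x) * expR (al / 2 * x)).
      rewrite -[in LHS](_ : al / 2 * x + al / 2 * x = al * x); last by lra.
      by rewrite expRD; ring.
    apply: ler_wpM2l; first exact: sqr_ge0.
    by apply: ler_pM; rewrite ?sqr_ge0.
  by lra.
pose m := wmean l (fun x => psi (expR (lam * x)) / psi vs).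
have tot : wmean l (fun x => (psi ((1 + u) * expR (lam * x)) / psi vs)^-1) <= 2 - m.
  apply: le_trans (wmean_le l0 (h := fun x => 2 - psi (expR (lam * x)) / psi vs + (- (s * u / 4) + s * u / 4 * (expR (al * x) / (2 * A)) + s * (c2 * lam ^+ 2 * expR (al * x)))) _) _.
    by move=> x xl; apply: pt; apply: (allP lx).
  have -> : (fun x => 2 - psi (expR (lam * x)) / psi vs + (- (s * u / 4) + s * u / 4 * (expR (al * x) / (2 * A)) + s * (c2 * lam ^+ 2 * expR (al * x)))) =
    (fun x => ((2 - s * u / 4) * 1 + (-1) * (psi (expR (lam * x)) / psi vs)) + (s * u / 4 / (2 * A) + s * c2 * lam ^+ 2) * expR (al * x)).
    by apply/funext => x; ring.
  rewrite !(wmeanD, wmeanZ) -/m.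
  have -> : wmean l (fun=> 1) = 1 by rewrite /wmean; under eq_bigr do rewrite mulr1.
  have cf : 0 <= s * u / 4 / (2 * A) + s * c2 * lam ^+ 2.
    apply: addr_ge0; last by apply: mulr_ge0; [apply: mulr_ge0 => //; exact: ltW|exact: sqr_ge0].
    apply: divr_ge0; last by apply: mulr_ge0 => //; exact: ltW.
    by apply: divr_ge0 => //; apply: mulr_ge0.
  have h1 := ler_wpM2l cf lmean.
  have h2 : (s * u / 4 / (2 * A) + s * c2 * lam ^+ 2) * A = s * u / 8 + s * (c2 * A * lam ^+ 2).
    by field; rewrite gt_eqF.
  have h3 : 8 * (c2 * A * lam ^+ 2) <= u.
    rewrite /u /C; have := sqr_ge0 lam; have := sqr_ge0 (b + 1); nra.
  have h4 : s * (8 * (c2 * A * lam ^+ 2)) <= s * u by rewrite ler_wpM2l.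
  by rewrite h2 in h1; lra.
have inv x : (psi ((1 + u) * expR (lam * x)))^-1 = (psi vs)^-1 * (psi ((1 + u) * expR (lam * x)) / psi vs)^-1.
  by rewrite invfM invrK mulrCA mulVf ?mulr1 // gt_eqF.
have pp x : psi (expR (lam * x)) = psi vs * (psi (expR (lam * x)) / psi vs).
  by rewrite mulrCA mulfV ?mulr1 // gt_eqF.
rewrite (_ : (fun x => psi (expR (lam * x))) = fun x => psi vs * (psi (expR (lam * x)) / psi vs)); last by apply/funext => x.
rewrite (_ : (fun x => (psi _)^-1) = fun x => (psi vs)^-1 * (psi ((1 + u) * expR (lam * x)) / psi vs)^-1); last by apply/funext => x.
rewrite !wmeanZ mulrACA mulfV ?gt_eqF // mul1r -/m.
have m0 : 0 <= m.
  rewrite /m /wmean big_seq; apply: sumr_ge0 => x xl; rewrite mulr_ge0 ?(allP l0) //.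
  rewrite divr_ge0 ?(ltW P0) //; case: cpsi => h _ _ _; apply: le_trans ler01 (h _ _).
  by rewrite -expR0 ler_expR mulr_ge0 ?(ltW lam1) ?(allP lx).
apply: (@le_trans _ _ (m * (2 - m))); first exact: ler_wpM2l.
by have := sqr_ge0 (m - 1); rewrite sqrrB1 expr2; lra.
Qed.

End OneDim.

(** * From one weight to many: two-sided exponential tails *)

Section Concentration.
Variables (R : realType) (I : eqType).
Implicit Types (l : seq (R * R)) (s : seq I) (f g : I -> R) (Phi : (I -> R) -> R).

Lemma cls_min (psi psi' : R -> R) : cls psi -> cls psi' -> cls (fun t => Num.min (psi t) (psi' t)).
Proof.
move=> [a1 a2 a3 a4] [b1 b2 b3 b4]; split.
- by move=> t t1; rewrite le_min a1 ?b1.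
- by move=> t u t1 tu; rewrite le_min !ge_min a2 ?b2 ?orbT.
- move=> c t c1 t1; have c0 : 0 <= c by lra.
  by rewrite minr_pMr // le_min !ge_min a3 ?b3 ?orbT.
- move=> u v w u1 uv vw; have wu : 0 <= w - u by lra.
  rewrite [leRHS]minr_pMr // le_min; apply/andP; split.
    apply: le_trans (a4 _ _ _ u1 uv vw); apply: lerD; apply: ler_wpM2l; rewrite ?ge_min ?lexx //; lra.
  apply: le_trans (b4 _ _ _ u1 uv vw); apply: lerD; apply: ler_wpM2l; rewrite ?ge_min ?lexx ?orbT //; lra.
Qed.

Lemma cls_cst (c : R) : 1 <= c -> cls (fun=> c).
Proof.
move=> c1; split=> //; first by move=> k t k1 _; rewrite ler_peMl //; lra.
by move=> u v w _ _ _; rewrite le_eqVlt; apply/orP; left; apply/eqP; ring.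
Qed.

Lemma cls_lin (c : R) : 1 <= c -> cls (fun t => c * t).
Proof.
move=> c1; split.
- by move=> t t1; rewrite -[leLHS]mulr1; apply: ler_pM.
- by move=> t u _ tu; apply: ler_wpM2l => //; lra.
- by move=> k t _ _; rewrite mulrCA.
- by move=> u v w _ _ _; rewrite le_eqVlt; apply/orP; left; apply/eqP; ring.
Qed.

Lemma cls_wmean l (W : Type) (Psi : R -> R -> R) : law l -> (forall x, x \in l -> cls (Psi x.2)) ->
  cls (fun t => \sum_(x <- l) x.1 * Psi x.2 t).
Proof.
move=> [l0 l1] h; have p x : x \in l -> 0 <= x.1 by move=> xl; apply: (allP l0).
split.
- move=> t t1; rewrite -l1 big_seq [leRHS]big_seq; apply: ler_sum => x xl.
  by rewrite ler_peMr ?p //; case: (h _ xl) => a _ _ _; apply: a.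
- move=> t u t1 tu; rewrite big_seq [leRHS]big_seq; apply: ler_sum => x xl.
  by apply: ler_wpM2l; rewrite ?p //; case: (h _ xl) => _ a _ _; apply: a.
- move=> c t c1 t1; rewrite big_distrr big_seq [leRHS]big_seq; apply: ler_sum => x xl.
  by rewrite [leRHS]mulrCA; apply: ler_wpM2l; rewrite ?p //; case: (h _ xl) => _ _ a _; apply: a.
- move=> u v w u1 uv vw; rewrite !big_distrr -big_split big_seq [leRHS]big_seq; apply: ler_sum => x xl.
  rewrite [leRHS]mulrCA; case: (h _ xl) => _ _ _ a; have := ler_wpM2l (p _ xl) (a _ _ _ u1 uv vw).
  by rewrite /=; lra.
Qed.

Definition sepc Phi := forall g, (forall x, 1 <= g x) ->
  1 <= Phi g /\ forall e, cls (fun t => Phi (upd g e t)).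

Lemma upd_ge1 g e (v : R) : (forall x, 1 <= g x) -> 1 <= v -> forall x, 1 <= upd g e v x.
Proof. by move=> g1 v1 x; rewrite /upd; case: eqP. Qed.

Lemma cls_Ex l s (Psi : R -> (I -> R) -> R) g : law l -> all (fun x => 1 <= x.2) l ->
  (forall f, (forall x, 1 <= f x) -> cls (fun t => Psi t f)) -> (forall x, 1 <= g x) ->
  cls (fun t => Ex l s (Psi t) g).
Proof.
move=> hl l1 h; elim: s g => [|e s IH] g g1; first exact: h.
apply: (@cls_wmean l R (fun v t => Ex l s (Psi t) (upd g e v))) => // x xl.
by apply: IH; apply: upd_ge1 => //; apply: (allP l1).
Qed.

Definition lawmap l (h : R -> R) : seq (R * R) := [seq (x.1, h x.2) | x <- l].

Lemma law_map l h : law l -> law (lawmap l h).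
Proof. by move=> [l0 l1]; split; [rewrite /lawmap all_map|rewrite /lawmap big_map]. Qed.

(* [one_dim] applies to the average of [Phi] over all coordinates but one. *)
Lemma Ex_inv_product (al A : R) : 0 < al -> 0 < A -> exists C lam0 : R, [/\ 0 < C, 0 < lam0 &
  forall (lam : R) l, 0 < lam -> lam <= lam0 -> law l -> all (fun x => 0 <= x.2) l ->
    wmean l (fun x => expR (al * x)) <= A ->
  forall Phi s g, sepc Phi -> uniq s -> (forall x, 1 <= g x) ->
    Ex (lawmap l (fun x => expR (lam * x))) s Phi g *
    Ex (lawmap l (fun x => (1 + C * lam ^+ 2) * expR (lam * x))) s (fun f => (Phi f)^-1) g <= 1].
Proof.
move=> al0 A0; have [C [lam0 [C0 lam00 H]]] := one_dim al0 A0.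
exists C, lam0; split=> // lam l lam1 laml hl lx lA Phi s g sP.
pose kap := 1 + C * lam ^+ 2; rewrite -/kap.
have kap1 : 1 <= kap by rewrite /kap; have := mulr_ge0 (ltW C0) (sqr_ge0 lam); lra.
have E1 x : x \in l -> 1 <= expR (lam * x.2).
  by move=> xl; rewrite -expR0 ler_expR mulr_ge0 ?(ltW lam1) //; apply: (allP lx).
have kE1 x : x \in l -> 1 <= kap * expR (lam * x.2).
  by move=> xl; have := E1 _ xl; nra.
elim: s g => [|e s IH] g us g1.
  have [h _] := sP _ g1.
  by rewrite /= mulfV // gt_eqF // (lt_le_trans ltr01).
have [es {}us] := andP us.
pose psi t := Ex (lawmap l (fun x => expR (lam * x))) s Phi (upd g e t).
have cpsi : cls psi.
  rewrite /psi (_ : (fun t => _) = fun t => Ex (lawmap l (fun x => expR (lam * x))) s (fun f => Phi (upd f e t)) g); last first.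
    by apply/funext => t; rewrite Ex_upd.
  apply: cls_Ex => //; first exact: law_map.
    by rewrite /lawmap all_map; apply/allP => x xl /=; apply: E1.
  by move=> f f1; case: (sP _ f1).
have h1 := H lam l psi lam1 laml (proj1 hl) (proj2 hl) lx lA cpsi.
have -> : Ex (lawmap l (fun x => expR (lam * x))) (e :: s) Phi g = wmean l (fun x => psi (expR (lam * x))).
  by rewrite [LHS]/= {1}/lawmap big_map.
have -> : Ex (lawmap l (fun x => kap * expR (lam * x))) (e :: s) (fun f => (Phi f)^-1) g =
    wmean l (fun x => Ex (lawmap l (fun x => kap * expR (lam * x))) s (fun f => (Phi f)^-1) (upd g e (kap * expR (lam * x)))).
  by rewrite [LHS]/= {1}/lawmap big_map.
(* With [e] frozen at [kap * v], the induction hypothesis bounds the average of [1 / Phi] over the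
   other coordinates by [1 / psi (kap * v)]; what is left is the one-variable inequality for
   [psi]. *)
apply: le_trans h1; apply: ler_wpM2l.
  rewrite /wmean big_seq; apply: sumr_ge0 => x xl; apply: mulr_ge0; first exact: (allP (proj1 hl)).
  by case: cpsi => a _ _ _; apply: le_trans ler01 (a _ (E1 _ xl)).
rewrite /wmean big_seq [leRHS]big_seq; apply: ler_sum => x xl.
apply: ler_wpM2l; first exact: (allP (proj1 hl)).
have p0 : 0 < psi (kap * expR (lam * x.2)).
  by case: cpsi => a _ _ _; apply: lt_le_trans ltr01 (a _ (kE1 _ xl)).
rewrite -(ler_pM2l p0) mulfV ?gt_eqF //; apply: IH => //.
by apply: upd_ge1 => //; apply: kE1.
Qed.

Definition summin (c0 : seq I) (Gam : seq (seq I)) f : R :=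
  \big[Num.min / \sum_(e <- c0) f e]_(c <- Gam) \sum_(e <- c) f e.
Definition prodmin (c0 : seq I) (Gam : seq (seq I)) f : R :=
  \big[Num.min / \prod_(e <- c0) f e]_(c <- Gam) \prod_(e <- c) f e.

(** A list without repetition uses each weight at most once, so the product is linear or constant in
    it. A repeated edge would give a square, which is not subhomogeneous. *)
Lemma sepc_prod (c : seq I) : uniq c -> sepc (fun f => \prod_(e <- c) f e).
Proof.
move=> uc g g1; have p1 (b : seq I) : 1 <= \prod_(e <- b) g e.
  elim: b => [|e b IH]; first by rewrite big_nil.
  by rewrite big_cons -[leLHS]mulr1; apply: ler_pM.
split=> // e; have [ec|ec] := boolP (e \in c).
  rewrite (_ : (fun t => _) = fun t => (\prod_(x <- rem e c) g x) * t); first exact: cls_lin.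
  apply/funext => t; rewrite (perm_big _ (perm_to_rem ec)) big_cons mulrC /upd eqxx.
  congr (_ * _); rewrite big_seq [RHS]big_seq; apply: eq_bigr => x.
  by rewrite mem_rem_uniq // => /andP[/= /negPf -> _].
rewrite (_ : (fun t => _) = fun t => \prod_(x <- c) g x); first exact: cls_cst.
apply/funext => t; rewrite big_seq [RHS]big_seq; apply: eq_bigr => x xc.
by rewrite /upd; case: eqP => // xe; rewrite xe (negPf ec) in xc.
Qed.

Lemma sepc_prodmin c0 Gam : uniq c0 -> all uniq Gam -> sepc (prodmin c0 Gam).
Proof.
move=> u0; rewrite /prodmin; elim: Gam => [_|c Gam IH /andP[uc /IH uG]].
  by rewrite (_ : (fun f => _) = fun f => \prod_(e <- c0) f e);
    [exact: sepc_prod|apply/funext => f; rewrite big_nil].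
move=> g g1; have [a b] := sepc_prod uc g1; have [a' b'] := uG _ g1.
split; first by rewrite big_cons le_min a.
by move=> e; under eq_fun do rewrite big_cons; apply: cls_min.
Qed.

Lemma expR_summin (lam : R) c0 Gam f : 0 <= lam ->
  expR (lam * summin c0 Gam f) = prodmin c0 Gam (fun e => expR (lam * f e)).
Proof.
move=> l0; have h (c : seq I) : expR (lam * \sum_(e <- c) f e) = \prod_(e <- c) expR (lam * f e).
  elim: c => [|e c IH]; first by rewrite !big_nil mulr0 expR0.
  by rewrite !big_cons mulrDr expRD IH.
rewrite /summin /prodmin; elim: Gam => [|c Gam IH]; first by rewrite !big_nil h.
rewrite !big_cons -IH -h; case: leP => ab; last first.
  by rewrite min_r // ler_expR ler_wpM2l // ltW.
by rewrite min_l // ler_expR ler_wpM2l.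
Qed.

(** This is where the bound [L] on the length of paths enters: removing the rescaling of all weights
    costs at most [kap ^ L]. *)
Lemma prodmin_scale (kap : R) L c0 Gam f : 1 <= kap -> (forall e, 0 <= f e) ->
  (size c0 <= L)%N -> all (fun c => size c <= L)%N Gam ->
  prodmin c0 Gam (fun e => kap * f e) <= kap ^+ L * prodmin c0 Gam f.
Proof.
move=> k1 f1 s0 sG; have h (c : seq I) : (size c <= L)%N ->
    \prod_(e <- c) (kap * f e) <= kap ^+ L * \prod_(e <- c) f e.
  move=> sc; rewrite big_split /= big_const_seq count_predT iter_mulr_1.
  apply: ler_wpM2r; last by rewrite ler_weXn2l.
  by apply: prodr_ge0 => e _; apply: f1.
rewrite /prodmin; elim: Gam sG => [_|c Gam IH /andP[sc /IH sG]]; first by rewrite !big_nil h.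
rewrite !big_cons minr_pMr ?exprn_ge0 ?(le_trans ler01) // le_min !ge_min h //=.
by rewrite sG orbT.
Qed.

Lemma dep_prodmin c0 Gam s f g : all (fun c => all [in s] c) (c0 :: Gam) ->
  (forall e, e \in s -> f e = g e) -> prodmin c0 Gam f = prodmin c0 Gam g.
Proof.
move=> + fg; have h (c : seq I) : all [in s] c -> \prod_(e <- c) f e = \prod_(e <- c) g e.
  move=> /allP cs; rewrite big_seq [RHS]big_seq; apply: eq_bigr => e ec.
  by apply: fg; apply: cs.
rewrite /prodmin; elim: Gam => [/andP[c0s _]|c Gam IH /and3P[c0s cs Gs]].
  by rewrite !big_nil h.
by rewrite !big_cons h // IH //=; apply/andP; split.
Qed.

Lemma Ex_gt0 l s (F : (I -> R) -> R) f : law l -> (forall f, 0 < F f) -> 0 < Ex l s F f.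
Proof.
move=> [l0 l1] F0; elim: s f => [|e s IH] f //=.
have: 0 < \sum_(x <- l) x.1 by rewrite l1.
set a := fun v => Ex l s F (upd f e v); have : forall v, 0 < a v by move=> v; exact: IH.
rewrite -[\sum_(x <- l) x.1 * _]/(\sum_(x <- l) x.1 * a x.2).
move: a => a a0.
elim: l l0 {l1 IH} => [|x l IHl].
  by rewrite big_nil ltxx.
case/andP=> x0 l0; rewrite !big_cons; have s0 : 0 <= \sum_(y <- l) y.1 * a y.2.
  rewrite big_seq; apply: sumr_ge0 => y yl; apply: mulr_ge0; [exact: (allP l0)|exact: ltW].
have [xz|xz] := eqVneq x.1 0.
  by rewrite xz mul0r !add0r; apply: IHl.
by move=> _; apply: ltr_wpDr => //; apply: mulr_gt0 => //; rewrite lt_def xz.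
Qed.

(** With [F = expR (lam * T)], the product inequality gives [E F * E (1 / F) <= kap ^ L <= expR (C *
    lam ^ 2 * L)]. Markov for [F] gives the upper tail about [m = ln (E F) / lam]; Markov for
    [1 / F] gives the lower tail about the same centre. *)
Lemma concentration (al A : R) : 0 < al -> 0 < A -> exists C lam0 : R, [/\ 0 < C, 0 < lam0 &
  forall (lam : R) l, 0 < lam -> lam <= lam0 -> law l -> all (fun x => 0 <= x.2) l ->
    wmean l (fun x => expR (al * x)) <= A ->
  forall c0 Gam s f (L : nat) (dl : R), uniq s -> all uniq (c0 :: Gam) ->
    all (fun c => size c <= L)%N (c0 :: Gam) -> (forall e, 0 <= f e) ->
    all (fun c => all [in s] c) (c0 :: Gam) ->
    forall m, m = ln (Ex l s (fun f => expR (lam * summin c0 Gam f)) f) / lam ->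
    Ex l s (fun f => ind R (dl <= `|summin c0 Gam f - m|)) f <=
      2 * expR (C * lam ^+ 2 * L%:R - lam * dl)].
Proof.
move=> al0 A0; have [C [lam0 [C0 lam00 H]]] := Ex_inv_product al0 A0.
exists C, lam0; split=> // lam l lam1 laml hl lx lA c0 Gam s f L dl us uG sG f0 cs m mE.
have {}H := H lam l lam1 laml hl lx lA.
pose T := summin c0 Gam; pose F f := expR (lam * T f).
pose kap := 1 + C * lam ^+ 2.
have kap1 : 1 <= kap by rewrite /kap; have := mulr_ge0 (ltW C0) (sqr_ge0 lam); lra.
have F0 g : 0 < F g by exact: expR_gt0.
have E0 : 0 < Ex l s F f by apply: Ex_gt0.
pose Phi := prodmin c0 Gam; pose ex := fun x : R => expR (lam * x).
have FE g : F g = Phi (ex \o g) by rewrite /F /T (expR_summin _ _ _ (ltW lam1)).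
have [u0 uG'] := andP uG; have [s0 sG'] := andP sG.
have sP : sepc Phi by apply: sepc_prodmin.
have h1 : Ex l s F f * Ex l s (fun f => (F f)^-1) f <= kap ^+ L.
  have g1 x : 1 <= (ex \o f) x by rewrite /ex /= -expR0 ler_expR mulr_ge0 // ltW.
  have := H Phi s (ex \o f) sP us g1; rewrite -/kap => h.
  have e1 : Ex (lawmap l ex) s Phi (ex \o f) = Ex l s F f.
    by rewrite /lawmap Ex_map_law; apply: eq_Ex => g; rewrite FE.
  have e2 : Ex (lawmap l (fun x => kap * ex x)) s (fun f => (Phi f)^-1) (ex \o f) =
      Ex l s (fun f => (Phi ((fun x => kap * ex x) \o f))^-1) f.
    rewrite -(Ex_map_law l s (fun x => kap * ex x) (fun f => (Phi f)^-1)) -/(lawmap _ _).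
    apply: (@Ex_agree _ _ _ _ s [in s]); last by move=> e es; rewrite es.
    move=> g g' gg; congr (_^-1); apply: dep_prodmin cs _.
    by move=> e es; apply: gg.
  rewrite -/ex e1 e2 in h.
  have k0 : 0 < kap ^+ L by apply: exprn_gt0; lra.
  rewrite -[leRHS]mulr1; apply: le_trans (ler_wpM2l (ltW k0) h).
  rewrite mulrCA; apply: ler_wpM2l; first exact: ltW.
  rewrite -ExZ; apply: Ex_le => // g.
  have P1 : 0 < Phi (ex \o g) by rewrite -FE.
  have P2 : 0 < Phi ((fun x => kap * ex x) \o g).
    have k1 : 0 < kap by lra.
    have -> : (fun x => kap * ex x) \o g = ex \o (fun e => g e + ln kap / lam).
      apply/funext => e; rewrite /ex /= mulrDr expRD [lam * (_ / _)]mulrC divfK ?gt_eqF //.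
      by rewrite lnK ?posrE // mulrC.
    by rewrite -FE.
  rewrite FE ler_pdivlMr // ler_pdivrMl //.
  rewrite mulrC; apply: (@prodmin_scale kap L c0 Gam (ex \o g)) => // e.
  by rewrite /ex /= expR_ge0.
have Em : expR (lam * m) = Ex l s F f.
  by rewrite mE mulrC divfK ?gt_eqF // lnK.
have b1 : Ex l s (fun f => ind R (dl <= `|summin c0 Gam f - m|)) f <=
    Ex l s (fun f => expR (- lam * (m + dl)) * F f + expR (lam * (m - dl)) * (F f)^-1) f.
  apply: Ex_le => // g; have p1 : 0 <= expR (- lam * (m + dl)) * F g.
    by apply: mulr_ge0; [exact: expR_ge0|exact: ltW].
  have p2 : 0 <= expR (lam * (m - dl)) * (F g)^-1.
    by apply: mulr_ge0; [exact: expR_ge0|rewrite invr_ge0; exact: ltW].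
  have [hd|hd] := pselect (dl <= `|summin c0 Gam g - m|); last by rewrite ind0 // addr_ge0.
  rewrite ind1 //; have [hs|hs] := leP 0 (summin c0 Gam g - m).
    rewrite ger0_norm // in hd.
    apply: le_trans (_ : expR (- lam * (m + dl)) * F g <= _); last by rewrite lerDl.
    rewrite /F -expRD -expR0 ler_expR /T.
    by have : 0 <= lam * (summin c0 Gam g - m - dl); [rewrite mulr_ge0 ?(ltW lam1) //; lra|lra].
  rewrite ltr0_norm // in hd.
  apply: le_trans (_ : expR (lam * (m - dl)) * (F g)^-1 <= _); last by rewrite lerDr.
  rewrite /F -expRN -expRD -expR0 ler_expR /T.
  by have : 0 <= lam * (m - summin c0 Gam g - dl); [rewrite mulr_ge0 ?(ltW lam1) //; lra|lra].
apply: le_trans b1 _; rewrite ExD !ExZ -[X in expR (- lam * (m + dl)) * X]Em.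
have -> : expR (lam * (m - dl)) = Ex l s F f * expR (- (lam * dl)) by rewrite -Em -expRD; congr expR; ring.
rewrite mulrAC -expRD (_ : - lam * (m + dl) + lam * m = - (lam * dl)); last by ring.
have kE : kap ^+ L <= expR (C * lam ^+ 2 * L%:R).
  rewrite mulrC expRM_natl; apply: lerXn2r; rewrite ?nnegrE ?expR_ge0 //; first by lra.
  exact: expR_ge1Dx.
have k1 : 1 <= kap ^+ L by rewrite exprn_ege1.
rewrite expRD; have ep := expR_gt0 (- (lam * dl)).
have h2 := ler_wpM2r (ltW ep) (le_trans h1 kE).
have h3 := ler_wpM2r (ltW ep) (le_trans k1 kE).
by lra.
Qed.

End Concentration.

(** * Passage times and the diameter of a hole *)

Section PassageTime.
Variable R : realType.
Implicit Types (w : edge -> R) (x y z : vtx) (p q : seq vtx).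

Lemma lattice_connected x y : exists p, nn_path x y p.
Proof.
have [m] : exists m : nat, (m = `|x.1 - y.1|%N + `|x.2 - y.2|%N)%N by eexists.
move: y => [y1 y2]; elim: m x => [|m IH] [x1 x2] /= h.
  by exists [::]; split=> //=; congr (_, _); lia.
have [z [az hz]] : exists z, adj (x1, x2) z /\ (m = `|z.1 - y1|%N + `|z.2 - y2|%N)%N.
  have [h1|h1] := leP x1 y1; last by exists (x1 - 1, x2); rewrite /adj /=; lia.
  have [h2|h2] := ltP x1 y1; first by exists (x1 + 1, x2); rewrite /adj /=; lia.
  have [h3|h3] := leP x2 y2; first by exists (x1, x2 + 1); rewrite /adj /=; lia.
  by exists (x1, x2 - 1); rewrite /adj /=; lia.
have [p [pp lp]] := IH z hz; exists (z :: p); split=> //=; by rewrite az.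
Qed.

Lemma path_time_cons w x y p : path_time w x (y :: p) = w (edge_of x y) + path_time w y p.
Proof. by rewrite /path_time /= big_cons. Qed.

Lemma path_time_nil w x : path_time w x [::] = 0.
Proof. by rewrite /path_time /= big_nil. Qed.

Lemma path_time_cat w x p q : path_time w x (p ++ q) = path_time w x p + path_time w (last x p) q.
Proof.
elim: p x => [|y p IH] x; first by rewrite path_time_nil add0r.
by rewrite cat_cons !path_time_cons IH addrA.
Qed.

Lemma path_time_ge0 w x p : (forall e, 0 <= w e) -> 0 <= path_time w x p.
Proof. by move=> w0; apply: sumr_ge0 => ab _. Qed.

Lemma passage_le w x y p : (forall e, 0 <= w e) -> path adj x p -> last x p = y ->
  passage_time w x y <= path_time w x p.
Proof.
move=> w0 pp lp; apply: ge_inf; last by exists p.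
by exists 0 => _ [q _ <-]; apply: path_time_ge0.
Qed.

Lemma path_uniq w x p : (forall e, 0 <= w e) -> path adj x p ->
  exists q, [/\ path adj x q, last x q = last x p, uniq (x :: q) & path_time w x q <= path_time w x p].
Proof.
move=> w0; elim: p x => [|y p IH] x; first by exists [::].
case/andP=> axy /IH [q [pq lq uq tq]].
have [xq|xq] := boolP (x \in y :: q); last first.
  exists (y :: q); split; [by rewrite /= axy|by []|by rewrite cons_uniq xq|].
  by rewrite !path_time_cons lerD2l.
have [xy|xy] := eqVneq x y.
  exists q; rewrite xy; split=> //; rewrite -xy path_time_cons xy.
  by apply: le_trans tq _; rewrite lerDr.
move: xq; rewrite in_cons (negPf xy) /= => xq.
case/splitPr: xq pq lq uq tq => q1 q2; rewrite cat_path => /and3P[_ _ p2] lq uq tq.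
exists q2; split=> //; first by move: lq; rewrite last_cat.
  by move: uq; rewrite -cat_cons cat_uniq => /and3P[].
rewrite path_time_cons; apply: le_trans (_ : path_time w y (q1 ++ x :: q2) <= _).
  rewrite path_time_cat path_time_cons addrA lerDr addr_ge0 ?path_time_ge0 //.
by apply: le_trans tq _; rewrite lerDr.
Qed.

Lemma passage_near w x y (r : R) : (forall e, 0 <= w e) -> passage_time w x y < r ->
  exists p, [/\ path adj x p, last x p = y, uniq (x :: p) & path_time w x p < r].
Proof.
move=> w0 /inf_lt [|_ [p [pp lp] <-] tp].
  by have [p h] := lattice_connected x y; exists (path_time w x p); exists p.
have [q [pq lq uq tq]] := path_uniq w0 pp.
by exists q; split=> //; [rewrite lq|exact: le_lt_trans tq tp].
Qed.

Lemma path_nrm x p y : path adj x p -> y \in x :: p -> (nrm y <= nrm x + size p)%N.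
Proof.
elim: p x => [|z p IH] x; first by rewrite mem_seq1 => _ /eqP->; rewrite addn0.
case/andP=> axz pp; rewrite in_cons => /orP[/eqP->|/(IH _ pp)]; first by rewrite leq_addr.
by have := nrm_adj axz; move: (nrm x) (nrm y) (nrm z) => a b d /=; lia.
Qed.

Lemma path_rows x p : path adj x p -> (`|(last x p).2 - x.2|%N <= size p)%N.
Proof.
elim: p x => [|z p IH] x; first by move=> _; rewrite /= subrr.
case/andP=> axz /IH; rewrite /=; move: axz; rewrite /adj; lia.
Qed.

Definition eqd (a b a' b' : vtx) :=
  `|b.1 - a.1|%N = `|b'.1 - a'.1|%N /\ `|b.2 - a.2|%N = `|b'.2 - a'.2|%N.

Definition linear_growth w (L K0 : nat) (c : R) := forall x p, (nrm x <= L)%N ->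
  path adj x p -> uniq (x :: p) -> (K0 <= size p)%N -> c * (size p)%:R <= path_time w x p.

(** The right-hand side is the time of an explicit short path, which can be the tail of a
    near-geodesic; the infimum need not be attained. *)
Definition concentrated w (L : nat) (W : R) := forall a b a' p,
  (nrm a <= L)%N -> (nrm b <= L)%N -> (nrm a' <= L)%N -> (nrm (last a' p) <= L)%N ->
  eqd a b a' (last a' p) -> path adj a' p -> uniq (a' :: p) -> (size p <= L)%N ->
  passage_time w a b <= path_time w a' p + W.

Definition good w L K0 c W :=
  [/\ forall e, 0 <= w e, linear_growth w L K0 c & concentrated w L W].

Definition lsym (g : vtx -> vtx) :=
  [/\ forall a b, adj (g a) (g b) = adj a b, cancel g g, forall x, nrm (g x) = nrm x,
      forall a b a' b', eqd a b a' b' -> eqd (g a) (g b) (g a') (g b') & g origin = origin].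

Definition refx x : vtx := (- x.1, x.2).
Definition refy x : vtx := (x.1, - x.2).
Definition swp x : vtx := (x.2, x.1).

Lemma lsym_refx : lsym refx.
Proof.
split=> //; rewrite /refx /nrm /adj /eqd /=.
- by move=> [a1 a2] [b1 b2] /=; lia.
- by move=> [a1 a2] /=; rewrite opprK.
- by move=> [a1 a2] /=; lia.
- by move=> [a1 a2] [b1 b2] [c1 c2] [d1 d2] /= [h1 h2]; split; lia.
Qed.

Lemma lsym_swp : lsym swp.
Proof.
split=> //; rewrite /swp /nrm /adj /eqd /=.
- by move=> [a1 a2] [b1 b2] /=; lia.
- by move=> [a1 a2].
- by move=> [a1 a2] /=; lia.
- by move=> [a1 a2] [b1 b2] [c1 c2] [d1 d2] /= [h1 h2]; split; lia.
Qed.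

Lemma lsym_refy : lsym refy.
Proof.
split=> //; rewrite /refy /nrm /adj /eqd /=.
- by move=> [a1 a2] [b1 b2] /=; lia.
- by move=> [a1 a2] /=; rewrite opprK.
- by move=> [a1 a2] /=; lia.
- by move=> [a1 a2] [b1 b2] [c1 c2] [d1 d2] /= [h1 h2]; split; lia.
Qed.

Lemma passage_cat w x y p : (forall e, 0 <= w e) -> path adj x p ->
  passage_time w x y <= path_time w x p + passage_time w (last x p) y.
Proof.
move=> w0 pp; rewrite leNgt; apply/negP => lt.
have {}lt : passage_time w (last x p) y < passage_time w x y - path_time w x p by lra.
have [q [pq lq _ tq]] := passage_near w0 lt.
have := @passage_le w x y (p ++ q) w0; rewrite cat_path pp pq last_cat path_time_cat.
by move=> /(_ isT lq); lra.
Qed.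

Section Sym.
Variable g : vtx -> vtx.
Hypothesis adjg : forall a b, adj (g a) (g b) = adj a b.

Lemma path_act x p : path adj (g x) (map g p) = path adj x p.
Proof. by elim: p x => [//|y p IH] x /=; rewrite IH adjg. Qed.

Lemma path_time_act w x p : path adj x p ->
  path_time (w \o act g) x p = path_time w (g x) (map g p).
Proof.
elim: p x => [|y p IH] x; first by rewrite !path_time_nil.
by case/andP=> axy pp; rewrite map_cons !path_time_cons IH //= act_edge.
Qed.

Lemma passage_act w g' x y : (forall a b, adj (g' a) (g' b) = adj a b) -> cancel g g' -> cancel g' g ->
  passage_time (w \o act g) x y = passage_time w (g x) (g y).
Proof.
move=> adjg' gK g'K; congr inf; apply/seteqP; split=> _ [p [pp lp] <-].
  exists (map g p); last by rewrite path_time_act.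
  by split; [rewrite path_act|rewrite last_map lp].
have e : p = map g (map g' p) by rewrite mapK.
rewrite e in pp lp *; exists (map g' p).
  split; first by rewrite -path_act.
  by apply: (can_inj gK); rewrite -lp last_map.
by rewrite path_time_act // -path_act.
Qed.
End Sym.

Lemma good_act w L K0 c W g : lsym g -> good w L K0 c W -> good (w \o act g) L K0 c W.
Proof.
move=> [adjg gK gn ge _] [w0 G1 G2]; split.
- by move=> e; apply: w0.
- move=> x p xL pp up sp; rewrite path_time_act // -[size p](size_map g).
  apply: G1; rewrite ?gn ?path_act ?size_map //.
  by rewrite -map_cons map_inj_uniq //; apply: can_inj gK.
- move=> a b a' p aL bL a'L lL ab pp up sp.
  rewrite (passage_act adjg w a b adjg gK gK) path_time_act //.
  apply: G2; rewrite ?gn ?path_act ?size_map ?last_map ?gn //; first exact: ge.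
  by rewrite -map_cons map_inj_uniq //; apply: can_inj gK.
Qed.

Section Hole.
Variables (L K0 D0 : nat) (c W t : R).
Hypotheses (c0 : 0 < c) (W0 : 0 <= W) (KL : (K0 <= L)%N) (tL : t + W + 3 <= c * L%:R).
Hypotheses (KD : (K0 <= D0)%N) (D1 : (0 < D0)%N) (WD : 2 * W + 1 <= c * D0%:R).
Implicit Types (h : vtx) (H : seq vtx).

(** A path longer than [L] would by linear growth take time at least [c * L]. This puts all
    near-geodesics within the range of [concentrated]. *)
Lemma near_geodesic_size w p : good w L K0 c W -> path adj origin p -> uniq (origin :: p) ->
  path_time w origin p <= t + W + 2 -> (size p <= L)%N.
Proof.
move=> [w0 G1 _] pp up tp; case: leqP => // Lp.
have := G1 origin p (leq0n _) pp up (leq_trans KL (ltnW Lp)).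
have : c * L%:R <= c * (size p)%:R by rewrite ler_pM2l // ler_nat ltnW.
by move: tp tL; lra.
Qed.

(* Reflect the tail of the path in the vertical bisector of [h] and [z]. *)
Lemma mono_col_pos w h p : good w L K0 c W -> path adj origin p -> uniq (origin :: p) ->
  (size p <= L)%N -> h.2 = (last origin p).2 -> (`|h.1|%N)%:Z <= (last origin p).1 ->
  passage_time w origin h <= path_time w origin p + W.
Proof.
move=> [w0 G1 G2] pp up sp h2 h1; set z := last origin p in h2 h1.
pose A x := h.1 + z.1 <= x.1 + x.1.
have zL : (nrm z <= L)%N.
  by have := path_nrm pp (mem_last _ _); move: sp; rewrite -/z /= /origin /nrm /=; clear; lia.
have hL : (nrm h <= L)%N by move: zL h1 h2; rewrite /nrm; clear; lia.
have Az : A z by move: h1; rewrite /A; clear; lia.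
(* If the bisector does not lie to the right of the origin, the bound on [h.1] forces [h.1 = - z.1],
   and the whole path can be compared at once. *)
have [hz|hz] := pselect (h.1 + z.1 <= 0).
  by apply: G2; rewrite -/z //; move: hz h1 h2; rewrite /eqd /origin /=; clear; lia.
have : has A (origin :: p) by apply/hasP; exists z => //; exact: mem_last.
rewrite /= /A /origin /= => /orP[|]; first by move=> k; case: hz; move: k; clear; lia.
move=> /has_split [p1 [u [p2 [pE Au nA]]]].
have lzE : z = last u p2 by rewrite /z pE last_cat.
have nv : ~~ A (last origin p1).
  have : last origin p1 \in origin :: p1 by apply: mem_last.
  rewrite in_cons => /orP[/eqP->|k]; first by rewrite /A /origin /=; move: hz; clear; lia.
  by apply: contra nA => Av; apply/hasP; exists (last origin p1).
set v := last origin p1 in nv.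
have vp : v \in origin :: p.
  by rewrite pE -cat_cons mem_cat mem_last.
have uin : u \in origin :: p by rewrite pE in_cons mem_cat mem_head !orbT.
have vL : (nrm v <= L)%N.
  by have := path_nrm pp vp; move: sp; rewrite /origin /nrm /=; clear; lia.
have uL : (nrm u <= L)%N.
  by have := path_nrm pp uin; move: sp; rewrite /origin /nrm /=; clear; lia.
move: (pp); rewrite {1}pE cat_path /= -/v => /and3P[pp1 avu pp2].
have up2 : uniq (u :: p2) by move: up; rewrite pE -cat_cons cat_uniq => /and3P[].
have sp2 : (size p2 <= L)%N by move: sp; rewrite pE size_cat /=; clear; lia.
have T0v : passage_time w origin h <= path_time w origin p1 + passage_time w v h by exact: passage_cat.
have T0u : passage_time w origin h <= path_time w origin p1 + w (edge_of v u) + passage_time w u h.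
  have := @passage_cat w origin h (rcons p1 u) w0; rewrite rcons_path pp1 avu last_rcons -cats1.
  by rewrite path_time_cat path_time_cons path_time_nil addr0; apply.
have tE : path_time w origin p = path_time w origin p1 + (w (edge_of v u) + path_time w u p2).
  by rewrite pE path_time_cat path_time_cons.
have wvu := w0 (edge_of v u).
(* Either the bisector is a lattice column and contains [u], or it runs halfway between [v] and [u],
   which are then mirror images; the reflected tail starts at [u] or at [v] accordingly. *)
have [e|ne] := eqVneq (h.1 + z.1) (u.1 + u.1).
  have : passage_time w u h <= path_time w u p2 + W.
    by apply: G2; rewrite -?lzE //; move: e h2; rewrite /eqd; clear; lia.
  by move: T0u tE; lra.
have : passage_time w v h <= path_time w u p2 + W.
  apply: G2; rewrite -?lzE //; move: ne nv Au avu h2; rewrite /A /adj /eqd; clear; lia.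
by move: T0v tE wvu; lra.
Qed.

End Hole.
End PassageTime.

(** * Domination of points and the barrier argument *)

Section Hole.
Variable R : realType.
Variables (L K0 D0 : nat) (c W t : R).
Hypotheses (c0 : 0 < c) (W0 : 0 <= W) (KL : (K0 <= L)%N) (tL : t + W + 3 <= c * L%:R).
Hypotheses (KD : (K0 <= D0)%N) (D1 : (0 < D0)%N) (WD : 2 * W + 1 <= c * D0%:R).
Implicit Types (w : edge -> R) (x y z h m a b d u v : vtx) (p q : seq vtx) (H : seq vtx).

Lemma transport g w h p : lsym g -> path adj origin p -> uniq (origin :: p) ->
  [/\ passage_time (w \o act g) origin (g h) = passage_time w origin h,
      path_time (w \o act g) origin (map g p) = path_time w origin p,
      path adj origin (map g p) & uniq (origin :: map g p)].
Proof.
move=> [adjg gK gn ge go] pp up.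
have pp' : path adj origin (map g p) by rewrite -{1}go path_act.
split=> //.
- by rewrite (passage_act adjg w _ _ adjg gK gK) go gK.
- by rewrite path_time_act // go mapK.
- by rewrite -{1}go -map_cons map_inj_uniq //; apply: can_inj gK.
Qed.

Lemma mono_col w h p : good w L K0 c W -> path adj origin p -> uniq (origin :: p) ->
  (size p <= L)%N -> h.2 = (last origin p).2 -> (`|h.1| <= `|(last origin p).1|)%N ->
  passage_time w origin h <= path_time w origin p + W.
Proof.
move=> gw pp up sp h2 h1; have [z0|z0] := leP 0 (last origin p).1.
  by apply: (mono_col_pos gw) => //; move: z0 h1; clear; lia.
have [e1 e2 pp' up'] := transport w h lsym_refx pp up.
rewrite -e1 -e2; apply: (mono_col_pos (good_act lsym_refx gw)) => //.
- by rewrite size_map.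
- by rewrite -[origin]/(refx origin) last_map.
- by rewrite -[origin]/(refx origin) last_map /refx [X in _ <= X]/=; move: z0 h1; clear => /=; lia.
Qed.

Lemma mono_row w h p : good w L K0 c W -> path adj origin p -> uniq (origin :: p) ->
  (size p <= L)%N -> h.1 = (last origin p).1 -> (`|h.2| <= `|(last origin p).2|)%N ->
  passage_time w origin h <= path_time w origin p + W.
Proof.
move=> gw pp up sp h2 h1.
have [e1 e2 pp' up'] := transport w h lsym_swp pp up.
rewrite -e1 -e2; apply: (mono_col (good_act lsym_swp gw)) => //.
- by rewrite size_map.
- by rewrite -[origin]/(swp origin) last_map.
- by rewrite -[origin]/(swp origin) last_map.
Qed.

(** One coordinate is lowered at a time, each at a cost [W]; the extra 1 buys an actual path to the
    intermediate point. *)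
Lemma mono w h p : good w L K0 c W -> path adj origin p -> uniq (origin :: p) ->
  path_time w origin p <= t + 1 ->
  (`|h.1| <= `|(last origin p).1|)%N -> (`|h.2| <= `|(last origin p).2|)%N ->
  passage_time w origin h <= path_time w origin p + 2 * W + 1.
Proof.
move=> gw pp up tp h1 h2; have [w0 _ _] := gw.
have sp : (size p <= L)%N.
  by apply: (near_geodesic_size c0 KL tL gw) => //; move: tp W0; lra.
have := @mono_col w (h.1, (last origin p).2) p gw pp up sp erefl h1 => T1.
have T1' : passage_time w origin (h.1, (last origin p).2) < path_time w origin p + W + 1 by lra.
have [q [pq lq uq tq]] := passage_near w0 T1'.
have sq : (size q <= L)%N.
  by apply: (near_geodesic_size c0 KL tL gw) => //; move: tp tq W0; lra.
have := @mono_row w h q gw pq uq sq; rewrite lq => /(_ erefl h2).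
by move: tq; lra.
Qed.

Definition hole w H := (forall h, h \in H -> t < passage_time w origin h) /\
  (forall h y, h \in H -> adj h y -> y \notin H -> passage_time w origin y <= t).

Lemma hole_act g w H : lsym g -> hole w H -> hole (w \o act g) (map g H).
Proof.
move=> [adjg gK gn ge go] [h1 h2].
have e x : passage_time (w \o act g) origin x = passage_time w origin (g x).
  by rewrite (passage_act adjg w _ _ adjg gK gK) go.
have m x : (x \in map g H) = (g x \in H).
  by rewrite -{1}(gK x) mem_map //; apply: can_inj gK.
split=> [x|x y]; rewrite !e !m; first exact: h1.
by move=> xH xy yH; apply: (h2 (g x)) => //; rewrite adjg.
Qed.

Lemma last_split (A : pred vtx) x p : A x -> ~~ A (last x p) ->
  exists p1 b p2, [/\ p = p1 ++ b :: p2, A (last x p1) & all (predC A) (b :: p2)].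
Proof.
elim: p x => [|y p IH] x Ax; first by rewrite /= Ax.
rewrite [last _ _]/= => Al; have [Ay|Ay] := boolP (A y).
  have [p1 [b [p2 [-> h1 h2]]]] := IH y Ay Al.
  by exists (y :: p1), b, p2.
have [hA|nA] := boolP (has A p); last by exists [::], y, p; rewrite /= -all_predC in nA *; rewrite Ay.
have : has A (rev p) by rewrite has_rev.
move=> /has_split [s1 [z [s2 [E Az nz]]]].
have pE : p = rev s2 ++ z :: rev s1 by rewrite -(revK p) E rev_cat rev_cons cat_rcons.
case s1E : s1 nz pE E => [|b s] nz pE E.
  by move: Al; rewrite pE last_cat /= Az.
have rE : exists b' s', rev (b :: s) = b' :: s'.
  by case e : (rev (b :: s)) => [|b' s']; [move: (congr1 size e); rewrite size_rev|exists b', s'].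
have [b' [s' rE']] := rE.
exists (y :: rcons (rev s2) z), b', s'; split.
- by rewrite pE rE' /= cat_rcons.
- by rewrite /= last_rcons.
- by rewrite -rE' all_rev all_predC.
Qed.

Lemma seq_max (H : seq vtx) : H != [::] -> exists2 m, m \in H & forall x, x \in H -> x.1 <= m.1.
Proof.
elim: H => [//|x H IH] _; have [->|/IH [m mH hm]] := eqVneq H [::].
  by exists x; rewrite ?mem_head // => y; rewrite mem_seq1 => /eqP->.
have [xm|xm] := leP x.1 m.1.
  exists m; first by rewrite in_cons mH orbT.
  by move=> y; rewrite in_cons => /orP[/eqP->|/hm].
exists x; first exact: mem_head.
by move=> y; rewrite in_cons => /orP[/eqP->|/hm h]; [|apply: le_trans h (ltW xm)].
Qed.

(** Finiteness of [H] leaves room between [t] and the passage times on [H]. A path of time below [r]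
    to a point of passage time at most [t] then misses [H], even if no geodesic exists. *)
Lemma seq_gap (f : vtx -> R) H : (forall h, h \in H -> t < f h) ->
  exists r, [/\ t < r, r <= t + 1 & forall h, h \in H -> r <= f h].
Proof.
elim: H => [|x H IH] h; first by exists (t + 1); split=> //; lra.
have [y yH|r [r1 r2 r3]] := IH; first by apply: h; rewrite in_cons yH orbT.
exists (Num.min r (f x)); split.
- by rewrite lt_min r1 h // mem_head.
- by rewrite ge_min r2.
- by move=> y; rewrite in_cons => /orP[/eqP->|/r3 k]; rewrite ge_min ?lexx ?orbT // k.
Qed.

Lemma steps_rcons (x y : vtx) p : steps x (rcons p y) = rcons (steps x p) (last x p, y).
Proof. by elim: p x => [//|z p IH] x; rewrite rcons_cons /steps [zip _ _]/= -[zip _ _]/(steps _ _) IH. Qed.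

Lemma rcount_first h0 b q (k : int) x : h0.2 = k -> x.2 = k -> all (fun y => k < y.2) (b :: q) ->
  rcount h0 (b :: q) x = (x.1 < h0.1) :> nat.
Proof.
move=> hk xk /allP al; rewrite /rcount -[steps _ _]/((h0, b) :: steps b q) /count -/(count _ _).
have -> : count (fun s => (x.1 < s.1.1) && ((s.1.2 <= x.2) (+) (s.2.2 <= x.2))) (steps b q) = 0%N.
  apply/eqP; rewrite -leqn0 leqNgt -has_count; apply/hasPn => s /mem_steps [/al s1 /al s2].
  by rewrite xk (ltNge _ s.1.2) in s1 *; move: s1 s2; rewrite !ltNge => /negPf -> /negPf ->; rewrite andbF.
rewrite addn0 /= hk xk lexx; have : k < b.2 by apply: al; exact: mem_head.
by rewrite ltNge => /negPf ->; rewrite andbT.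
Qed.

Lemma rcount_last h0 q h1 (k : int) x : h1.2 = k + 1 -> x.2 = k -> adj (last h0 q) h1 ->
  all (fun y => y.2 <= k) (h0 :: q) ->
  rcount h0 (rcons q h1) x = (x.1 < h1.1) :> nat.
Proof.
move=> hk xk ad /allP al; rewrite /rcount steps_rcons -cats1 count_cat.
have -> : count (fun s => (x.1 < s.1.1) && ((s.1.2 <= x.2) (+) (s.2.2 <= x.2))) (steps h0 q) = 0%N.
  apply/eqP; rewrite -leqn0 leqNgt -has_count; apply/hasPn => s /mem_steps [/al s1 /al s2].
  by rewrite xk s1 s2 andbF.
have := al _ (mem_last h0 q); move: ad hk xk; move: (last h0 q) => [l1 l2].
move: h1 x {al} => [a1 a2] [x1 x2]; rewrite /adj /= => ad hk xk lk.
rewrite hk xk addn0 add0n lk; have -> : (k + 1 <= k) = false by clear; lia.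
by rewrite andbT; have -> : l1 = a1 by move: ad hk lk; clear; lia.
Qed.

Lemma no_straddle (a b m : vtx) : adj a b -> (a.2 = m.2 -> a.1 <= m.1) -> (b.2 = m.2 -> b.1 <= m.1) ->
  ~~ ((m.1 + 1 < a.1) && ((a.2 <= m.2) (+) (b.2 <= m.2))).
Proof. by move: a b m => [a1 a2] [b1 b2] [m1 m2]; rewrite /adj /=; lia. Qed.

Lemma rcount_right h0 q m : path adj h0 q -> (forall x, x \in h0 :: q -> x.2 = m.2 -> x.1 <= m.1) ->
  rcount h0 q (m.1 + 1, m.2) = 0%N.
Proof.
move=> pq hm; apply/eqP; rewrite /rcount -leqn0 leqNgt -has_count; apply/hasPn => s ss.
have := pq; rewrite path_steps => al; have ad := allP al _ ss.
have [i1 i2] := mem_steps ss.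
exact: no_straddle ad (hm _ i1) (hm _ i2).
Qed.

(* [z] is the last vertex outside the open strip of a geodesic to [y].  The
   barrier [h0, b, q, h1] separates the strip and [y] lies on its right, so
   [z] is to the right of the end of the barrier in its row. *)
Lemma strip_core w H h0 b q h1 y m : good w L K0 c W -> hole w H ->
  0 <= h0.2 -> 0 <= h0.1 -> h1.2 = h0.2 + D0%:Z + D0%:Z ->
  path adj h0 (b :: rcons q h1) -> all [in H] (h0 :: b :: rcons q h1) ->
  all (fun x => h0.2 < x.2 < h1.2) (b :: q) ->
  m \in H -> y = (m.1 + 1, m.2) -> m.2 = h0.2 + D0%:Z ->
  (forall x, x \in H -> x.2 = m.2 -> x.1 <= m.1) -> False.
Proof.
move=> gw [hH1 hH2] k1 h01 k3E pq qH rows mH yE mk2 mmax.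
have [w0 G1 _] := gw.
set k1' := h0.2 in k1 k3E rows mk2; set k3 := h1.2 in k3E rows.
have k13 : k1' < k3 by move: k3E D1; clear; lia.
have yH : y \notin H by apply/negP => /mmax; rewrite yE /= => /(_ erefl); lia.
have my : adj m y by rewrite yE /adj /=; clear; lia.
have Ty : passage_time w origin y <= t := hH2 m y mH my yH.
have [r [r1 r2 r3]] := seq_gap hH1.
have [g [pg lg ug tg]] := passage_near w0 (le_lt_trans Ty r1).
have gH x : x \in origin :: g -> x \notin H.
  move=> xg; apply/negP => /r3 xr.
  case/splitPl: xg pg tg xr => g1 g2 lx; rewrite cat_path path_time_cat => /andP[pg1 _] tg xr.
  have := passage_le w0 pg1 lx; have := path_time_ge0 (last origin g1) g2 w0.
  by move: tg xr; lra.
pose A := fun x : vtx => ~~ (k1' < x.2 < k3).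
have A0 : A origin by rewrite /A /origin /=; move: k1; clear; lia.
have Ay : ~~ A (last origin g) by rewrite /A negbK lg yE /=; move: mk2 k3E D1; clear; lia.
have [g1 [d [g2 [gE Az Ag2]]]] := last_split A0 Ay.
set z := last origin g1 in Az.
move: (pg); rewrite {1}gE cat_path -/z => /andP[pg1 pg2].
have azd : adj z d by case/andP: pg2.
have dA : k1' < d.2 < k3 by case/andP: Ag2 => /negbNE.
have lz : last z (d :: g2) = y by rewrite -lg gE last_cat.
have zk : z.2 = k1' \/ z.2 = k3.
  by move: azd dA Az; rewrite /A /adj; clear; lia.
(* [z] lies on the bottom or top row and [y] on the middle row, so the remaining part costs at least
   [c * D0 >= 2 * W + 1]. *)
have zD : (D0 <= size (d :: g2))%N.
  by have := path_rows pg2; rewrite lz yE; move: zk mk2 k3E; rewrite [(_, _).2]/=; clear; lia.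
have sg : (size g <= L)%N by apply: (near_geodesic_size c0 KL tL gw) => //; move: tg r2 W0; lra.
have zg : z \in origin :: g1 by exact: mem_last.
have zL : (nrm z <= L)%N.
  have := path_nrm pg1 zg; rewrite -[nrm origin]/0%N add0n => zs; apply: leq_trans zs _.
  by apply: leq_trans sg; rewrite gE size_cat leq_addr.
have uz : uniq (z :: d :: g2).
  move: ug; rewrite gE -cat_cons lastI -/z cat_rcons cat_uniq => /and3P[_ _]; done.
have T2 := G1 z (d :: g2) zL pg2 uz (leq_trans KD zD).
have T2' : c * D0%:R <= c * (size (d :: g2))%:R by rewrite ler_pM2l // ler_nat.
have tgE : path_time w origin g = path_time w origin g1 + path_time w z (d :: g2).
  by rewrite gE path_time_cat.
(* A vertex [h] of [H] dominated by [z] would have passage time at most that of the initial part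
   plus [2 * W + 1], hence at most that of the whole path, which is below [r]. *)
have dom h : h \in H -> (`|h.1| <= `|z.1|)%N -> (`|h.2| <= `|z.2|)%N -> False.
  move=> hH h1' h2'.
  have ug1 : uniq (origin :: g1) by move: ug; rewrite gE -cat_cons cat_uniq => /andP[].
  have p2 := path_time_ge0 z (d :: g2) w0.
  have tg1 : path_time w origin g1 <= t + 1 by move: tg tgE r2 p2; lra.
  have := mono gw pg1 ug1 tg1 h1' h2'; have := r3 _ hH.
  by move: tg tgE T2 T2' WD; lra.
have inH x : x \in h0 :: b :: rcons q h1 -> x \in H by move=> xq; apply: (allP qH).
have gnq x : x \in origin :: g -> x \notin h0 :: b :: rcons q h1.
  by move=> xg; apply: contra (gH x xg); exact: inH.
have zH : z \notin H by apply: gH; rewrite gE -cat_cons mem_cat zg.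
have h0H : h0 \in H by apply: inH; exact: mem_head.
have h1H : h1 \in H by apply: inH; rewrite !in_cons mem_rcons mem_head !orbT.
have y0 : rcount h0 (b :: rcons q h1) y = 0%N.
  by rewrite yE; apply: rcount_right => // x /inH; exact: mmax.
have mem_g2 x : x \in d :: g2 -> x \in origin :: g.
  by move=> xg; rewrite gE -cat_cons mem_cat xg orbT.
have in_g2 x : x \in d :: g2 -> k1' < x.2 < k3 by move=> xg; have := allP Ag2 _ xg; move/negbNE.
have lq : k3 <= (last h0 (b :: rcons q h1)).2 by rewrite /= last_rcons.
have rowb : all (fun x => k1' < x.2) (b :: rcons q h1).
  rewrite -rcons_cons all_rcons; apply/andP; split; first exact: k13.
  by apply: sub_all rows => x /andP[].
have rowl : all (fun x => x.2 <= k3 - 1) (h0 :: b :: q).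
  apply/andP; split; first by have : k1' <= k3 - 1 by move: k13; clear; lia.
  by apply: sub_all rows => x; clear; lia.
(* On the bottom row only the first step of the barrier is seen, so the parity at [z] tests whether
   [z] is to the left of [h0]; it is even, as at [y]. *)
case: zk => zk.
  have od : odd (rcount h0 (b :: rcons q h1) z) = odd (rcount h0 (b :: rcons q h1) (last z (d :: g2))).
    apply: (rcount_path pq pg2 (lexx _) lq); apply/allP => x; rewrite in_cons => /orP[/eqP->|xg].
      apply/andP; split; last by apply: gnq; rewrite gE -cat_cons mem_cat zg.
      by rewrite zk; apply/andP; split; [exact: lexx|exact: k13].
    rewrite gnq ?mem_g2 // andbT; have /andP[i1 i2] := in_g2 _ xg.
    by apply/andP; split; [exact: ltW|].
  rewrite lz y0 (rcount_first (k := k1')) // oddb in od.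
  have zh : h0 != z by apply: contra zH => /eqP <-.
  apply: (dom h0 h0H); last by rewrite zk.
  have : z.1 != h0.1.
    by apply: contra zh => /eqP e; apply/eqP; rewrite [RHS]surjective_pairing e zk -surjective_pairing.
  move: od h01; clear; lia.
(* The top row is excluded from the parity argument, which therefore starts at [d], just below [z];
   there only the last step of the barrier is seen, so [z] is to the right of [h1]. *)
have pd : path adj d g2 by case/andP: pg2.
have od : odd (rcount h0 (b :: rcons q h1) d) = odd (rcount h0 (b :: rcons q h1) (last d g2)).
  apply: (rcount_path pq pd (lexx _) lq); apply/allP => x xg.
  rewrite gnq ?mem_g2 // andbT; have /andP[i1 i2] := in_g2 _ xg.
  by apply/andP; split; [exact: ltW|].
have lz' : last d g2 = y by rewrite -lz.
have [d1 d2] : d.1 = z.1 /\ d.2 = k3 - 1.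
  by move: azd dA zk; rewrite /adj; clear; lia.
have k3e : h1.2 = k3 - 1 + 1 by rewrite subrK.
have alq : adj (last h0 (b :: q)) h1 by move: pq; rewrite -rcons_cons rcons_path => /andP[].
rewrite lz' y0 -rcons_cons (rcount_last k3e d2 alq rowl) oddb d1 in od.
have zh : h1 != z by apply: contra zH => /eqP <-.
have hz1 : h1.1 < z.1.
  have : z.1 != h1.1.
    by apply: contra zh => /eqP e; apply/eqP; rewrite [RHS]surjective_pairing e zk -surjective_pairing.
  move: od; clear; lia.
have [hz|hz] := leP h0.1 z.1.
  apply: (dom h0 h0H); first by move: hz h01; clear; lia.
  have : (`|k1'| <= `|k3|)%N by move: k1 k3E; clear; lia.
  by rewrite zk.
(* Now the column of [z] lies between [h1] and [h0], so the barrier meets it, at a vertex no higher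
   than [z]. *)
have : has (fun x : vtx => x.1 <= z.1) (b :: rcons q h1).
  by apply/hasP; exists h1; [rewrite in_cons mem_rcons mem_head orbT|exact: ltW].
move=> /has_split [q1 [e [q2 [qE ez nq1]]]].
have eH : e \in H by apply: inH; rewrite qE in_cons mem_cat mem_head !orbT.
have e1 : e.1 = z.1.
  have nl : ~~ ((last h0 q1).1 <= z.1).
    have := mem_last h0 q1; rewrite in_cons => /orP[/eqP->|lq1]; first by rewrite -ltNge.
    by apply: contra nq1 => k; apply/hasP; exists (last h0 q1).
  have : adj (last h0 q1) e by move: pq; rewrite qE cat_path => /andP[_ /andP[]].
  by move: nl ez; rewrite /adj; clear; lia.
apply: (dom e eH); first by rewrite e1.
have : e \in b :: rcons q h1 by rewrite qE mem_cat mem_head orbT.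
rewrite -rcons_cons mem_rcons in_cons => /orP[/eqP->|/(allP rows)]; rewrite zk //.
have : forall k : int, k1' < k < k3 -> (`|k| <= `|k3|)%N by move: k1; clear; lia.
exact.
Qed.

Lemma on_mem (e : rel vtx) H x y : on [in H] e x y -> [/\ e x y, x \in H & y \in H].
Proof. by case/and3P. Qed.

Lemma cross_row (x y : vtx) (k : int) : adj x y -> x.2 < k -> ~~ (y.2 < k) -> y.2 = k /\ x.2 + 1 = k.
Proof. by move: x y => [x1 x2] [y1 y2]; rewrite /adj /=; lia. Qed.

(** A barrier is cut from a path in [H] between its last visit to the bottom row and the first
    arrival at the top row. The same path meets the middle row, where the rightmost vertex [m] of
    [H] is taken. *)
Lemma strip w H u v : good w L K0 c W -> hole w H -> reach (on [in H] adj) u v ->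
  0 <= u.2 -> u.2 + D0%:Z + D0%:Z <= v.2 -> False.
Proof.
move=> gw hH uv u0 uv2; set e0 := on [in H] adj in uv.
pose A := fun x : vtx => x.2 < u.2 + D0%:Z + D0%:Z.
have Au : A u by rewrite /A; move: D1; clear; lia.
have Av : ~~ A v by rewrite /A -leNgt.
have [a [h1 [ua Aa Ah1 ah1]]] := reach_exit Au Av uv.
pose B := fun x : vtx => x.2 <= u.2.
have [adah aH h1H] := on_mem ah1.
have [h1E aE] := cross_row adah Aa Ah1.
have Bu : B u by rewrite /B.
have Ba : ~~ B a.
  have : forall k : int, k + 1 = u.2 + D0%:Z + D0%:Z -> ~~ (k <= u.2) by move: D1; clear; lia.
  by apply.
have [h0 [b [Bh0 Bb h0b ba]]] := reach_last_exit Bu Ba ua.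
have [h0b' Ah0 Ab] := and3P h0b.
have [adhb h0H bH] := on_mem h0b'.
have [bE h0E'] : b.2 = u.2 + 1 /\ h0.2 + 1 = u.2 + 1.
  by apply: cross_row adhb _ _; rewrite ltzD1.
have h0E : h0.2 = u.2 by move: h0E'; apply: addIr.
have [q pq lq] := ba.
have pq' : path adj b q.
  by apply: sub_path pq => x y /and3P[/and3P[/and3P[]]].
have qH : all (fun x => [&& x \in H, A x & ~~ B x]) q.
  elim: q b pq {bE lq Ab Bb h0b h0b' adhb bH ba pq'} => [//|x q IH] b /andP[h /IH /= ->].
  case/and3P: h => /and3P[/and3P[_ _ xH] _ Ax] _ Bx.
  by rewrite andbT; apply/and3P; split.
have [hh0 [hh [m2 [uh0 Ah0' Ah2 h0m]]]] : True /\ exists h m2 : vtx, [/\ reach (on (fun x => x.2 < u.2 + D0%:Z) e0) u h,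
    h.2 < u.2 + D0%:Z, ~~ (m2.2 < u.2 + D0%:Z) & e0 h m2].
  split=> //; apply: reach_exit uv; first by move: D1; clear; lia.
  by rewrite -leNgt; apply: le_trans uv2; rewrite lerDl.
have [adhm _ m2H] := on_mem h0m.
have [m2E _] := cross_row adhm Ah0' Ah2.
have ne : [seq x <- H | x.2 == m2.2] != [::].
  by apply/eqP => e; have := mem_filter (fun x : vtx => x.2 == m2.2) m2 H; rewrite e m2H eqxx.
have [m mf mmax] := seq_max ne.
move: mf; rewrite mem_filter => /andP[/eqP mm mH].
have mmax' x : x \in H -> x.2 = m.2 -> x.1 <= m.1.
  by move=> xH xm; apply: mmax; rewrite mem_filter xH xm mm eqxx.
have rows : all (fun x => h0.2 < x.2 < h1.2) (b :: q).
  rewrite h0E h1E /=; apply/andP; split; first by rewrite ltNge; apply/andP.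
  by apply: sub_all qH => x /and3P[_ h h']; rewrite ltNge; apply/andP.
have pp : path adj h0 (b :: rcons q h1) by rewrite /= adhb rcons_path pq' lq.
have allH : all [in H] (h0 :: b :: rcons q h1).
  by rewrite /= h0H bH all_rcons h1H; apply: sub_all qH => x /and3P[].
have h12 : h1.2 = h0.2 + D0%:Z + D0%:Z by rewrite h0E.
have mE : m.2 = h0.2 + D0%:Z by rewrite mm h0E.
have h02 : 0 <= h0.2 by rewrite h0E.
have [s|s] := leP 0 h0.1; first by apply: (strip_core gw hH h02 s h12 pp allH rows mH erefl mE mmax').
(* A barrier starting to the left of the axis is reflected; the rightmost vertex of the middle row
   must then be chosen anew. *)
have gw' := good_act lsym_refx gw; have hH' := hole_act lsym_refx hH.
have [adjg gK _ _ _] := lsym_refx.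
have inj : injective refx := can_inj gK.
have pp' : path adj (refx h0) (refx b :: rcons (map refx q) (refx h1)).
  by rewrite -map_rcons -map_cons path_act.
have allH' : all [in map refx H] (refx h0 :: refx b :: rcons (map refx q) (refx h1)).
  by rewrite -map_rcons -!map_cons all_map; apply: sub_all allH => x xH /=; rewrite mem_map.
have rows' : all (fun x : vtx => (refx h0).2 < x.2 < (refx h1).2) (refx b :: map refx q).
  by rewrite -map_cons all_map.
pose H' := map refx H.
have ne' : [seq x <- H' | x.2 == m2.2] != [::].
  apply/eqP => e; have := mem_filter (fun x : vtx => x.2 == m2.2) (refx m2) H'.
  by rewrite e mem_map // m2H [(refx m2).2]/= eqxx.
have [m' mf' mmax2] := seq_max ne'.
move: mf'; rewrite mem_filter => /andP[/eqP mm' mH'].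
have mmax2' x : x \in H' -> x.2 = m'.2 -> x.1 <= m'.1.
  by move=> xH xm; apply: mmax2; rewrite mem_filter xH xm mm' eqxx.
have s' : 0 <= (refx h0).1 by rewrite /refx /= oppr_ge0 ltW.
have mE' : m'.2 = (refx h0).2 + D0%:Z by rewrite mm' /= h0E.
exact: (@strip_core _ _ (refx h0) (refx b) (map refx q) (refx h1) _ m' gw' hH' h02 s' h12 pp' allH' rows' mH' erefl mE' mmax2').
Qed.

(** A height above [4 * D0] leaves a part of height at least [2 * D0] on one side of the horizontal
    axis; after a reflection it lies in the upper half-plane. *)
Lemma hole_height w H u v : good w L K0 c W -> hole w H -> reach (on [in H] adj) u v ->
  (`|u.2 - v.2| <= 4 * D0)%N.
Proof.
move=> gw hH.
have sym : symmetric (on [in H] adj) by move=> x y; rewrite /on adj_sym [(x \in H) && _]andbC.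
suff up (a b : vtx) : reach (on [in H] adj) a b -> a.2 + (4 * D0)%N%:Z < b.2 -> False.
  move=> uv; rewrite leqNgt; apply/negP => lt.
  have [uv2|uv2] := leP u.2 v.2.
    by apply: (up u v uv); move: lt uv2; clear; lia.
  by apply: (up v u (reach_sym sym uv)); move: lt uv2; clear; lia.
move=> ab lt.
have [a0|a0] := leP 0 a.2.
  by apply: (strip gw hH ab a0); move: lt; clear; lia.
have cross k : a.2 < k -> k <= b.2 -> exists2 z : vtx, z.2 = k &
    reach (on [in H] adj) a z /\ reach (on [in H] adj) z b.
  move=> ak kb.
  have := @reach_last_exit _ (on [in H] adj) (fun x => x.2 < k) a b ak _ ab.
  rewrite -leNgt => /(_ kb) [x [z [xk zk xz zb]]].
  have zb' : reach (on [in H] adj) z b by apply: reach_sub zb => ? ? /and3P[].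
  exists z; first by have [adz _ _] := on_mem xz; case: (cross_row adz xk zk).
  by split=> //; apply: reach_trans ab _; apply: reach_sym.
have [b0|b0] := leP ((D0 + D0)%N%:Z) b.2.
  have [z zE [_ zb]] : exists2 z : vtx, z.2 = 0 & reach (on [in H] adj) a z /\ reach (on [in H] adj) z b.
    by apply: cross => //; apply: le_trans b0.
  by apply: (strip gw hH zb); rewrite zE //; move: b0; clear; lia.
have gw' := good_act lsym_refy gw; have hH' := hole_act lsym_refy hH.
have [adjg gK _ _ _] := lsym_refy.
have inj : injective refy := can_inj gK.
pose k : int := Num.min 0 b.2.
have [z zE [az _]] : exists2 z : vtx, z.2 = k & reach (on [in H] adj) a z /\ reach (on [in H] adj) z b.
  by apply: cross; rewrite /k; move: lt a0; clear; lia.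
have [p pp lp] := az.
have za : reach (on [in map refy H] adj) (refy z) (refy a).
  apply: reach_sym; first by move=> x y; rewrite /on adj_sym [(x \in _) && _]andbC.
  exists (map refy p); last by rewrite last_map lp.
  rewrite path_map; apply: sub_path pp => x y /and3P[xy xH yH] /=.
  by rewrite /on adjg xy /= !mem_map // xH.
by apply: (strip gw' hH' za); rewrite /refy /= zE /k; move: lt a0 b0; clear; lia.
Qed.

Lemma hole_extent w H u v : good w L K0 c W -> hole w H -> reach (on [in H] adj) u v ->
  (dst u v <= 4 * D0)%N.
Proof.
move=> gw hH uv; have h2 := hole_height gw hH uv.
have gw' := good_act lsym_swp gw; have hH' := hole_act lsym_swp hH.
have [adjg gK _ _ _] := lsym_swp.
have inj : injective swp := can_inj gK.
have uv' : reach (on [in map swp H] adj) (swp u) (swp v).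
  have [p pp lp] := uv; exists (map swp p); last by rewrite last_map lp.
  rewrite path_map; apply: sub_path pp => x y /and3P[xy xH yH] /=.
  by rewrite /on adjg xy /= !mem_map // xH.
have := hole_height gw' hH' uv'; move: h2; rewrite /swp /dst /shift /opv /nrm /=.
by clear; lia.
Qed.

Lemma hole_size w n : good w L K0 c W -> finite_component_size (~` ball_B w t) n ->
  (n <= (8 * D0).+1 * (8 * D0).+1)%N.
Proof.
move=> gw [s [us [x Sx Cx] <-]].
set S := ~` ball_B w t in Sx Cx.
have SE y : S y <-> t < passage_time w origin y.
  rewrite /S /ball_B /setC /=; split; [move=> /negP; rewrite -ltNge //|].
  by rewrite ltNge => /negP.
have inS y : y \in s <-> connected_in S x y.
  by split=> [ys|]; [have : [set` s] y by []; rewrite Cx|move=> cy; have : [set` s] y by rewrite Cx].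
have cS y : connected_in S x y -> S y.
  move=> [p [[pp <-] _ /allP al]]; have := mem_last x p; rewrite in_cons => /orP[/eqP->|/al /asboolP] //.
have hs : hole w s.
  split=> [h /inS /cS /SE //|h y /inS [p [[pp lp] _ al]] hy ys].
  rewrite leNgt; apply/negP => /SE Sy; move: ys => /negP; apply; apply/inS.
  exists (rcons p y); split=> //; last by rewrite all_rcons al andbT; apply/asboolP.
  by split; [rewrite rcons_path pp lp|rewrite last_rcons].
have rs y : y \in s -> reach (on [in s] adj) x y.
  move=> /inS [p [[pp lp] _ al]]; exists p => //.
  have : all [in s] (x :: p).
    apply/allP => z zp; apply/inS; case/splitPl: zp pp al lp => p1 p2 lz.
    rewrite cat_path all_cat => /andP[pp1 _] /andP[al1 _] _; exists p1; split=> //.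
  elim: p x {Sx Cx inS cS al lp} pp => [//|z p IH] x /andP[xz pz] /and3P[xs zs ps].
  rewrite [path _ _ _]/= /on xz xs zs /=; apply: IH => //=; by rewrite zs.
have sub : {subset s <= ball x (4 * D0)}.
  by move=> y ys; rewrite mem_ball; apply: hole_extent gw hs (rs y ys).
have := uniq_leq_size us sub; rewrite size_ball.
have -> : (4 * D0).*2 = (8 * D0)%N by rewrite -muln2; clear; lia.
by [].
Qed.

End Hole.

(** * Passage times restricted to bounded paths *)

Section PathLists.
Variable R : realType.
Implicit Types (f w : edge -> R) (x y a b : vtx) (p q : seq vtx) (L : nat).

Definition nbrs x : seq vtx :=
  [:: (x.1 + 1, x.2); (x.1 - 1, x.2); (x.1, x.2 + 1); (x.1, x.2 - 1)].

Lemma mem_nbrs x y : (y \in nbrs x) = adj x y.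
Proof.
move: x y => [x1 x2] [y1 y2]; rewrite /nbrs /adj !in_cons in_nil /= !xpair_eqE.
by apply/idP/idP; lia.
Qed.

Fixpoint paths L x : seq (seq vtx) :=
  [::] :: if L is L'.+1 then flatten [seq map (cons y) (paths L' y) | y <- nbrs x] else [::].

Lemma pathsS L x : paths L.+1 x = [::] :: flatten [seq map (cons y) (paths L y) | y <- nbrs x].
Proof. by []. Qed.

Lemma mem_paths L x p : (p \in paths L x) = path adj x p && (size p <= L)%N.
Proof.
elim: L x p => [|L IH] x [|y p] //; first by rewrite /= andbF.
rewrite pathsS in_cons; apply/idP/idP.
  move=> /orP[//|/flatten_mapP [z zx /mapP [q]]]; rewrite mem_nbrs in zx.
  by rewrite IH => /andP[pq sq] [-> ->] /=; rewrite zx pq.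
case/andP=> /andP[xy pp] sp; apply/orP; right; apply/flatten_mapP; exists y.
  by rewrite mem_nbrs.
by apply/mapP; exists p => //; rewrite IH; apply/andP.
Qed.

Definition edges x p := [seq edge_of s.1 s.2 | s <- steps x p].

Lemma path_time_edges f x p : path_time f x p = \sum_(e <- edges x p) f e.
Proof. by rewrite big_map. Qed.

Lemma size_edges x p : size (edges x p) = size p.
Proof. by rewrite size_map size_zip /=; apply/minn_idPr. Qed.

Lemma mem_edges x p e : path adj x p -> e \in edges x p ->
  src e \in x :: p /\ tgt e \in x :: p.
Proof.
move=> pp /mapP [s ss ->]; have [s1 s2] := mem_steps ss.
have := pp; rewrite path_steps => /allP/(_ _ ss) /edge_ends [] [-> ->] //.
Qed.

Lemma uniq_edges x p : path adj x p -> uniq (x :: p) -> uniq (edges x p).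
Proof.
elim: p x => [//|y p IH] x /andP[xy pp] /andP[xn up].
rewrite /edges -[steps _ _]/((x, y) :: steps y p) map_cons cons_uniq IH // andbT.
apply/negP => /(mem_edges pp) [h1 h2]; move: xn.
by case: (edge_ends xy) => -[e1 e2]; rewrite [(x,y).1]/= [(x,y).2]/= ?e1 ?e2 in h1 h2; rewrite ?h1 ?h2.
Qed.

Lemma steps_map (g : vtx -> vtx) x p : steps (g x) (map g p) = [seq (g s.1, g s.2) | s <- steps x p].
Proof. by elim: p x => [//|y p IH] x; rewrite map_cons -[LHS]/((g x, g y) :: steps (g y) (map g p)) IH. Qed.

Definition admissible L a b := [seq p <- paths L a | uniq (a :: p) && (last a p == b)].

Lemma mem_admissible L a b p : p \in admissible L a b <->
  [/\ path adj a p, last a p = b, uniq (a :: p) & (size p <= L)%N].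
Proof.
rewrite mem_filter mem_paths; split; first by case/andP => /andP[-> /eqP ->] /andP[-> ->].
by move=> [-> -> -> ->]; rewrite eqxx.
Qed.

Lemma admissible_edges L a b p e : (nrm a <= L)%N -> p \in admissible L a b ->
  e \in edges a p -> e \in EL (3 * L).
Proof.
move=> aL /mem_admissible [pp _ _ sp] /(mem_edges pp) [h _].
rewrite mem_EL /box; apply: leq_trans (path_nrm pp h) _.
by move: (nrm a) (size p) aL sp => k m; clear; lia.
Qed.

(** A minimum over finitely many self-avoiding paths, hence a function of finitely many weights. The
    default 0 for points without such a path is harmless, since [log_mgf] then vanishes as well. *)
Definition restricted_time L a b f : R :=
  if admissible L a b is c0 :: G then summin (edges a c0) (map (edges a) G) f else 0.

Lemma summin_le (I : eqType) (c0 : seq I) (G : seq (seq I)) (f : I -> R) c :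
  c \in c0 :: G -> summin c0 G f <= \sum_(e <- c) f e.
Proof.
rewrite /summin; elim: G => [|c1 G IH]; first by rewrite mem_seq1 big_nil => /eqP->.
rewrite big_cons !in_cons => /or3P[h|/eqP->|h]; rewrite ge_min ?lexx // IH ?orbT // in_cons h ?orbT //.
Qed.

Lemma summin_attained (I : eqType) (c0 : seq I) (G : seq (seq I)) (f : I -> R) :
  exists2 c, c \in c0 :: G & summin c0 G f = \sum_(e <- c) f e.
Proof.
rewrite /summin; elim: G => [|c1 G [c cG IH]]; first by exists c0; rewrite ?mem_head // big_nil.
rewrite big_cons IH; case: leP => _; first by exists c1; rewrite // !in_cons eqxx orbT.
by exists c => //; move: cG; rewrite !in_cons => /orP[->//|->]; rewrite !orbT.
Qed.

Lemma restricted_le L a b f p : p \in admissible L a b -> restricted_time L a b f <= path_time f a p.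
Proof.
rewrite /restricted_time path_time_edges; case: (admissible L a b) => [//|c0 G] pG.
by apply: summin_le; rewrite -map_cons map_f.
Qed.

Lemma restricted_attained L a b f p : p \in admissible L a b ->
  exists2 q, q \in admissible L a b & restricted_time L a b f = path_time f a q.
Proof.
rewrite /restricted_time; case: (admissible L a b) => [//|c0 G] _.
have [c] := summin_attained (edges a c0) (map (edges a) G) f.
by rewrite -map_cons => /mapP [q qG ->] ->; exists q => //; rewrite path_time_edges.
Qed.

Definition flip (s : bool) (z : int) := if s then z else - z.
(** The isometry taking [a] to [b] and reversing the axes prescribed by the signs; these four maps
    realise exactly the relation [eqd]. *)
Definition iso s1 s2 a b x : vtx := (b.1 + flip s1 (x.1 - a.1), b.2 + flip s2 (x.2 - a.2)).

Lemma adj_iso s1 s2 a b x y : adj (iso s1 s2 a b x) (iso s1 s2 a b y) = adj x y.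
Proof.
by move: s1 s2 a b x y => [] [] [a1 a2] [b1 b2] [x1 x2] [y1 y2]; rewrite /adj /iso /flip /=; lia.
Qed.

Lemma isoK s1 s2 a b : cancel (iso s1 s2 a b) (iso s1 s2 b a).
Proof.
by move: s1 s2 a b => [] [] [a1 a2] [b1 b2] [x1 x2]; rewrite /iso /flip /=; congr (_, _); lia.
Qed.

Lemma iso_left s1 s2 a b : iso s1 s2 a b a = b.
Proof. by move: s1 s2 a b => [] [] [a1 a2] [b1 b2]; rewrite /iso /flip /=; congr (_, _); lia. Qed.

Lemma eqd_iso a b a' b' : eqd a b a' b' -> exists s1 s2, iso s1 s2 a a' b = b'.
Proof.
move: a b a' b' => [a1 a2] [b1 b2] [c1 c2] [d1 d2]; rewrite /eqd /= => -[h1 h2].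
exists (b1 - a1 == d1 - c1), (b2 - a2 == d2 - c2); rewrite /iso /flip /=.
by congr (_, _); case: eqP; lia.
Qed.

Lemma admissible_iso L s1 s2 a a' b p :
  (map (iso s1 s2 a a') p \in admissible L a' (iso s1 s2 a a' b)) = (p \in admissible L a b).
Proof.
have inj : injective (iso s1 s2 a a') := can_inj (@isoK _ _ _ _).
apply/idP/idP => /mem_admissible [pp lp up sp]; apply/mem_admissible.
  split; first by rewrite -(path_act (@adj_iso s1 s2 a a')) iso_left.
  - by apply: inj; rewrite -lp -[X in last X (map _ _)](iso_left s1 s2 a a') last_map.
  - by rewrite -(map_inj_uniq inj) map_cons iso_left.
  - by move: sp; rewrite size_map.
set g := iso s1 s2 a a' in inj *; have ga : g a = a' by exact: iso_left.
split; last by rewrite size_map.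
- by rewrite -ga (@path_act g (@adj_iso s1 s2 a a')).
- by rewrite -ga last_map lp.
- by rewrite -{1}ga -map_cons map_inj_uniq.
Qed.

Lemma restricted_iso L s1 s2 a a' b f :
  restricted_time L a' (iso s1 s2 a a' b) f = restricted_time L a b (f \o act (iso s1 s2 a a')).
Proof.
set g := iso s1 s2 a a'; have gK : cancel (iso s1 s2 a' a) g := @isoK s1 s2 a' a.
have pt q : q \in admissible L a b -> path_time (f \o act g) a q = path_time f a' (map g q).
  move=> /mem_admissible [pq _ _ _]; rewrite (path_time_act (@adj_iso s1 s2 a a')) //.
  by rewrite -/g /g iso_left.
have [E|[p0 p0A]] : admissible L a b = [::] \/ exists p, p \in admissible L a b.
  by case: (admissible L a b) => [|p G]; [left|right; exists p; exact: mem_head].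
  have E' : admissible L a' (g b) = [::].
    case E' : (admissible L a' (g b)) => [//|p G].
    have : p \in admissible L a' (g b) by rewrite E' mem_head.
    by rewrite -(mapK gK p) admissible_iso E.
  by rewrite /restricted_time E E'.
apply/eqP; rewrite eq_le; apply/andP; split.
  have [q qA ->] := restricted_attained (f \o act g) p0A.
  by rewrite pt //; apply: restricted_le; rewrite admissible_iso.
have p0A' : map g p0 \in admissible L a' (g b) by rewrite admissible_iso.
have [q qA ->] := restricted_attained f p0A'.
have qE : q = map g (map (iso s1 s2 a' a) q) by rewrite mapK.
rewrite qE admissible_iso in qA; rewrite qE -pt //; exact: restricted_le.
Qed.

Lemma restricted_agree L a b f f' : (forall p e, p \in admissible L a b -> e \in edges a p -> f e = f' e) ->
  restricted_time L a b f = restricted_time L a b f'.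
Proof.
move=> ff; have pt q : q \in admissible L a b -> path_time f a q = path_time f' a q.
  move=> qA; rewrite !path_time_edges big_seq [RHS]big_seq; apply: eq_bigr => e eq.
  exact: ff qA eq.
have [E|[p0 p0A]] : admissible L a b = [::] \/ exists p, p \in admissible L a b.
  by case: (admissible L a b) => [|p G]; [left|right; exists p; exact: mem_head].
  by rewrite /restricted_time E.
apply/eqP; rewrite eq_le; apply/andP; split.
  by have [q qA ->] := restricted_attained f' p0A; rewrite -pt //; exact: restricted_le.
by have [q qA ->] := restricted_attained f p0A; rewrite pt //; exact: restricted_le.
Qed.

(* With this centring both tails follow from [Ex_inv_product]. *)
Definition log_mgf l L (lam : R) a b : R :=
  ln (Ex l (EL (3 * L)) (fun f => expR (lam * restricted_time L a b f)) (fun=> 0)) / lam.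

(** An isometry only permutes independent, identically distributed weights, and the paths from both
    starting points stay among the edges of [EL (3 * L)]. This is how the centring cancels. *)
Lemma log_mgf_eqd l L lam a b a' b' : law l -> (nrm a <= L)%N -> (nrm a' <= L)%N ->
  eqd a b a' b' -> log_mgf l L lam a b = log_mgf l L lam a' b'.
Proof.
move=> hl aL a'L /eqd_iso [s1 [s2 <-]]; congr (ln _ / _).
set g := iso s1 s2 a a'; set g' := iso s1 s2 a' a.
have ck : cancel (act g') (act g) by apply: act_cancel; [exact: adj_iso|exact: adj_iso|exact: isoK].
have ck' : cancel (act g) (act g') by apply: act_cancel; [exact: adj_iso|exact: adj_iso|exact: isoK].
rewrite [RHS](@eq_Ex _ _ _ _ _ _ (fun f => expR (lam * restricted_time L a b (f \o act g)))); last first.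
  by move=> f; rewrite restricted_iso.
rewrite -(Ex_map_index l (EL (3 * L)) (fun f => expR (lam * restricted_time L a b f)) (fun=> 0) ck ck').
apply: (@Ex_same _ _ _ _ _ _ (fun e => (e \in EL (3 * L)) && (act g e \in EL (3 * L)))) => //.
- move=> f f' ff; congr (expR (_ * _)); apply: restricted_agree => p e pA ep; apply: ff.
  rewrite (admissible_edges aL pA ep) /=.
  apply: (@admissible_edges L a' (g b) (map g p)) => //; first by rewrite admissible_iso.
  move: ep => /mapP [s ss ->]; have /mem_admissible [pp _ _ _] := pA.
  have := pp; rewrite path_steps => /allP/(_ _ ss) ad.
  rewrite -act_edge //; last exact: adj_iso.
  rewrite -(iso_left s1 s2 a a') -/g; apply/mapP; exists (g s.1, g s.2) => //.
  by rewrite steps_map; apply/mapP; exists s.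
- exact: uniq_EL.
- by rewrite map_inj_uniq ?uniq_EL //; exact: can_inj ck.
- move=> e /andP[e1 e2]; rewrite e1; by apply/esym/mapP; exists (act g e).
Qed.

End PathLists.

Section Deviation.
Variable R : realType.
Implicit Types (f w : edge -> R) (a b : vtx) (p : seq vtx) (l : seq (R * R)) (L : nat).

Definition deviates l L (lam dl : R) f := exists a b, [/\ (nrm a <= L)%N, (nrm b <= L)%N &
  dl <= `|restricted_time L a b f - log_mgf l L lam a b|].

Lemma size_VL L : size (VL L) = (L.*2.+1 * L.*2.+1)%N.
Proof. by rewrite size_allpairs !size_iota. Qed.

Lemma ler_sum_mem (T : eqType) (s : seq T) (F : T -> R) x : (forall y, 0 <= F y) -> x \in s ->
  F x <= \sum_(y <- s) F y.
Proof.
move=> F0 xs; rewrite (perm_big _ (perm_to_rem xs)) big_cons lerDl.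
by apply: sumr_ge0 => y _.
Qed.

Lemma deviates_prob (al A : R) : 0 < al -> 0 < A -> exists C lam0 : R, [/\ 0 < C, 0 < lam0 &
  forall (lam : R) l, 0 < lam -> lam <= lam0 -> law l -> all (fun x => 0 <= x.2) l ->
    wmean l (fun x => expR (al * x)) <= A ->
  forall (L : nat) (dl : R), 0 < dl ->
    Ex l (EL (3 * L)) (fun f => ind R (deviates l L lam dl f)) (fun=> 0) <=
      (size (VL L) * size (VL L))%:R * (2 * expR (C * lam ^+ 2 * L%:R - lam * dl))].
Proof.
move=> al0 A0; have [C [lam0 [C0 lam00 H]]] := concentration edge al0 A0.
exists C, lam0; split=> // lam l lam1 laml hl lx lA L dl dl0.
have {}H := H lam l lam1 laml hl lx lA.
set B := 2 * _; have B0 : 0 <= B by rewrite mulr_ge0 ?expR_ge0.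
have pr a b : (nrm a <= L)%N ->
  Ex l (EL (3 * L)) (fun f => ind R (dl <= `|restricted_time L a b f - log_mgf l L lam a b|)) (fun=> 0) <= B.
  move=> aL; rewrite /log_mgf; case E : (admissible L a b) => [|p0 G].
    under eq_Ex do rewrite /restricted_time E.
    rewrite mulr0 expR0 (Ex_cst _ 1) // ln1 mul0r subrr normr0 ind0; last by move=> h; move: dl0; rewrite ltNge h.
    by rewrite Ex_cst.
  have rE : @restricted_time R L a b = summin (edges a p0) (map (edges a) G).
    by apply/funext => f; rewrite /restricted_time E.
  rewrite rE.
  have cG c : c \in edges a p0 :: map (edges a) G -> exists2 p, p \in admissible L a b & c = edges a p.
    by rewrite -map_cons -E => /mapP.
  have u1 : all uniq (edges a p0 :: map (edges a) G).
    by apply/allP => c /cG [p /mem_admissible [pp _ up _] ->]; exact: uniq_edges.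
  have s1 : all (fun c => size c <= L)%N (edges a p0 :: map (edges a) G).
    by apply/allP => c /cG [p /mem_admissible [_ _ _ sp] ->]; rewrite size_edges.
  have c1 : all (fun c => all [in EL (3 * L)] c) (edges a p0 :: map (edges a) G).
    by apply/allP => c /cG [p pA ->]; apply/allP => e ep; exact: admissible_edges aL pA ep.
  exact: (H (edges a p0) (map (edges a) G) (EL (3 * L)) (fun=> 0) L dl (uniq_EL _) u1 s1 (fun=> lexx _) c1 _ erefl).
apply: (@le_trans _ _ (\sum_(a <- VL L) \sum_(b <- VL L) B)); last first.
  by rewrite !big_const_seq !count_predT !iter_addr_0 -mulrnA mulr_natl.
apply: (@le_trans _ _ (Ex l (EL (3 * L)) (fun f => \sum_(a <- VL L) \sum_(b <- VL L)
    ind R (dl <= `|restricted_time L a b f - log_mgf l L lam a b|)) (fun=> 0))).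
  apply: Ex_le => // f; have s0 : 0 <= \sum_(a <- VL L) \sum_(b <- VL L)
      ind R (dl <= `|restricted_time L a b f - log_mgf l L lam a b|).
    by do 2 (apply: sumr_ge0 => ? _); exact: ind_ge0.
  have [dv|dv] := pselect (deviates l L lam dl f); last by rewrite ind0.
  have [a [b [aL bL h]]] := dv; rewrite ind1 //.
  have av : a \in VL L by rewrite mem_VL.
  have bv : b \in VL L by rewrite mem_VL.
  rewrite -(ind1 R h).
  pose D a b : R := ind R (dl <= `|restricted_time L a b f - log_mgf l L lam a b|).
  have D0 x y : 0 <= D x y by exact: ind_ge0.
  have g1 : D a b <= \sum_(y <- VL L) D a y by exact: (@ler_sum_mem _ _ (D a) b (D0 a) bv).
  have S0 x : 0 <= \sum_(y <- VL L) D x y by apply: sumr_ge0 => y _; exact: D0.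
  have g2 : \sum_(y <- VL L) D a y <= \sum_(x <- VL L) \sum_(y <- VL L) D x y.
    exact: (@ler_sum_mem _ _ (fun x => \sum_(y <- VL L) D x y) a S0 av).
  exact: le_trans g1 g2.
rewrite Ex_sum big_seq [leRHS]big_seq; apply: ler_sum => a; rewrite mem_VL => aL.
by rewrite Ex_sum; apply: ler_sum => b _; exact: pr.
Qed.

(** Both restricted times lie within [dl] of the same centre, and replacing [w] by [f] costs at most
    [L * eps] along each of the two paths. *)
Lemma not_deviates_concentrated l L (lam dl eps : R) f w : law l -> 0 <= eps -> (forall e, 0 <= w e) ->
  (forall e, e \in EL (3 * L) -> `|w e - f e| <= eps) -> ~ deviates l L lam dl f ->
  concentrated w L (2 * dl + 2 * (L%:R * eps)).
Proof.
move=> hl e0 w0 wf nd a b a' p aL bL a'L lL ab pp up sp.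
have near x y q : (nrm x <= L)%N -> q \in admissible L x y ->
    `|path_time w x q - path_time f x q| <= L%:R * eps.
  move=> xL qA; rewrite !path_time_edges -sumrB.
  apply: le_trans (ler_norm_sum _ _ _) _.
  apply: (@le_trans _ _ (\sum_(e <- edges x q) eps)).
    rewrite big_seq [leRHS]big_seq; apply: ler_sum => e eq; apply: wf.
    exact: admissible_edges xL qA eq.
  rewrite big_const_seq count_predT iter_addr_0 size_edges -[leLHS]mulr_natl.
  by apply: ler_wpM2r => //; rewrite ler_nat; case/mem_admissible: qA.
have dev x y : (nrm x <= L)%N -> (nrm y <= L)%N ->
    `|restricted_time L x y f - log_mgf l L lam x y| < dl.
  by move=> xL yL; rewrite ltNge; apply/negP => h; apply: nd; exists x, y.
set b' := last a' p in ab lL.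
have pA : p \in admissible L a' b' by apply/mem_admissible.
have [s1 [s2 ie]] := eqd_iso ab.
have q0A : map (iso s1 s2 a' a) p \in admissible L a b.
  have := @admissible_iso L s1 s2 a a' b (map (iso s1 s2 a' a) p).
  by rewrite ie (mapK (@isoK s1 s2 a' a)) pA => <-.
have [q qA qE] := restricted_attained f q0A.
have [pq lq _ _] := (mem_admissible _ _ _ _).1 qA.
have h1 : passage_time w a b <= path_time w a q by exact: passage_le.
have h2 := near _ _ _ aL qA; have h3 := near _ _ _ a'L pA.
have h4 := dev _ _ aL bL; have h5 := dev _ _ a'L lL.
have h6 := restricted_le f pA; have h7 := log_mgf_eqd lam hl aL a'L ab.
rewrite h7 qE in h4.
move: h2 h3 h4 h5; rewrite !ler_norml !ltr_norml => /andP[_ h2] /andP[h3 _] /andP[_ h4] /andP[h5 _].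
by lra.
Qed.

End Deviation.

(** * Transfer to the probability space *)

Section Transfer.
Variables (d : measure_display) (T : measurableType d) (R : realType) (P : probability T R).

Lemma prob_partition (W : eqType) (vals : seq W) (X : W -> set T) : uniq vals ->
  (forall v, measurable (X v)) -> (forall u v w, X u w -> X v w -> u = v) ->
  measurable [set w | exists2 v, v \in vals & X v w] /\
  P [set w | exists2 v, v \in vals & X v w] = (\sum_(v <- vals) fine (P (X v)))%:E.
Proof.
move=> + mX dX; elim: vals => [_|v vals IH /andP[vn /IH [m IHP]]].
  rewrite (_ : [set w | _] = set0); first by rewrite big_nil measure0.
  by apply/seteqP; split=> // w [v].
have E : [set w | exists2 u, u \in v :: vals & X u w] = X v `|` [set w | exists2 u, u \in vals & X u w].
  apply/seteqP; split=> w /=.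
    move=> [u]; rewrite in_cons => /orP[/eqP->|uv]; [by left|by right; exists u].
  move=> [vw|[u uv uw]]; first by exists v; rewrite ?mem_head.
  by exists u; rewrite // in_cons uv orbT.
rewrite E; split; first exact: measurableU.
rewrite measureU //; last first.
  apply/seteqP; split=> // w [/= vw [u uv uw]].
  by rewrite (dX _ _ _ vw uw) uv in vn.
rewrite big_cons EFinD; congr (_ + _)%E; last exact: IHP.
by rewrite fineK ?fin_num_measure.
Qed.

Variable tau : edge -> T -> R.
Hypothesis tau_iid : iid_edge_weights P tau.

Section Quantized.
Variables (W : eqType) (K : R -> W) (vals : seq W) (e0 : edge).
Hypotheses (uv : uniq vals) (Kv : forall x, K x \in vals) (mK : forall v, measurable (K @^-1` [set v])).

Definition quantized_law : seq (R * W) :=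
  [seq (fine (P (tau e0 @^-1` (K @^-1` [set v]))), v) | v <- vals].

Let mtau e (B : set R) : measurable B -> measurable (tau e @^-1` B).
Proof.
by move=> mB; case: tau_iid => h _ _; rewrite -[_ @^-1` _]setTI; apply: h.
Qed.

Lemma law_quantized : law quantized_law.
Proof.
split; first by rewrite all_map; apply/allP => v _ /=; apply: fine_ge0.
rewrite big_map /=.
have [_ h] := @prob_partition W vals (fun v => tau e0 @^-1` (K @^-1` [set v])) uv
  (fun v => mtau e0 (mK v)) (fun u v w h1 h2 => etrans (esym h1) h2).
apply: EFin_inj; rewrite -h -(@probability_setT _ _ _ P); congr (P _).
by apply/seteqP; split=> // w _; exists (K (tau e0 w)).
Qed.

Definition cyl (t : seq edge) (B : edge -> set R) : set T := \bigcap_(e in [set` t]) (tau e @^-1` B e).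

Definition conf (s : seq edge) (f : edge -> W) (w : T) : edge -> W :=
  fun e => if e \in s then K (tau e w) else f e.

Lemma prob_cyl t B : uniq t -> (forall e, measurable (B e)) ->
  P (cyl t B) = (\prod_(e <- t) fine (P (tau e @^-1` B e)))%:E.
Proof.
move=> ut mB; case: tau_iid => _ h _; rewrite /cyl h //.
elim: t {ut} => [|e t IH]; first by rewrite !big_nil.
by rewrite !big_cons IH EFinM fineK // fin_num_measure //; exact: mtau.
Qed.

Lemma measurable_cyl t B : (forall e, measurable (B e)) -> measurable (cyl t B).
Proof. by move=> mB; apply: fin_bigcap_measurable => // e _; exact: mtau. Qed.

Lemma prob_conf s t B f (A : (edge -> W) -> Prop) : uniq (s ++ t) -> (forall e, measurable (B e)) ->
  measurable ([set w | A (conf s f w)] `&` cyl t B) /\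
  P ([set w | A (conf s f w)] `&` cyl t B) =
    (Ex quantized_law s (fun f => ind R (A f)) f * \prod_(e <- t) fine (P (tau e @^-1` B e)))%:E.
Proof.
elim: s t B f => [|e s IH] t B f; rewrite ?cat0s => us mB.
  have -> : [set w | A (conf [::] f w)] = [set _ | A f] by apply/seteqP; split.
  have [a|a] := pselect (A f).
    rewrite (_ : [set _ | A f] = setT); last by apply/seteqP; split.
    rewrite setTI /= ind1 // mul1r; split; first exact: measurable_cyl.
    exact: prob_cyl.
  rewrite (_ : [set _ | A f] = set0); last by apply/seteqP; split.
  by rewrite set0I measure0 /= ind0 // mul0r.
pose Bv v := fun x => if x == e then K @^-1` [set v] else B x.
have mBv v x : measurable (Bv v x) by rewrite /Bv; case: ifP.
move: us; rewrite cat_cons => /andP[en us].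
have us' : uniq (s ++ e :: t) by rewrite uniq_catC cat_cons cons_uniq mem_cat orbC -mem_cat en uniq_catC.
pose X v := [set w | A (conf s (upd f e v) w)] `&` cyl (e :: t) (Bv v).
have [es et] : e \notin s /\ e \notin t by move: en; rewrite mem_cat negb_or => /andP[].
have cylE v w : cyl (e :: t) (Bv v) w <-> K (tau e w) = v /\ cyl t B w.
  split.
    move=> h; split; first by have := h e (mem_head _ _); rewrite /Bv /= eqxx.
    move=> x xt; have := h x; rewrite /Bv /= in_cons xt orbT => /(_ isT).
    by case: eqP => // xe; move: et; rewrite -xe xt.
  move=> [h1 h2] x; rewrite /= in_cons => /orP[/eqP->|xt]; rewrite /Bv; first by rewrite eqxx.
  by case: eqP => // xe; [move: et; rewrite -xe xt|exact: h2].
have confE w : conf (e :: s) f w = conf s (upd f e (K (tau e w))) w.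
  apply/funext => x; rewrite /conf /upd in_cons.
  by case: (x =P e) => [->|]; rewrite ?(negPf es).
have E : [set w | A (conf (e :: s) f w)] `&` cyl t B = [set w | exists2 v, v \in vals & X v w].
  apply/seteqP; split=> w.
    move=> [/= a c]; exists (K (tau e w)) => //; split; first by rewrite /= -confE.
    by apply/cylE.
  move=> [v _ [a /cylE [h c]]]; split=> //=.
  by rewrite confE h.
have [m PE] := @prob_partition W vals X uv (fun v => (IH _ _ _ us' (mBv v)).1)
  (fun u v w h1 h2 => etrans (esym ((cylE _ _).1 h1.2).1) ((cylE _ _).1 h2.2).1).
rewrite E; split=> //; rewrite PE; congr (_%:E).
rewrite [X in _ = X * _]/= {1}/quantized_law big_map big_distrl /=; apply: eq_bigr => v _.
rewrite (IH _ _ _ us' (mBv v)).2 /= big_cons {1}/Bv eqxx.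
have -> : fine (P (tau e @^-1` (K @^-1` [set v]))) = fine (P (tau e0 @^-1` (K @^-1` [set v]))).
  by case: tau_iid => _ _ h; rewrite (h e e0).
rewrite mulrCA mulrA; congr (_ * _); rewrite big_seq [RHS]big_seq; apply: eq_bigr => x xt.
by rewrite /Bv; case: eqP => // xe; move: et; rewrite -xe xt.
Qed.

Lemma transfer s f (A : (edge -> W) -> Prop) : uniq s ->
  (forall f g, (forall e, e \in s -> f e = g e) -> A f -> A g) ->
  measurable [set w | A (fun e => K (tau e w))] /\
  P [set w | A (fun e => K (tau e w))] = (Ex quantized_law s (fun f => ind R (A f)) f)%:E.
Proof.
move=> us Ad; have us0 : uniq (s ++ [::]) by rewrite cats0.
have := @prob_conf s [::] (fun=> setT) f A us0 (fun _ => measurableT).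
rewrite big_nil mulr1 (_ : cyl [::] _ = setT); last by apply/seteqP; split=> // w _ e.
rewrite setIT (_ : [set w | A (conf s f w)] = [set w | A (fun e => K (tau e w))]) //.
by apply/seteqP; split=> w /=; apply: Ad => e es; rewrite /conf es.
Qed.

End Quantized.
End Transfer.

(** * Borel-Cantelli and moment bounds on the probability space *)

Section Probability.
Variables (d : measure_display) (T : measurableType d) (R : realType) (P : probability T R).

Lemma sum_inv_sqr (N : nat) : \sum_(n < N) (n.+1%:R ^+ 2)^-1 <= 2 :> R.
Proof.
suff h : \sum_(n < N.+1) (n.+1%:R ^+ 2)^-1 <= 2 - N.+1%:R^-1 :> R.
  apply: (@le_trans _ _ (\sum_(n < N.+1) (n.+1%:R ^+ 2)^-1)).
    by rewrite big_ord_recr /= lerDl invr_ge0 sqr_ge0.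
  by apply: le_trans h _; rewrite lerBlDr lerDl invr_ge0.
elim: N => [|N IH]; first by rewrite big_ord1 expr1n invr1; lra.
rewrite big_ord_recr; apply: (le_trans (lerD IH (lexx _))).
rewrite /= -[N.+2%:R]natr1; set x : R := N.+1%:R; have x0 : 0 < x by rewrite ltr0n.
have y0 : 0 < x + 1 by lra.
rewrite -subr_ge0 (_ : _ - _ = (x * (x + 1) ^+ 2)^-1); last by field; rewrite !gt_eqF.
by rewrite invr_ge0 mulr_ge0 ?sqr_ge0 // ltW.
Qed.

Lemma borel_cantelli (F : nat -> set T) (c : R) (n1 : nat) : 0 <= c ->
  (forall n, measurable (F n)) ->
  (forall n, (n1 <= n)%N -> (P (F n) <= (c / n.+1%:R ^+ 2)%:E)%E) ->
  {ae P, forall w, exists n0, forall n, (n0 <= n)%N -> ~ F n w}.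
Proof.
move=> c0 mF PF; pose G n := F (n + n1)%N.
have PG n : (P (G n) <= (c * (n.+1%:R ^+ 2)^-1)%:E)%E.
  apply: le_trans (PF _ (leq_addl _ _)) _; rewrite lee_fin; apply: ler_wpM2l => //.
  rewrite lef_pV2 ?posrE ?exprn_gt0 ?ltr0n //.
  by apply: lerXn2r; rewrite ?nnegrE ?ler0n // ler_nat ltnS leq_addr.
have null : P (lim_sup_set G) = 0%E.
  apply: lim_sup_set_cvg0 => [n|]; first exact: mF.
  apply: (@le_lt_trans _ _ (c * 2)%:E); last by rewrite ltry.
  apply: lime_le; first by apply: is_cvg_nneseries => n _ _; exact: measure_ge0.
  near=> N; apply: (@le_trans _ _ (\sum_(0 <= n < N) (c * (n.+1%:R ^+ 2)^-1)%:E)%E).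
    by apply: lee_sum => n _; exact: PG.
  rewrite sumEFin lee_fin -big_distrr /= big_mkord; apply: ler_wpM2l => //.
  exact: sum_inv_sqr.
have ml : measurable (lim_sup_set G).
  apply: bigcapT_measurable => n; apply: bigcup_measurable => j _; exact: mF.
exists (lim_sup_set G); split=> // w /= nw n _.
apply: contrapT => h; apply: nw; exists (n + n1)%N => m nm Fm; apply: h.
have n1m : (n1 <= m)%N by apply: leq_trans nm; exact: leq_addl.
exists (m - n1)%N => /=; first by rewrite leq_subRL // addnC.
by rewrite /G subnK.
Unshelve. all: by end_near. Qed.

(** Continuity from above: [P (X < 1/n)] tends to [P (X <= 0)], which equals [P (X = 0)] and is
    below 1/2. *)
Lemma low_threshold (X : T -> R) : measurable_fun setT X -> P [set w | 0 <= X w] = 1%E ->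
  (P [set w | X w = 0%R] < (1 / 2 : R)%:E)%E ->
  exists2 dl : R, 0 < dl & fine (P [set w | X w < dl]) < 2^-1.
Proof.
move=> mX X0 Xz.
have mlt (a : R) : measurable [set w | X w < a].
  rewrite (_ : [set w | X w < a] = X @^-1` `]-oo, a[%classic); last first.
    by apply/seteqP; split=> w /=; rewrite in_itv.
  by rewrite -[_ @^-1` _]setTI; apply: mX.
pose F (n : nat) := [set w | X w < n.+1%:R^-1].
have capE : \bigcap_n F n = [set w | X w <= 0].
  apply/seteqP; split=> w /= h.
    rewrite leNgt; apply/negP => Xp.
    have := h (Num.truncn (X w)^-1) I; rewrite /F /=.
    have := truncnS_gt (X w)^-1; rewrite -[X in _ < X -> _]invrK ltf_pV2 ?posrE ?invr_gt0 ?ltr0n // => h1 h2.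
    by have := lt_trans h1 h2; rewrite ltxx.
  by move=> n _ /=; apply: le_lt_trans h _; rewrite invr_gt0.
have mcap : measurable (\bigcap_n F n) by apply: bigcapT_measurable => n; exact: mlt.
have cv : P \o F @ \oo --> P (\bigcap_n F n).
  apply: nonincreasing_cvg_mu => //.
  - by apply: le_lt_trans (probability_le1 P (mlt _)) _; rewrite ltry.
  - by move=> i; exact: mlt.
  - move=> m n mn; apply/subsetPset => w /= h; apply: lt_le_trans h _.
    by rewrite lef_pV2 ?posrE ?ltr0n // ler_nat.
have Pcap : (P (\bigcap_n F n) < (1 / 2 : R)%:E)%E.
  apply: le_lt_trans Xz; rewrite capE.
  have mz : measurable [set w | X w = 0].
    rewrite (_ : [set w | X w = 0] = X @^-1` [set 0]) //.
    by rewrite -[_ @^-1` _]setTI; apply: mX.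
  have E : [set w | X w <= 0] = [set w | X w = 0] `|` [set w | X w < 0].
    apply/seteqP; split=> w /=; last by move=> [->//|/ltW].
    by rewrite le_eqVlt => /orP[/eqP|]; [left|right].
  rewrite E; apply: le_trans (measureU2 _ mz (mlt 0)) _.
  suff z : P [set w | X w < 0] = 0%E.
    by rewrite -[leRHS]adde0; apply: leeD => //; rewrite le_eqVlt; apply/orP; left; apply/eqP; exact: z.
  have -> : [set w | X w < 0] = ~` [set w | 0 <= X w].
    by apply/seteqP; split=> w /=; rewrite ltNge; [move=> /negP|move=> /negP].
  rewrite probability_setC; first by rewrite X0 subee.
  rewrite (_ : [set w | 0 <= X w] = ~` [set w | X w < 0]); first exact: measurableC.
  by apply/seteqP; split=> w /=; rewrite leNgt; [move=> /negP|move=> /negP].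
have : \forall n \near \oo, (P (F n) < (1 / 2 : R)%:E)%E.
  exact: (cv _ (open_ereal_lt' Pcap)).
move=> [N _ hN]; exists N.+1%:R^-1; first by rewrite invr_gt0.
have := hN N (leqnn _); rewrite /F.
by rewrite -[P _]fineK ?fin_num_measure // lte_fin; lra.
Qed.

(** A step function lying below [g]. It serves for the moment of the rounded weights and, with a
    single set, as Markov's inequality. *)
Lemma mgf_sum (I : eqType) (s : seq I) (F : I -> set T) (c : I -> R) (g : T -> R) :
  uniq s -> (forall i, measurable (F i)) -> trivIset [set` s] F -> measurable_fun setT g ->
  (forall w, 0 <= g w) -> (forall i, i \in s -> 0 <= c i) ->
  (forall i w, i \in s -> F i w -> c i <= g w) ->
  ((\sum_(i <- s) fine (P (F i)) * c i)%:E <= \int[P]_w (g w)%:E)%E.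
Proof.
move=> us mF tF mg g0 c0 cg.
have mgE (D : set T) : measurable_fun D (EFin \o g) by apply/measurable_EFinP; exact: measurable_funTS.
apply: (@le_trans _ _ (\int[P]_(w in \big[setU/set0]_(i <- s) F i) (g w)%:E)%E); last first.
  apply: ge0_subset_integral => //; first exact: bigsetU_measurable.
  by move=> w _; rewrite lee_fin.
rewrite ge0_integral_bigsetU //; last by move=> w _; rewrite lee_fin.
rewrite -sumEFin big_seq [leRHS]big_seq; apply: lee_sum => i si.
rewrite EFinM fineK ?fin_num_measure // muleC -integral_cst //.
apply: ge0_le_integral => //.
- by move=> w _; rewrite lee_fin c0.
- by move=> w Fw; rewrite lee_fin; exact: cg.
Qed.

End Probability.

(** * Linear growth, almost surely *)

Section Growth.
Variables (d : measure_display) (T : measurableType d) (R : realType) (P : probability T R).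
Variable tau : edge -> T -> R.
Hypothesis tau_iid : iid_edge_weights P tau.
Hypothesis tau_ge0 : forall e, P [set w | 0 <= tau e w] = 1%E.

Lemma measurable_preim e (B : set R) : measurable B -> measurable (tau e @^-1` B).
Proof. by move=> mB; case: tau_iid => h _ _; rewrite -[_ @^-1` _]setTI; apply: h. Qed.

Lemma ae_nonneg : {ae P, forall w, forall e, 0 <= tau e w}.
Proof.
have h n : {ae P, forall w, forall e, unpickle n = Some e -> 0 <= tau e w}.
  case: (unpickle n) => [e|]; last by apply: aeW => w e.
  have m : measurable [set w | 0 <= tau e w].
    rewrite (_ : [set w | _] = tau e @^-1` `[0, +oo[%classic); first exact: measurable_preim.
    by apply/seteqP; split=> w /=; rewrite in_itv /= andbT.
  exists (~` [set w | 0 <= tau e w]); split; first exact: measurableC.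
    by rewrite probability_setC // tau_ge0 subee.
  by move=> w /= nw hw; apply: nw => e' [<-].
have := ae_foralln h; apply: filterS => w hw e.
by apply: (hw (pickle e)); rewrite pickleK.
Qed.

Lemma path_time_nhigh (w : edge -> R) (dl : R) (x : vtx) (p : seq vtx) : (forall e, 0 <= w e) -> 0 <= dl ->
  dl * (nhigh (fun e => w e < dl) x p)%:R <= path_time w x p.
Proof.
move=> w0 dl0; elim: p x => [|y p IH] x; first by rewrite path_time_nil /nhigh /= mulr0.
rewrite path_time_cons /nhigh -[steps _ _]/((x, y) :: steps y p) [count _ _]/= natrD mulrDr.
apply: lerD; last exact: IH.
by rewrite -leNgt; case: (leP dl) => h /=; rewrite ?mulr1 ?mulr0 ?w0.
Qed.

Lemma nhigh_take (b : edge -> bool) (x : vtx) (p : seq vtx) m : (nhigh b x (take m p) <= nhigh b x p)%N.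
Proof.
elim: m p x => [|m IH] [|y p] x //; rewrite /nhigh [take _ _]/=.
rewrite -[steps x _]/((x, y) :: steps y (take m p)) -[X in (_ <= count _ X)%N]/((x, y) :: steps y p).
by rewrite /= leq_add2l; apply: IH.
Qed.

(** Cutting a slow path after [j * vol l] steps leaves a slow path, so the event depends on finitely
    many edges. *)
Lemma slow_path_agree l j N (x : vtx) (b b' : edge -> bool) : (nrm x + j * vol l <= N)%N ->
  (forall e, e \in EL N -> b e = b' e) -> slow_path l j x b -> slow_path l j x b'.
Proof.
move=> xN bb [p [pp up sp hp]]; exists (take (j * vol l) p).
have pt : path adj x (take (j * vol l) p).
  by move: pp; rewrite -{1}(cat_take_drop (j * vol l) p) cat_path => /andP[].
have st : size (take (j * vol l) p) = (j * vol l)%N by rewrite size_takel.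
split=> //; first by move: up; rewrite -{1}(cat_take_drop (j * vol l) p) -cat_cons cat_uniq => /and3P[].
  by rewrite st.
apply: leq_trans hp; rewrite leq_mul2l /=; apply: leq_trans (nhigh_take b x p (j * vol l)).
rewrite /nhigh; apply: eq_leq; apply: eq_in_count => s ss; congr (~~ _); apply/esym; apply: bb.
have [s1 s2] := mem_steps ss.
have := pt; rewrite path_steps => al; have ad := allP al _ ss.
have h y : y \in x :: take (j * vol l) p -> box N y.
  by move=> yp; apply: leq_trans (path_nrm pt yp) _; rewrite st.
rewrite mem_EL -/(src _); case: (edge_ends ad) => -[-> _]; exact: h.
Qed.

Lemma growth_as : (forall e, (P [set w | tau e w = 0%R] < (1 / 2 : R)%:E)%E) ->
  exists (c : R) (V : nat), [/\ 0 < c, (0 < V)%N &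
  {ae P, forall w, exists k0 : nat, forall k L, (k0 <= k)%N -> (L <= 2 ^ k)%N ->
     linear_growth (tau^~ w) L (V * k) c}].
Proof.
move=> tau0; pose e0 : edge := (origin, false).
have [mt _ _] := tau_iid.
have [dl dl0 low] := low_threshold (mt e0) (tau_ge0 e0) (tau0 e0).
set q := fine _ in low.
have q0 : 0 <= q by rewrite /q fine_ge0.
have q01 : 0 <= q <= 1 by apply/andP; split=> //; lra.
have [l l0 hl] := theta_small q0 low.
pose K (x : R) := x < dl.
have Kv x : K x \in [:: true; false] by case: (K x).
have mK v : measurable (K @^-1` [set v]).
  have m1 : measurable [set x : R | x < dl].
    by rewrite (_ : [set x | _] = `]-oo, dl[%classic) //; apply/seteqP; split=> x /=; rewrite in_itv.
  case: v.
    by rewrite (_ : _ @^-1` _ = [set x : R | x < dl]) //; apply/seteqP; split=> x.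
  rewrite (_ : _ @^-1` _ = ~` [set x : R | x < dl]); first exact: measurableC.
  by apply/seteqP; split=> x /=; rewrite /K; case: (x < dl).
have lawE : quantized_law P tau K [:: true; false] e0 = pb q.
  have [_] := law_quantized tau_iid e0 (erefl : uniq [:: true; false]) Kv mK.
  rewrite /quantized_law /= !big_cons big_nil /= addr0.
  have -> : fine (P (tau e0 @^-1` (K @^-1` [set true]))) = q by congr (fine (P _)); apply/seteqP; split.
  by rewrite /pb => h; congr [:: _; (_, _)]; lra.
(* With [j = 4 * k] the probability [2 * 2 ^ (- 4 * k)] beats the at most [(3 * 2 ^ k) ^ 2] starting
   points, leaving [18 * 4 ^ (- k)]. *)
pose A k (b : edge -> bool) := exists2 x, (nrm x <= 2 ^ k)%N & slow_path l (4 * k) x b.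
pose F k := [set w | A k (fun e => K (tau e w))].
pose N k := (2 ^ k + (4 * k) * vol l + 2 * (4 * k) * l.*2.+1 + l)%N.
have tr k := @transfer _ _ _ P tau tau_iid _ K [:: true; false] e0 erefl Kv mK (EL (N k)) allc (A k) (uniq_EL _).
have Ad k f g : (forall e, e \in EL (N k) -> f e = g e) -> A k f -> A k g.
  move=> fg [x xk sp]; exists x => //; apply: (slow_path_agree _ fg sp).
  by rewrite /N; move: xk; move: (nrm x) (2 ^ k)%N (4 * k * vol l)%N (2 * (4 * k) * l.*2.+1)%N => ? ? ? ?; clear; lia.
have mF k : measurable (F k) := (tr k (Ad k)).1.
have PF k : (1 <= k)%N -> (P (F k) <= (18 / k.+1%:R ^+ 2)%:E)%E.
  move=> k1; rewrite (tr k (Ad k)).2 lawE lee_fin.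
  apply: (@le_trans _ _ (Ex (pb q) (EL (N k)) (fun b => \sum_(x <- VL (2 ^ k)) ind R (slow_path l (4 * k) x b)) allc)).
    apply: Ex_le; first exact: law_pb.
    move=> b; have [[x xk sp]|na] := pselect (A k b); last first.
      by rewrite ind0 //; apply: sumr_ge0 => x _; exact: ind_ge0.
    rewrite ind1; last by exists x.
    rewrite -(ind1 R sp).
    apply: (@ler_sum_mem R _ (VL (2 ^ k)) (fun x => ind R (slow_path l (4 * k) x b)) x).
      by move=> y; exact: ind_ge0.
    by rewrite mem_VL.
  rewrite Ex_sum.
  apply: (@le_trans _ _ (\sum_(x <- VL (2 ^ k)) 2 * 2^-1 ^+ (4 * k))).
    rewrite big_seq [leRHS]big_seq; apply: ler_sum => x; rewrite mem_VL => xk.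
    apply: slow_path_prob => //; first by rewrite muln_gt0.
    by rewrite /N; move: xk; rewrite /box; move: (nrm x) (2 ^ k)%N (4 * k * vol l)%N (2 * (4 * k) * l.*2.+1)%N => ? ? ? ?; clear; lia.
  rewrite big_const_seq count_predT iter_addr_0 size_VL -[leLHS]mulr_natr.
  pose z : R := (2 ^ k)%:R.
  have z1 : (k.+1)%:R <= z by rewrite ler_nat; exact: ltn_expl.
  have k0 : 0 < k.+1%:R :> R by rewrite ltr0n.
  have z0 : 0 < z by lra.
  have -> : 2^-1 ^+ (4 * k) = (z ^+ 4)^-1.
    by rewrite /z exprVn natrX -exprM mulnC.
  have -> : ((2 ^ k).*2.+1 * (2 ^ k).*2.+1)%:R = (2 * z + 1) ^+ 2 :> R.
    by rewrite natrM expr2 -addn1 -muln2 natrD natrM mulrC [z * 2]mulrC.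
  have h1 : (2 * z + 1) ^+ 2 <= (3 * z) ^+ 2.
    have : 1 <= k.+1%:R :> R by rewrite ler1n.
    by move=> ?; apply: lerXn2r; rewrite ?nnegrE; lra.
  rewrite ler_pdivlMr ?exprn_gt0 //.
  have h2 : k.+1%:R ^+ 2 <= z ^+ 2 by apply: lerXn2r; rewrite ?nnegrE; lra.
  apply: (@le_trans _ _ (2 * (z ^+ 4)^-1 * (3 * z) ^+ 2 * z ^+ 2)); last first.
    rewrite le_eqVlt; apply/orP; left; apply/eqP; field; rewrite gt_eqF //.
  have i0 : 0 <= 2 * (z ^+ 4)^-1 by rewrite mulr_ge0 // invr_ge0 exprn_ge0 // ltW.
  apply: ler_pM; rewrite ?sqr_ge0 //; first by rewrite mulr_ge0 ?sqr_ge0.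
  exact: ler_wpM2l.
have BC := borel_cantelli (ler0n _ 18) mF PF.
have V0 : (0 < 4 * vol l)%N by rewrite muln_gt0 /= /vol.
exists (dl / (4 * vol l)%:R), (4 * vol l)%N; split=> //; first by rewrite divr_gt0 // ltr0n.
apply: filterS2 BC ae_nonneg => w [k0 hk0] w0; exists k0.+1 => k L kk Lk x p xL pp up sp.
set V := (4 * vol l)%N in V0 sp *.
(* The scale fits the length of the path and not the box: as [k <= k'], the start is within
   [2 ^ k'], and since the path is not slow it has at least [k' + 1] edges of weight at least [dl],
   for fewer than [(k' + 1) * V] steps. *)
pose k' := (size p %/ V)%N.
have kk' : (k <= k')%N by rewrite leq_divRL // mulnC.
have k'V : (k' * V <= size p)%N by exact: leq_trunc_div.
have sp' : (size p < k'.+1 * V)%N by rewrite ltn_ceil.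
have nh : (4 * k' < 2 * nhigh (fun e => K (tau e w)) x p)%N.
  rewrite ltnNge; apply/negP => h; apply: (hk0 k'); first by apply: ltnW; exact: leq_trans kk kk'.
  exists x.
    by apply: leq_trans xL _; apply: leq_trans Lk _; rewrite leq_exp2l.
  exists p; split=> //; apply: leq_trans k'V; rewrite /V; move: (vol l) => v; clear; nia.
have k'1 : (1 <= k')%N by apply: leq_trans kk'; apply: leq_trans kk.
apply: le_trans (path_time_nhigh x p w0 (ltW dl0)).
rewrite -mulrA; apply: ler_wpM2l; first exact: ltW.
rewrite ler_pdivrMl ?ltr0n // -natrM ler_nat.
have : (k'.+1 <= nhigh (fun e => K (tau e w)) x p)%N.
  by move: (nhigh _ x p) nh k'1 => v; clear; lia.
move=> h; apply: ltnW; apply: leq_trans sp' _; rewrite mulnC; exact: leq_mul.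
Qed.

End Growth.

(** * Rounded weights and almost sure concentration *)

Section Discretization.
Variables (d : measure_display) (T : measurableType d) (R : realType) (P : probability T R).
Variable tau : edge -> T -> R.
Hypothesis tau_iid : iid_edge_weights P tau.
Variables (al M : R).
Hypotheses (al0 : 0 < al) (M0 : 0 <= M).
Let e0 : edge := (origin, false).
Hypothesis mgf : (\int[P]_w (expR (al * tau e0 w))%:E = M%:E)%E.

(* The cap makes the discretized law finite; almost surely it is eventually
   not reached. *)
Definition quant (n : nat) (x : R) : nat := minn (Num.truncn (n%:R * x)) (n ^ 2).

Lemma quant_gt n x m : (m < quant n x)%N -> m.+1%:R <= n%:R * x.
Proof. by rewrite leq_min => /andP[h _]; rewrite -truncn_gt_nat. Qed.

Lemma quant_near n x : (0 < n)%N -> 0 <= x -> x < n%:R -> `|x - (quant n x)%:R / n%:R| <= n%:R^-1.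
Proof.
move=> n0 x0 xn; have nr : 0 < n%:R :> R by rewrite ltr0n.
have nx0 : 0 <= n%:R * x by rewrite mulr_ge0 // ltW.
have /andP[h1 h2] := truncn_itv nx0.
have -> : quant n x = Num.truncn (n%:R * x).
  apply/minn_idPl; rewrite -(ler_nat R); apply: le_trans h1 _.
  by rewrite natrX expr2 ler_pM2l // ltW.
set k := Num.truncn _ in h1 h2 *.
have -> : x - k%:R / n%:R = (n%:R * x - k%:R) / n%:R by rewrite mulrBl mulrAC mulfV ?mul1r // gt_eqF.
have k0 : 0 <= n%:R * x - k%:R by lra.
rewrite ger0_norm; last by rewrite divr_ge0 // ltW.
rewrite -[leRHS]mul1r; apply: ler_wpM2r; first by rewrite invr_ge0 ltW.
by rewrite -natr1 in h2; lra.
Qed.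

Definition levels (n : nat) := iota 0 (n ^ 2).+1.

Lemma quant_levels n x : quant n x \in levels n.
Proof. by rewrite mem_iota /= add0n ltnS geq_minr. Qed.

Lemma measurable_quant n k : measurable (quant n @^-1` [set k]).
Proof.
have mQ m : measurable [set x | (m <= quant n x)%N].
  case: m => [|m]; first by rewrite (_ : [set x | _] = setT) //; apply/seteqP; split.
  have [mn|mn] := leqP m.+1 (n ^ 2); last first.
    rewrite (_ : [set x | _] = set0) //; apply/seteqP; split=> // x /= h.
    by move: (leq_trans h (geq_minr _ _)); rewrite leqNgt mn.
  have n0 : 0 < n%:R :> R by rewrite ltr0n; case: (n) mn => //.
  rewrite (_ : [set x | _] = `[m.+1%:R / n%:R, +oo[%classic) //.
  apply/seteqP; split=> x /=; rewrite in_itv /= andbT ler_pdivrMr // mulrC.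
    exact: quant_gt.
  by move=> h; rewrite leq_min mn andbT truncn_gt_nat.
rewrite (_ : _ @^-1` _ = [set x | (k <= quant n x)%N] `\` [set x | (k.+1 <= quant n x)%N]).
  exact: measurableD.
apply/seteqP; split=> x /=; first by move=> ->; rewrite leqnn ltnn.
by move=> [h1 /negP]; rewrite -leqNgt => h2; apply/eqP; rewrite eqn_leq h1 h2.
Qed.

Definition level_value (n k : nat) : R := k%:R / n%:R.
Definition disc_law n : seq (R * R) :=
  [seq (x.1, level_value n x.2) | x <- quantized_law P tau (quant n) (levels n) e0].

Let qlaw n := law_quantized tau_iid e0 (iota_uniq 0 (n ^ 2).+1) (quant_levels n) (measurable_quant n).

Lemma law_disc n : law (disc_law n).
Proof.
have [l0 l1] := qlaw n; split; first by rewrite /disc_law all_map.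
by rewrite /disc_law big_map.
Qed.

Lemma disc_ge0 n : all (fun x => 0 <= x.2) (disc_law n).
Proof. by rewrite /disc_law !all_map; apply/allP => k _ /=; rewrite divr_ge0. Qed.

Lemma measurable_mgf : measurable_fun setT (fun w => expR (al * tau e0 w)).
Proof.
case: tau_iid => mt _ _.
have ml : measurable_fun setT (fun w => al * tau e0 w) by exact: measurable_funM.
exact: (measurableT_comp (@measurable_expR R) ml).
Qed.

(** Rounding down keeps positive levels below the true weight, so they contribute at most [M]. Level
    0 also collects negative values and is bounded separately by 1. *)
Lemma disc_mgf n : (0 < n)%N -> wmean (disc_law n) (fun x => expR (al * x)) <= 1 + M.
Proof.
move=> n0; have nr : 0 < n%:R :> R by rewrite ltr0n.
pose F k := tau e0 @^-1` (quant n @^-1` [set k]).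
have mF k : measurable (F k) := measurable_preim tau_iid e0 (measurable_quant n k).
rewrite /wmean /disc_law /quantized_law /levels !big_map /= big_cons; apply: lerD.
  rewrite /level_value mul0r mulr0 expR0 mulr1.
  have h := probability_le1 P (mF 0%N).
  by move: h; rewrite -{1}[P _]fineK ?fin_num_measure // lee_fin.
rewrite -lee_fin -mgf.
apply: (@mgf_sum _ _ _ P _ (iota 1 (n ^ 2)) F (fun k => expR (al * level_value n k))
  (fun w => expR (al * tau e0 w)) (iota_uniq 1 (n ^ 2)) mF) => //.
- by move=> i j _ _ [w [/= h1 h2]]; rewrite -h1 -h2.
- exact: measurable_mgf.
- move=> i w; rewrite mem_iota => /andP[i1 _] /= Fi; rewrite ler_expR ler_pM2l //.
  rewrite /level_value ler_pdivrMr // mulrC; case: i i1 Fi => [//|i] _ Fi.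
  by apply: quant_gt; rewrite Fi.
Qed.

Lemma tail_bound e n : (P [set w | (n%:R <= tau e w)%R] <= (M * expR (- (al * n%:R)))%:E)%E.
Proof.
have mB : measurable [set x : R | n%:R <= x].
  rewrite (_ : [set x | _] = `[n%:R, +oo[%classic) //.
  by apply/seteqP; split=> x /=; rewrite in_itv /= andbT.
have -> : P [set w | (n%:R <= tau e w)%R] = P (tau e0 @^-1` [set x | n%:R <= x]).
  by case: tau_iid => _ _ h; rewrite -(h e e0).
have mF := measurable_preim tau_iid e0 mB.
have := @mgf_sum _ _ _ P unit [:: tt] (fun=> tau e0 @^-1` [set x | n%:R <= x])
  (fun=> expR (al * n%:R)) (fun w => expR (al * tau e0 w)) erefl (fun=> mF).
rewrite mgf big_seq1 lee_fin => h.
have {}h : fine (P (tau e0 @^-1` [set x | n%:R <= x])) * expR (al * n%:R) <= M.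
  apply: h => //.
  - by move=> [] [] _ _ _.
  - exact: measurable_mgf.
  - by move=> _ w _ /= h; rewrite ler_expR ler_pM2l.
by rewrite -[leLHS]fineK ?fin_num_measure // lee_fin expRN ler_pdivlMr ?expR_gt0.
Qed.

Lemma prob_union (I : choiceType) (s : seq I) (X : I -> set T) (b : R) : (forall i, measurable (X i)) ->
  (forall i, (P (X i) <= b%:E)%E) -> (P (\bigcup_(i in [set` s]) X i) <= ((size s)%:R * b)%:E)%E.
Proof.
move=> mX PX; elim: s => [|i s IH]; first by rewrite set_nil bigcup_set0 measure0 mul0r.
have -> : \bigcup_(j in [set` i :: s]) X j = X i `|` \bigcup_(j in [set` s]) X j.
  apply/seteqP; split=> w.
    by move=> [j /=]; rewrite in_cons => /orP[/eqP->|js] h; [left|right; exists j].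
  move=> [h|[j /= js h]]; first by exists i => //=; exact: mem_head.
  by exists j => //=; rewrite in_cons js orbT.
rewrite /= -natr1 addrC mulrDl mul1r EFinD.
apply: le_trans (measureU2 _ _ _) _ => //; first by apply: fin_bigcup_measurable.
by apply: leeD; [exact: PX|exact: IH].
Qed.

Lemma ln_le_sqrt (x : R) : 0 < x -> ln x <= 2 * Num.sqrt x.
Proof.
move=> x0; have s0 : 0 < Num.sqrt x by rewrite sqrtr_gt0.
have {1}-> : x = Num.sqrt x ^+ 2 by rewrite sqr_sqrtr // ltW.
rewrite lnXn // -[leLHS]mulr_natl ler_pM2l //.
exact: ltW (ln_sublinear s0).
Qed.

Lemma concentrated_as (a : nat) : (0 < a)%N -> (forall e, P [set w | 0 <= tau e w] = 1%E) ->
  exists2 B : R, 0 < B & {ae P, forall w, exists n0 : nat, forall n, (n0 <= n)%N ->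
    concentrated (tau^~ w) (a * n) (2 * (B * Num.sqrt (n%:R * ln n%:R)) + 2 * a%:R)}.
Proof.
move=> a0 tau_ge0; have A0 : 0 < 1 + M by rewrite ltr_pwDl.
have [C [lam0 [C0 lam00 H]]] := deviates_prob al0 A0.
(* With [lam n] and [dl n] below, the exponent [C * lam ^ 2 * L - lam * dl] equals
   [(C * a - B) * ln n = - 6 * ln n]: four powers of [n] for the pairs of points, two for
   summability. *)
pose B := C * a%:R + 6; have B0 : 0 < B by rewrite /B ltr_pwDr // mulr_ge0 // ltW.
exists B => //.
pose L n := (a * n)%N.
pose lam n : R := Num.sqrt (ln n%:R / n%:R).
pose dl n : R := B * Num.sqrt (n%:R * ln n%:R).
pose bad n (f : edge -> nat) := deviates (disc_law n) (L n) (lam n) (dl n) (level_value n \o f).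
have Ad n f g : (forall e, e \in EL (3 * L n) -> f e = g e) -> bad n f -> bad n g.
  move=> fg [x [y [xL yL h]]]; exists x, y; split=> //.
  rewrite -(@restricted_agree R (L n) x y (level_value n \o f)) // => p e pA ep.
  by rewrite /= fg //; exact: admissible_edges xL pA ep.
have tr n := transfer tau_iid e0 (iota_uniq 0 (n ^ 2).+1) (quant_levels n) (measurable_quant n)
  (fun=> 0%N) (uniq_EL (3 * L n)) (Ad n).
pose F1 n := [set w | bad n (fun e => quant n (tau e w))].
have mF1 n : measurable (F1 n) := (tr n).1.
(* The square of [lam n] is [ln n / n <= 2 / sqrt n], whence the threshold in terms of [lam0]. *)
have [n1 hn1] : exists n1 : nat, forall n, (n1 <= n)%N -> (2 <= n)%N /\ lam n <= lam0.
  exists (Num.bound (4 / lam0 ^+ 4)).+2 => n hn; split; first by apply: leq_trans hn.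
  have n0 : 0 < n%:R :> R by rewrite ltr0n; apply: leq_trans hn.
  have s0 : 0 < Num.sqrt n%:R :> R by rewrite sqrtr_gt0.
  have hb : 4 / lam0 ^+ 4 <= n%:R.
    apply: le_trans (_ : (Num.bound (4 / lam0 ^+ 4))%:R <= _); last by rewrite ler_nat; do 2 apply: ltnW.
    by apply: ltW; apply: archi_boundP; rewrite divr_ge0 // exprn_ge0 // ltW.
  have h2 : 2 / lam0 ^+ 2 <= Num.sqrt n%:R.
    have p0 : 0 <= 2 / lam0 ^+ 2 by rewrite divr_ge0 ?sqr_ge0.
    rewrite -(ger0_norm p0) -sqrtr_sqr ler_sqrt //.
    by apply: le_trans hb; rewrite exprMn exprVn -exprM le_eqVlt; apply/orP; left; apply/eqP; congr (_ / _); ring.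
  rewrite /lam -(ger0_norm (ltW lam00)) -sqrtr_sqr ler_sqrt ?sqr_ge0 // ler_pdivrMr //.
  apply: le_trans (ln_le_sqrt n0) _.
  have e : n%:R = Num.sqrt n%:R * Num.sqrt n%:R :> R by rewrite -expr2 sqr_sqrtr // ltW.
  rewrite [X in _ <= _ * X]e mulrA ler_pM2r //.
  by move: h2; rewrite ler_pdivrMr ?exprn_gt0 // mulrC.
have PF1 n : (n1 <= n)%N -> (P (F1 n) <= ((648 * a%:R ^+ 4) / n.+1%:R ^+ 2)%:E)%E.
  move=> /hn1 [n2 laml].
  have n0 : (0 < n)%N by apply: leq_trans n2.
  have nr : 0 < n%:R :> R by rewrite ltr0n.
  have ln0 : 0 < ln n%:R :> R by rewrite ln_gt0 // ltr1n.
  have lam1 : 0 < lam n by rewrite sqrtr_gt0 divr_gt0.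
  have dl0 : 0 < dl n by rewrite mulr_gt0 // sqrtr_gt0 mulr_gt0.
  have := H (lam n) (disc_law n) lam1 laml (law_disc n) (disc_ge0 n) (disc_mgf n0) (L n) (dl n) dl0.
  rewrite /F1 (tr n).2 lee_fin.
  have -> : (fun=> 0 : R) = level_value n \o (fun _ : edge => 0%N).
    by apply/funext => e; rewrite /level_value /= mul0r.
  rewrite (Ex_map_law _ _ (level_value n)) => h; apply: le_trans h _.
  have -> : C * lam n ^+ 2 * (L n)%:R - lam n * dl n = - (6 * ln n%:R).
    rewrite /lam /dl /L sqr_sqrtr; last by rewrite divr_ge0 ?ltW.
    have -> : Num.sqrt (ln n%:R / n%:R) * (B * Num.sqrt (n%:R * ln n%:R)) = B * ln n%:R.
      rewrite mulrCA -sqrtrM ?divr_ge0 ?ltW //; congr (_ * _).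
      rewrite (_ : ln n%:R / n%:R * (n%:R * ln n%:R) = ln n%:R ^+ 2 :> R) ?sqrtr_sqr ?gtr0_norm //.
      by field; rewrite gt_eqF.
    by rewrite natrM /B; field; rewrite gt_eqF.
  have -> : expR (- (6 * ln n%:R)) = (n%:R ^+ 6)^-1 :> R by rewrite expRN expRM_natl lnK ?posrE.
  pose z : R := n%:R; rewrite -/z in nr *.
  have ar : 1 <= a%:R :> R by rewrite ler1n.
  have z1 : 1 <= z by rewrite /z ler1n.
  have az : 1 <= a%:R * z by rewrite -[leLHS]mulr1; apply: ler_pM.
  have h1 : (size (VL (L n)) * size (VL (L n)))%:R <= (9 * (a%:R * z) ^+ 2) ^+ 2 :> R.
    have h2 : (size (VL (L n)))%:R <= 9 * (a%:R * z) ^+ 2 :> R.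
      rewrite size_VL natrM -addn1 -muln2 natrD natrM /L natrM.
      rewrite (_ : 9 * _ = (3 * (a%:R * z)) * (3 * (a%:R * z))); last by ring.
      by apply: ler_pM; rewrite ?addr_ge0 ?mulr_ge0 ?ler0n //; rewrite -/z; lra.
    by rewrite natrM expr2; apply: ler_pM.
  have y0 : 0 <= 2 * (z ^+ 6)^-1 by rewrite mulr_ge0 // invr_ge0 exprn_ge0 // ltW.
  apply: le_trans (ler_wpM2r y0 h1) _.
  rewrite ler_pdivlMr ?exprn_gt0 ?ltr0n //.
  have hz : n.+1%:R ^+ 2 <= (2 * z) ^+ 2.
    by apply: lerXn2r; rewrite ?nnegrE ?mulr_ge0 ?ler0n //; rewrite -natr1 -/z; lra.
  have w0 : 0 <= (9 * (a%:R * z) ^+ 2) ^+ 2 * (2 * (z ^+ 6)^-1) by rewrite mulr_ge0 ?sqr_ge0.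
  apply: le_trans (ler_wpM2l w0 hz) _.
  by rewrite le_eqVlt; apply/orP; left; apply/eqP; field; rewrite gt_eqF.
(* Outside this event no relevant weight reaches [n], so the cap is inactive and rounding changes
   each weight by at most [1/n], a total of at most [a] along a path of [a * n] edges. *)
pose F2 n := \bigcup_(e in [set` EL (3 * L n)]) [set w | n%:R <= tau e w].
have mE n e : measurable [set w | n%:R <= tau e w].
  have mB : measurable [set x : R | n%:R <= x].
    rewrite (_ : [set x | _] = `[n%:R, +oo[%classic) //.
    by apply/seteqP; split=> x /=; rewrite in_itv /= andbT.
  exact: (measurable_preim tau_iid e mB).
have mF2 n : measurable (F2 n) by apply: fin_bigcup_measurable => // e _; exact: mE.
pose cc := 98 * a%:R ^+ 2 * M * (16 * (2 / al) ^+ 4) * 4.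
have PF2 n : (1 <= n)%N -> (P (F2 n) <= (cc / n.+1%:R ^+ 2)%:E)%E.
  move=> n0; have nr : 0 < n%:R :> R by rewrite ltr0n.
  have := @prob_union edge (EL (3 * L n)) (fun e => [set w | n%:R <= tau e w]) (M * expR (- (al * n%:R))).
  move=> /(_ (mE n) (fun e => tail_bound e n)) h; apply: le_trans h _; rewrite lee_fin.
  pose z : R := n%:R; rewrite -/z in nr *.
  have z1 : 1 <= z by rewrite /z ler1n.
  have ar : 1 <= a%:R :> R by rewrite ler1n.
  have az : 1 <= a%:R * z by rewrite -[leLHS]mulr1; apply: ler_pM.
  have h1 : (size (EL (3 * L n)))%:R <= 98 * (a%:R * z) ^+ 2 :> R.
    rewrite size_allpairs size_VL /= !natrM -addn1 -muln2 natrD !natrM -/z.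
    rewrite (_ : 98 * _ = (7 * (a%:R * z)) * (7 * (a%:R * z)) * 2); last by ring.
    apply: ler_pM => //; first by rewrite !mulr_ge0 ?addr_ge0 ?mulr_ge0 ?ler0n.
    by apply: ler_pM; rewrite ?addr_ge0 ?mulr_ge0 ?ler0n //; rewrite -/z; lra.
  have h2 : expR (- (al * z)) <= 16 * (2 / al) ^+ 4 * (z ^+ 4)^-1.
    have alz : 0 < al * z by exact: mulr_gt0.
    have y0 : 0 <= al * z / 2 by rewrite divr_ge0 // ltW.
    have h3 := sqr_le_expR y0.
    have h4 : ((al * z / 2) ^+ 2) ^+ 2 <= (4 * expR (al * z / 2)) ^+ 2.
      by apply: lerXn2r; rewrite ?nnegrE ?sqr_ge0 ?mulr_ge0 ?expR_ge0.
    have h5 : (4 * expR (al * z / 2)) ^+ 2 = 16 * expR (al * z).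
      rewrite exprMn -expRM_natl (_ : 2%:R * (al * z / 2) = al * z); last by field.
      by congr (_ * _); ring.
    rewrite h5 in h4.
    rewrite expRN -[leLHS]mul1r ler_pdivrMr ?expR_gt0 //.
    have k0 : 0 < ((al * z / 2) ^+ 2) ^+ 2 by rewrite !exprn_gt0 // divr_gt0 // mulr_gt0.
    have -> : 16 * (2 / al) ^+ 4 * (z ^+ 4)^-1 * expR (al * z) = (16 * expR (al * z)) / ((al * z / 2) ^+ 2) ^+ 2.
      by field; rewrite !gt_eqF.
    by rewrite ler_pdivlMr // mul1r.
  have p1 : 0 <= M * expR (- (al * z)) by rewrite mulr_ge0 ?expR_ge0.
  apply: le_trans (ler_wpM2r p1 h1) _.
  have p2 : 0 <= 98 * (a%:R * z) ^+ 2 by rewrite mulr_ge0 ?sqr_ge0.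
  apply: le_trans (ler_wpM2l p2 (ler_wpM2l M0 h2)) _.
  rewrite ler_pdivlMr ?exprn_gt0 ?ltr0n //.
  have hz : n.+1%:R ^+ 2 <= (2 * z) ^+ 2.
    by apply: lerXn2r; rewrite ?nnegrE ?mulr_ge0 ?ler0n //; rewrite -natr1 -/z; lra.
  have q0 : 0 <= 98 * (a%:R * z) ^+ 2 * (M * (16 * (2 / al) ^+ 4 * (z ^+ 4)^-1)).
    apply: mulr_ge0 => //; apply: mulr_ge0 => //; apply: mulr_ge0.
      by rewrite mulr_ge0 // exprn_ge0 // divr_ge0 // ltW.
    by rewrite invr_ge0 exprn_ge0 // ltW.
  apply: le_trans (ler_wpM2l q0 hz) _.
  by rewrite /cc le_eqVlt; apply/orP; left; apply/eqP; field; rewrite !gt_eqF.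
have cc0 : 0 <= cc.
  have i0 : 0 <= 2 / al by rewrite divr_ge0 // ltW.
  have i4 : 0 <= (2 / al) ^+ 4 by rewrite exprn_ge0.
  have ia : 0 <= 98 * a%:R ^+ 2 :> R by rewrite mulr_ge0 ?sqr_ge0.
  by rewrite /cc; apply: mulr_ge0 => //; apply: mulr_ge0; [apply: mulr_ge0|apply: mulr_ge0].
have c1 : 0 <= 648 * a%:R ^+ 4 :> R.
  by apply: mulr_ge0; [exact: ler0n|apply: exprn_ge0; exact: ler0n].
have BC1 := borel_cantelli c1 mF1 PF1.
have BC2 := borel_cantelli cc0 mF2 PF2.
have ae0 := ae_nonneg tau_iid tau_ge0.
move: BC1 BC2 ae0; apply: filterS3 => w [m1 hm1] [m2 hm2] w0; exists (maxn (maxn m1 m2) 1) => n.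
rewrite !geq_max => /andP[/andP[nm1 nm2] n1'].
have nr : 0 < n%:R :> R by rewrite ltr0n.
have e1 : 2 * a%:R = 2 * ((a * n)%:R * n%:R^-1) :> R.
  by rewrite natrM mulfK // gt_eqF.
rewrite e1; apply: (@not_deviates_concentrated R (disc_law n) (L n) (lam n) (dl n) n%:R^-1
  (level_value n \o (fun e => quant n (tau e w)))) => //.
- exact: law_disc.
- move=> e ee; apply: quant_near => //; rewrite ltNge; apply/negP => h.
  by apply: (hm2 n nm2); exists e.
- by apply: hm1.
Qed.

End Discretization.

(** * Proof of the theorem *)

Section Numeric.
Variable R : realType.

Lemma sqr_le_exp2 k : (k ^ 2 <= 4 * 2 ^ k)%N.
Proof.
suff h : (k ^ 2 <= 4 * 2 ^ k)%N /\ (2 * k + 1 <= 4 * 2 ^ k)%N by case: h.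
elim: k => [//|k [h1 h2]]; rewrite [(2 ^ k.+1)%N]expnS; move: (2 ^ k)%N h1 h2 => x.
by rewrite -!mulnn => h1 h2; split; nia.
Qed.

(** [2 ^ k] is the first power of 2 above [a * n], so [k <= 8 * a * s]. In [E] the first summand
    makes [c * D0] exceed [2 * W + 1] and the second makes [D0] exceed [V * k], for [D0] the integer
    just above [E * s]. Rounding is absorbed by [s >= 1]. *)
Lemma eventual_bounds (a V k0 : nat) (B c : R) : (0 < a)%N -> (0 < V)%N -> 0 < B -> 0 < c -> 3 <= c * a%:R ->
  let E := (4 * B + 4 * a%:R + 1) / c + 8 * a%:R * V%:R in
  exists N : nat, forall n, (N <= n)%N ->
    let s := Num.sqrt (n%:R * ln n%:R) in let W := 2 * (B * s) + 2 * a%:R in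
    1 <= ln n%:R :> R /\ exists k D0 : nat,
    [/\ (k0 <= k)%N /\ (a * n <= 2 ^ k)%N, (V * k <= a * n)%N /\ (V * k <= D0)%N,
        (0 < D0)%N /\ n%:R + W + 3 <= c * (a * n)%:R, 2 * W + 1 <= c * D0%:R &
        (8 * D0).+1%:R <= (8 * E + 9) * s].
Proof.
move=> a0 V0 B0 c0 ca E.
have ar : 1 <= a%:R :> R by rewrite ler1n.
have Vr : 1 <= V%:R :> R by rewrite ler1n.
have E0 : 0 <= E.
  rewrite /E addr_ge0 ?divr_ge0 ?mulr_ge0 ?ler0n ?(ltW c0) //; lra.
exists ((2 ^ k0 + 8 * V ^ 2) + (4 * a + 3) + (Num.bound ((32 * B ^+ 2) ^+ 2) + Num.bound (expR 1 : R)))%N.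
move=> n; set b1 := Num.bound _; set b2 := Num.bound _ => hn s W.
have [n1 n2 n3] : [/\ (2 ^ k0 <= n)%N, (8 * V ^ 2 <= n)%N & (4 * a + 3 <= n)%N].
  by move: (2 ^ k0)%N (V ^ 2)%N b1 b2 hn => x y z t; clear; split; lia.
have [n4 n5] : (b1 <= n)%N /\ (b2 <= n)%N.
  by move: (2 ^ k0)%N (V ^ 2)%N b1 b2 hn => x y z t; clear; lia.
have nr : 3 <= n%:R :> R by rewrite ler_nat; apply: leq_trans n3; exact: leq_addl.
have nr0 : 0 < n%:R :> R by lra.
have le1 : 1 <= ln n%:R :> R.
  rewrite -[leLHS]expRK ler_ln ?posrE ?expR_gt0 //.
  apply: le_trans (_ : b2%:R <= _); last by rewrite ler_nat.
  by apply: ltW; apply: archi_boundP; exact: expR_ge0.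
split=> //.
have s1 : 1 <= s.
  rewrite -[leLHS]sqrtr1 ler_sqrt; last by rewrite mulr_ge0 ?ler0n // ltW // (lt_le_trans ltr01).
  by rewrite -[leLHS]mulr1; apply: ler_pM => //; lra.
have ss : s ^+ 2 = n%:R * ln n%:R by rewrite sqr_sqrtr // mulr_ge0 ?ler0n //; lra.
have sB : 4 * B * s <= n%:R.
  have h1 : 32 * B ^+ 2 <= Num.sqrt n%:R.
    have p0 : 0 <= 32 * B ^+ 2 by rewrite mulr_ge0 ?sqr_ge0.
    rewrite -(ger0_norm p0) -sqrtr_sqr ler_sqrt //.
    apply: le_trans (_ : b1%:R <= _); last by rewrite ler_nat.
    by apply: ltW; apply: archi_boundP; exact: sqr_ge0.
  have h2 := ln_le_sqrt nr0.
  have nn : n%:R = Num.sqrt n%:R ^+ 2 :> R by rewrite sqr_sqrtr // ltW.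
  have q0 : 0 <= Num.sqrt n%:R :> R by exact: sqrtr_ge0.
  have h3 : (4 * B * s) ^+ 2 <= n%:R ^+ 2.
    rewrite exprMn ss.
    have h4 : (4 * B) ^+ 2 * ln n%:R <= n%:R.
      apply: (@le_trans _ _ ((4 * B) ^+ 2 * (2 * Num.sqrt n%:R))); first by apply: ler_wpM2l; rewrite ?sqr_ge0.
      rewrite [leRHS]nn; have := ler_wpM2r q0 h1.
      by rewrite !expr2; lra.
    rewrite [leRHS]expr2 mulrCA; apply: ler_wpM2l; [exact: ltW|exact: h4].
  have p1 : 0 <= 4 * B * s by rewrite !mulr_ge0 ?(ltW B0) //; lra.
  by rewrite -(ler_pXn2r (n := 2)) ?nnegrE //; exact: ltW.
have W0 : 0 <= W by rewrite /W addr_ge0 ?mulr_ge0 ?ler0n ?(ltW B0) //; lra.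
have Wn : W <= n%:R.
  have : 4 * a%:R <= n%:R :> R by rewrite -natrM ler_nat; apply: leq_trans n3; exact: leq_addr.
  by rewrite /W; move: sB; lra.
have Ws : 2 * W + 1 <= (4 * B + 4 * a%:R + 1) * s.
  have h : a%:R <= a%:R * s by rewrite ler_peMr ?ler0n.
  by rewrite /W; lra.
pose L := (a * n)%N.
have L0 : (0 < L)%N by rewrite muln_gt0 a0 /=; apply: leq_trans n3; rewrite addn_gt0 orbT.
pose k := (trunc_log 2 L).+1.
have kL : (L < 2 ^ k)%N := trunc_log_ltn L (ltnSn 1).
have kL2 : (2 ^ k <= 2 * L)%N by rewrite expnS leq_mul2l /=; exact: trunc_logP.
have k2 : (k ^ 2 <= 8 * L)%N.
  by apply: leq_trans (sqr_le_exp2 k) _; move: (2 ^ k)%N kL2 => x; clear; lia.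
have kk0 : (k0 <= k)%N.
  rewrite -(leq_exp2l _ _ (ltnSn 1)); apply: leq_trans (ltnW kL); apply: leq_trans n1 _.
  by rewrite leq_pmull.
have VL : (V * k <= L)%N.
  rewrite -leq_sqr expnMn; apply: leq_trans (_ : V ^ 2 * (8 * L) <= _)%N; first by rewrite leq_mul2l k2 orbT.
  rewrite mulnCA mulnA -[(L ^ 2)%N]mulnn; apply: leq_mul => //; apply: leq_trans n2 _.
  by rewrite leq_pmull.
have ks : k%:R <= 8 * a%:R * s.
  have p1 : 0 <= 8 * a%:R * s by rewrite !mulr_ge0 ?ler0n //; lra.
  rewrite -(ler_pXn2r (n := 2)) ?nnegrE ?ler0n //.
  apply: (@le_trans _ _ (8 * L)%:R); first by rewrite -natrX ler_nat.
  rewrite exprMn ss /L !natrM mulrA.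
  apply: (@le_trans _ _ ((8 * a%:R) ^+ 2 * n%:R)).
    apply: ler_wpM2r; first exact: ltW.
    by rewrite expr2 ler_peMr //; lra.
  by apply: ler_wpM2l; rewrite ?sqr_ge0 // ler_peMr // ltW.
have Es0 : 0 <= E * s by rewrite mulr_ge0 //; lra.
have /andP[d1 d2] := truncn_itv Es0.
have Vks : (V * k)%:R <= E * s.
  rewrite natrM; apply: le_trans (ler_wpM2l (ler0n _ V) ks) _.
  rewrite /E mulrDl; have : 0 <= (4 * B + 4 * a%:R + 1) / c * s.
    by rewrite mulr_ge0 ?divr_ge0 ?(ltW c0) //; lra.
  by lra.
exists k, (Num.truncn (E * s)).+1; split=> //.
- by split=> //; exact: ltnW.
- by split=> //; rewrite -(ler_nat R); apply: ltW; apply: le_lt_trans d2.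
- by split=> //; rewrite natrM mulrA; have := ler_wpM2r (ltW nr0) ca; lra.
- apply: le_trans Ws _; apply: (@le_trans _ _ (c * (E * s))); last by rewrite ler_pM2l // ltW.
  rewrite mulrA; apply: ler_wpM2r; first by lra.
  rewrite /E mulrDr mulrCA mulfV ?gt_eqF // mulr1 lerDl.
  by rewrite !mulr_ge0 ?ler0n // ltW.
- rewrite -natr1 natrM -natr1; have : (Num.truncn (E * s))%:R <= E * s by [].
  by lra.
Qed.

End Numeric.

Theorem theorem3 (d : measure_display) (T : measurableType d) (R : realType)
  (P : probability T R) (tau : edge -> T -> R) :
  iid_edge_weights P tau ->
  (forall e, P [set w | (0 <= tau e w)%R] = 1%E) ->
  (forall e, (P [set w | tau e w = 0%R] < (1 / 2 : R)%:E)%E) ->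
  (exists2 alpha : R, 0 < alpha &
     forall e, (\int[P]_w (expR (alpha * tau e w))%:E < +oo)%E) ->
  exists2 C : R, 0 < C &
    {ae P, forall w, exists t0 : R, forall t : R, t0 <= t ->
       (M_max (fun e => tau e w) t <= (C * t * ln t)%:E)%E}.
Proof.
move=> iid ge0 lt0 [al al0 fin].
have I0 : (0 <= \int[P]_w (expR (al * tau (origin, false) w))%:E)%E.
  by apply: integral_ge0 => w _; rewrite lee_fin expR_ge0.
set M := fine (\int[P]_w (expR (al * tau (origin, false) w))%:E)%E.
have mgf : (\int[P]_w (expR (al * tau (origin, false) w))%:E = M%:E)%E.
  by rewrite /M fineK // ge0_fin_numE.
have M0 : 0 <= M by rewrite -lee_fin -mgf.
have [c [V [c0 V0 gr]]] := growth_as iid ge0 lt0.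
(* Then [c * (a * n) >= 3 * n], which leaves room for [n + W + 3] once [W] and 3 are at most [n]. *)
pose a := (Num.bound (3 / c)).+1.
have ca : 3 <= c * a%:R.
  rewrite mulrC -ler_pdivrMr //; apply: le_trans (_ : (Num.bound (3 / c))%:R <= _); last by rewrite ler_nat.
  by apply: ltW; apply: archi_boundP; rewrite divr_ge0 // ltW.
have [B B0 cc] := concentrated_as iid al0 M0 mgf (ltn0Sn _ : (0 < a)%N) ge0.
pose E := (4 * B + 4 * a%:R + 1) / c + 8 * a%:R * V%:R.
have E0 : 0 <= E.
  by rewrite /E addr_ge0 ?divr_ge0 ?mulr_ge0 ?ler0n ?(ltW c0) // !addr_ge0 ?mulr_ge0 ?ler0n // ltW.
(* The factor 4 comes from passing from [n] to [t]: [n <= 2 * t] and [ln n <= 2 * ln t]. *)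
pose C := 4 * (8 * E + 9) ^+ 2.
have C0 : 0 < C by rewrite /C mulr_gt0 // exprn_gt0 //; lra.
exists C => //; have nn := ae_nonneg iid ge0.
move: gr cc nn; apply: filterS3 => w [k0 hk] [n0 hn] w0.
have [N hN] := eventual_bounds k0 (ltn0Sn _ : (0 < a)%N) V0 B0 c0 ca.
exists ((maxn n0 N)%:R + 2) => t tN; have N0 : 0 <= (maxn n0 N)%:R :> R := ler0n _ _.
have t2 : 2 <= t by lra.
have t0 : 0 <= t by lra.
(* Since [t < n <= t + 1], the event at the integer scale [n] serves all real [t] in between, so
   countably many scales suffice. *)
pose n := (Num.truncn t).+1.
have /andP[n1 n2] := truncn_itv t0; rewrite -/n in n2.
have nmax : (maxn n0 N <= n)%N by rewrite -(ler_nat R); lra.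
have nn0 : (n0 <= n)%N by apply: leq_trans nmax; exact: leq_maxl.
have nN : (N <= n)%N by apply: leq_trans nmax; exact: leq_maxr.
have [ln1 [k [D0 [[kk Lk] [VL VD] [D1 tL] WD Ds]]]] := hN n nN.
set s := Num.sqrt _ in Ds tL WD; set W := 2 * (B * s) + 2 * a%:R in tL WD.
have s0 : 0 <= s := sqrtr_ge0 _.
have W0 : 0 <= W by rewrite /W addr_ge0 ?mulr_ge0 ?ler0n ?(ltW B0).
have gw : good (tau^~ w) (a * n) (V * k) c W.
  by split; [exact: w0|exact: hk k (a * n)%N kk Lk|exact: hn].
have tL' : t + W + 3 <= c * (a * n)%:R by lra.
have lt0' : 0 <= ln t by apply: ln_ge0; lra.
apply: ge_ereal_sup => _ [[m hm <-]|->]; rewrite lee_fin; last first.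
  by apply: mulr_ge0 => //; apply: mulr_ge0 => //; exact: ltW.
have hm' := hole_size c0 W0 VL tL' VD D1 WD gw hm.
apply: (@le_trans _ _ (((8 * D0).+1 * (8 * D0).+1)%:R)); first by rewrite ler_nat.
rewrite natrM; apply: (@le_trans _ _ (((8 * E + 9) * s) * ((8 * E + 9) * s))).
  by apply: ler_pM; rewrite ?ler0n.
have nr : n%:R <= t + 1 by rewrite /n -natr1; lra.
have ss : s * s = n%:R * ln n%:R.
  by rewrite -expr2 sqr_sqrtr // mulr_ge0 ?ler0n //; lra.
rewrite (_ : _ * _ = (8 * E + 9) ^+ 2 * (s * s)); last by ring.
rewrite ss /C (_ : 4 * _ * t * ln t = (8 * E + 9) ^+ 2 * ((2 * t) * (2 * ln t))); last by ring.
apply: ler_wpM2l; first exact: sqr_ge0.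
have ln2 : ln n%:R <= 2 * ln t.
  have t0' : 0 < t by lra.
  have <- : ln (t ^+ 2) = 2 * ln t by rewrite lnXn // -[LHS]mulr_natl.
  rewrite ler_ln ?posrE ?exprn_gt0 ?ltr0n // expr2.
  have : 2 * t <= t * t by rewrite ler_pM2r.
  by lra.
by apply: ler_pM; rewrite ?ler0n //; lra.
Qed.
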